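(* Let $k\ge1$, let $\lambda_1,\ldots,\lambda_k\in\mathbb{C}\setminus\{0\}$, and consider the foliation $(\mathbb{D}^k,\mathscr{L},\{0\})$ which is the restriction to the unit polydisc $\mathbb{D}^k$ of the foliation associated to the vector field $F(z)=\sum_{j=1}^k\lambda_jz_j\frac{\partial}{\partial z_j}$. Put $$\lambda_*:=\frac{\max\{|\lambda_1|,\ldots,|\lambda_k|\}}{\min\{|\lambda_1|,\ldots,|\lambda_k|\}}.$$ Then for every compact subset $K$ of $\mathbb{D}^k$, the hyperbolic entropy $h(K)$ of $K$ is bounded from above by $70k\lambda_*$.
   Context: Leaves. For $x=(x_1,\ldots,x_k)\in\mathbb{D}^k\setminus\{0\}$ let $\varphi_x(\zeta)=(x_1e^{\lambda_1\zeta},\ldots,x_ke^{\lambda_k\zeta})$, $\zeta\in\mathbb{C}$, and $\Pi_x:=\varphi_x^{-1}(\mathbb{D}^k)$, a convex domain of $\mathbb{C}$ containing $0$. The leaf through $x$ is $\widehat L_x:=\varphi_x(\Pi_x)$; it is universally covered by the unit disc $\mathbb{D}$. Hyperbolic entropy. The Poincaré metric on $\mathbb{D}$ has length element $\frac{2|d\zeta|}{1-|\zeta|^2}$; $\mathbb{D}_R$ is the disc of center $0$ and radius $R$ for this metric. For $x\in\mathbb{D}^k\setminus\{0\}$ let $\widehat\phi_x:\mathbb{D}\to\widehat L_x$ be a universal covering map with $\widehat\phi_x(0)=x$ (unique up to a rotation of $\mathbb{D}$); $\widehat\phi_0$ is the constant map $0$. With $\mathrm{dist}$ the Euclidean distance,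 put $\mathrm{dist}_R(x,y):=\inf_{\theta\in\mathbb{R}}\sup_{\xi\in\mathbb{D}_R}\mathrm{dist}(\widehat\phi_x(\xi),\widehat\phi_y(e^{i\theta}\xi))$. The Bowen $(R,\epsilon)$-ball of center $x$ is $\{y:\mathrm{dist}_R(x,y)<\epsilon\}$. For a non-empty $K\subset\mathbb{D}^k$ let $N(K,R,\epsilon)$ be the minimal number of Bowen $(R,\epsilon)$-balls needed to cover $K$, and $h(K):=\sup_{\epsilon>0}\limsup_{R\to\infty}\frac1R\log N(K,R,\epsilon)$. *)

(* Defs.v *)
From HB Require Import structures.
From mathcomp Require Import all_boot all_order all_algebra.
From mathcomp Require Import all_classical all_reals all_analysis.
From mathcomp Require Import complex.

Set Implicit Arguments.
Unset Strict Implicit.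
Unset Printing Implicit Defensive.

Import Order.TTheory GRing.Theory Num.Theory.
Import numFieldNormedType.Exports.
Import ComplexField.Normc.

Local Open Scope classical_set_scope.
Local Open Scope ring_scope.

(* The regular alias [^o] is what carries the usual topology and normed-module
   structure of the concrete numFieldType [R[i]]. In particular [derivable] for
   functions on [cplx R] is complex differentiability. *)
Notation cplx R := ((complex R)^o) (only parsing).

Section Defs.
Variable R : realType.
Local Notation C := (cplx R).

Definition cexp (z : C) : C :=
  Complex (expR (complex.Re z) * cos (complex.Im z))
          (expR (complex.Re z) * sin (complex.Im z)).

Definition disc : set C := [set z | normc z < 1].

Section Polydisc.
Variable k : nat.

Definition polydisc : set 'rV[C]_k := [set z | forall j, normc (z 0 j) < 1].

(* The norm MathComp puts on row vectors is the sup norm, hence this. *)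
Definition euclid_dist (z w : 'rV[C]_k) : R :=
  Num.sqrt (\sum_(j < k) normc (z 0 j - w 0 j) ^+ 2).

Variable lam : 'I_k -> C.

Definition flow (x : 'rV[C]_k) (zeta : C) : 'rV[C]_k :=
  \row_(j < k) (x 0 j * cexp (lam j * zeta)).

Definition flow_domain (x : 'rV[C]_k) : set C := flow x @^-1` polydisc.

Definition leaf (x : 'rV[C]_k) : set 'rV[C]_k := flow x @` flow_domain x.

(* Leaf topology: the quotient topology induced by
   [flow x : flow_domain x -> leaf x]. It is in general strictly finer than the
   topology induced by C^k, since leaves need not be embedded (they may
   accumulate on themselves). [flow_domain x] is open, so that being
   open in it is the same as being open in C. *)
Definition leaf_open (x : 'rV[C]_k) (U : set 'rV[C]_k) : Prop :=
  U `<=` leaf x /\ open (flow_domain x `&` flow x @^-1` U).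

(* [U] is evenly covered by [f : disc -> leaf x]: the part of the disc over [U]
   is a disjoint union of open sheets, each mapped homeomorphically onto [U]
   for the leaf topology. *)
Definition evenly_covered (x : 'rV[C]_k) (f : C -> 'rV[C]_k)
    (U : set 'rV[C]_k) : Prop :=
  exists sheets : set (set C),
    [/\ forall V, sheets V -> open V,
        trivIset sheets id,
        \bigcup_(V in sheets) V = disc `&` f @^-1` U &
        forall V, sheets V ->
          [/\ set_inj V f, f @` V = U &
              forall W, W `<=` V -> (open W <-> leaf_open x (f @` W))]].

(* The total space being the (simply connected) disc, a holomorphic covering
   map onto [leaf x] is a universal one. The leaf is an immersed complex curve:
   a map into it is holomorphic iff it is continuous for the leaf topology
   (which follows from the covering property) and holomorphic as a map
   into C^k. *)
Definition universal_covering (x : 'rV[C]_k) (f : C -> 'rV[C]_k) : Prop :=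
  [/\ forall xi, disc xi -> forall j, derivable (fun z : C => f z 0 j : C) xi 1,
      f @` disc = leaf x &
      forall p, leaf x p ->
        exists U, [/\ leaf_open x U, U p & evenly_covered x f U]].

(* [phi x] is a universal covering map of the leaf through [x] sending 0 to [x];
   it is unique up to a rotation of the disc, and is constant for [x = 0].
   Values outside the unit disc are irrelevant. *)
Definition leaf_coverings (phi : 'rV[C]_k -> C -> 'rV[C]_k) : Prop :=
  (forall xi, disc xi -> phi 0 xi = 0) /\
  (forall x, polydisc x -> x != 0 ->
     universal_covering x (phi x) /\ phi x 0 = x).

(* For k = 0 this is the junk value 0 / 0 = 0. *)
Definition lambda_star : R :=
  let M := \big[Order.max/0]_(j < k) normc (lam j) in
  let m := \big[Order.min/M]_(j < k) normc (lam j) in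
  M / m.

End Polydisc.

Definition C1 (u : R -> R) : Prop :=
  (forall t, derivable u t 1) /\ continuous (derive1 u).

Definition poincare_length (g : R -> C) : \bar R :=
  let u := fun t => complex.Re (g t) in
  let v := fun t => complex.Im (g t) in
  (\int[lebesgue_measure]_(t in `[0%R, 1%R])
     (2 * Num.sqrt (derive1 u t ^+ 2 + derive1 v t ^+ 2)
        / (1 - normc (g t) ^+ 2))%:E)%E.

(* Every C^1 path on [0, 1] extends to a C^1 path on R, so asking for
   differentiability on all of R is no restriction. *)
Definition poincare_path (z w : C) (g : R -> C) : Prop :=
  [/\ C1 (fun t => complex.Re (g t)), C1 (fun t => complex.Im (g t)),
      forall t, 0 <= t <= 1 -> disc (g t), g 0 = z & g 1 = w].

Definition poincare_dist (z w : C) : \bar R :=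
  ereal_inf (poincare_length @` poincare_path z w).

Definition poincare_disc (r : R) : set C :=
  [set xi | disc xi /\ (poincare_dist 0%R xi < r%:E)%E].

Section Entropy.
Variables (k : nat) (phi : 'rV[C]_k -> C -> 'rV[C]_k).

Definition bowen_dist (r : R) (x y : 'rV[C]_k) : \bar R :=
  ereal_inf (range (fun theta : R =>
    ereal_sup [set (euclid_dist (phi x xi)
                          (phi y (cexp (Complex 0 theta) * xi)))%:E
              | xi in poincare_disc r])).

Definition bowen_ball (r e : R) (x : 'rV[C]_k) : set 'rV[C]_k :=
  [set y | polydisc y /\ (bowen_dist r x y < e%:E)%E].

Definition bowen_cover (K : set 'rV[C]_k) (r e : R) (n : nat) : Prop :=
  exists c : 'I_n -> 'rV[C]_k,
    (forall i, polydisc (c i)) /\ K `<=` \bigcup_i bowen_ball r e (c i).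

(* Minimal cardinality of a cover by Bowen balls, +oo if no finite one exists.*)
Definition bowen_number (K : set 'rV[C]_k) (r e : R) : \bar R :=
  ereal_inf [set (n%:R)%:E | n in bowen_cover K r e].

Definition hyperbolic_entropy (K : set 'rV[C]_k) : \bar R :=
  ereal_sup [set limf_esup (fun r : R => (r^-1)%:E * lne (bowen_number K r e))%E
                           (pinfty_nbhs R)
            | e in [set e : R | 0 < e]].

End Entropy.
End Defs.

(* Main.v *)
Require Import Defs.
From HB Require Import structures.
From mathcomp Require Import all_boot all_order all_algebra.
From mathcomp Require Import all_classical all_reals all_analysis.
From mathcomp Require Import complex ring lra.
Import Order.TTheory GRing.Theory Num.Theory.
Import numFieldNormedType.Exports.
Import ComplexField.Normc.
Local Open Scope classical_set_scope.
Local Open Scope ring_scope.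
Set Implicit Arguments.
Unset Strict Implicit.
Unset Printing Implicit Defensive.

(** The bound follows from a count at each hyperbolic radius [h], with [E = expR h].

The leaf through [x] is parametrized by the flow on the convex domain of times
where all the [x 0 j * cexp (lam j * zeta)] have modulus less than [1]. The
universal covering [f] of the leaf lifts through the flow to a conformal map [tau]
from the disc onto this domain ([covering_lift]). Let [y] be a second point, whose
coordinates agree with those of [x] up to [E ^- 4] in logarithmic polar
coordinates, except for coordinates so small that they never matter. The half
planes [Re (lam j * zeta) < - ln (normc (x 0 j))] then hardly change, and by Harnack's
inequality [tau] maps the disc of radius [t ^+ 2], where [1 - t = E ^- 3], into the
domain of [y], and conversely ([close_inclusion]). Lifting through the covering of
the leaf of [y] turns this inclusion into a holomorphic map [g] from a slightly
smaller disc to the disc. The same construction in the other direction inverts [g]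
near [0], so that by Schwarz's lemma [g] nearly preserves the modulus there
([compare_contraction]), and by Schwarz-Pick for [g z / z] it is close to a rotation
on the hyperbolic disc of radius [h] ([near_rotation]). As the coordinates of the
coverings are bounded by [1], Schwarz-Pick again makes the two coverings [O(E ^- 1)]
close there, up to this rotation ([close_leaves]).

Points all of whose coordinates are below [expR (- E ^+ 2)] lie in one Bowen ball
about [0] ([small_leaf]). The others are sorted by rounding the capped logarithms
of the moduli and the directions of their coordinates; points with the same label
are close in the above sense, and there are at most [E ^+ (34 * k)] labels
([bowen_cover_exists]). Hence the entropy is at most [34 * k], and
[1 <= lambda_star lam].

The coverings are only known to be complex differentiable at each point, and the
function theory is built from there. Goursat's theorem gives a primitive. Its
difference quotients are twice differentiable, so that the maximum principle for
them is a second order condition at a maximum, and it passes to the limit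
([max_modulus]). Taking high powers removes exceptional points where a function is
continuous ([max_modulus_except]), and this gives the Schwarz-Pick inequality
([schwarz_pick]) and the absence of critical points for injective functions
([injective_cder_neq0]). The latter makes the lifts of [lift_exists] holomorphic. *)

(** * Complex numbers with a real-valued modulus *)

Section Basics.
Variable R : realType.
Local Notation C := (cplx R).
Implicit Types (z w a d : C) (f g : C -> C).

Lemma normcE z : `|z| = (normc z)%:C%C.
Proof. by case: z. Qed.

Lemma normc_ge0 z : 0 <= normc z.
Proof. by case: z => x y; exact: sqrtr_ge0. Qed.

Lemma normc_eq0 z : (normc z == 0) = (z == 0).
Proof.
apply/eqP/eqP => [/eq0_normc//|->]; exact: normc0.
Qed.

Lemma normcC0 : normc (0 : C) = 0.
Proof. exact: normc0. Qed.

Lemma normcC1 : normc (1 : C) = 1.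
Proof. exact: normc1. Qed.

Lemma normcCM z w : normc (z * w) = normc z * normc w.
Proof. exact: normcM. Qed.

Lemma normcCV z : normc z^-1 = (normc z)^-1.
Proof. exact: normcV. Qed.

Lemma normc_gt0 z : (0 < normc z) = (z != 0).
Proof. by rewrite lt_def normc_ge0 andbT normc_eq0. Qed.

Lemma ler_normcD z w : normc (z + w) <= normc z + normc w.
Proof. exact: le_normcD. Qed.

Lemma normc_opp z : normc (- z) = normc z.
Proof. exact: normcN. Qed.

Lemma normc_sub z w : normc (z - w) = normc (w - z).
Proof. by rewrite -opprB normc_opp. Qed.

Lemma ler_normcB z w : normc (z - w) <= normc z + normc w.
Proof. by rewrite -(normc_opp w); exact: ler_normcD. Qed.

Lemma lerB_normcD z w : normc z - normc w <= normc (z + w).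
Proof.
rewrite lerBlDr -(normc_opp w); have := ler_normcD (z + w) (- w).
by rewrite addrK.
Qed.

Lemma lerB_normc z w : normc z - normc w <= normc (z - w).
Proof. by have := lerB_normcD z (- w); rewrite normc_opp. Qed.

Lemma normc_triangle a z w : normc (z - w) <= normc (z - a) + normc (a - w).
Proof. have -> : z - w = (z - a) + (a - w) by ring.
exact: ler_normcD. Qed.

Lemma normcX z n : normc (z ^+ n) = normc z ^+ n.
Proof.
elim: n => [|n ih]; first by rewrite !expr0 normc1.
by rewrite !exprS -ih; exact: normcM.
Qed.

Lemma normc_real (x : R) : normc (x%:C%C : C) = `|x|.
Proof. by rewrite /normc /= expr0n /= addr0 sqrtr_sqr. Qed.

Lemma normc_mulr (x : R) z : normc ((x%:C%C : C) * z) = `|x| * normc z.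
Proof. by rewrite normcM normc_real. Qed.

Lemma normc_Re z : `|complex.Re z| <= normc z.
Proof.
case: z => x y /=; rewrite -sqrtr_sqr ler_wsqrtr // lerDl; exact: sqr_ge0.
Qed.

Lemma normc_Im z : `|complex.Im z| <= normc z.
Proof.
case: z => x y /=; rewrite -sqrtr_sqr ler_wsqrtr // lerDr; exact: sqr_ge0.
Qed.

Lemma normc_sqr z : normc z ^+ 2 = complex.Re z ^+ 2 + complex.Im z ^+ 2.
Proof. by case: z => x y; rewrite sqr_sqrtr // addr_ge0 // sqr_ge0. Qed.

Lemma normc_ReIm z : normc z <= `|complex.Re z| + `|complex.Im z|.
Proof.
rewrite -(ler_pXn2r (n := 2)) ?nnegrE ?normc_ge0 ?addr_ge0 //.
rewrite normc_sqr -[complex.Re z ^+ 2]real_normK ?num_real //.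
rewrite -[complex.Im z ^+ 2]real_normK ?num_real // sqrrD lerD2r lerDl.
by rewrite mulrn_wge0 // mulr_ge0.
Qed.

Lemma ReD z w : complex.Re (z + w) = complex.Re z + complex.Re w.
Proof. by case: z; case: w. Qed.
Lemma ImD z w : complex.Im (z + w) = complex.Im z + complex.Im w.
Proof. by case: z; case: w. Qed.
Lemma ReN z : complex.Re (- z) = - complex.Re z.
Proof. by case: z. Qed.
Lemma ImN z : complex.Im (- z) = - complex.Im z.
Proof. by case: z. Qed.
Lemma ReM z w : complex.Re (z * w) =
  complex.Re z * complex.Re w - complex.Im z * complex.Im w.
Proof. by case: z; case: w. Qed.

Lemma Re_mul_conj z : complex.Re (z * (z^*)%C) = normc z ^+ 2.
Proof. by rewrite normc_sqr; case: z => x y /=; ring. Qed.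

Lemma ReZ (x : R) z : complex.Re ((x%:C%C : C) * z) = x * complex.Re z.
Proof. by case: z => a b /=; ring. Qed.

Lemma cplx_eq z w : complex.Re z = complex.Re w -> complex.Im z = complex.Im w ->
  z = w.
Proof. by case: z; case: w => ? ? ? ? /= -> ->. Qed.

Lemma cnbhsP a (P : C -> Prop) : nbhs a P <->
  exists2 d : R, 0 < d & forall z, normc (z - a) < d -> P z.
Proof.
split.
- move=> /nbhs_ballP[e /= e0 eP].
  have e1 : e = (complex.Re e)%:C%C.
    by move: e0; case: e {eP} => x y; rewrite ltcE /= => /andP[/eqP -> _].
  exists (complex.Re e).
    by move: e0; rewrite ltcE /= => /andP[_].
  move=> z zd; apply: eP; rewrite -ball_normE /ball_ /= e1 normcE normc_sub.
  by rewrite ltcR.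
- move=> [d d0 dP]; apply/nbhs_ballP; exists (d%:C%C); first by rewrite /= ltcR.
  move=> z; rewrite -ball_normE /ball_ /= normcE ltcR normc_sub; exact: dP.
Qed.

Lemma copenP (A : set C) : open A <->
  forall a, A a -> exists2 d : R, 0 < d & forall z, normc (z - a) < d -> A z.
Proof.
split; first by move=> Ao a Aa; apply/cnbhsP; exact: open_nbhs_nbhs.
by move=> h; rewrite openE => a /h /cnbhsP.
Qed.

Lemma ccontP f a : {for a, continuous f} <->
  forall e : R, 0 < e ->
    exists2 d : R, 0 < d & forall z, normc (z - a) < d -> normc (f z - f a) < e.
Proof.
split.
- move=> fa e e0; apply/cnbhsP.
  apply: (fa [set w | normc (w - f a) < e]); apply/cnbhsP; by exists e.
- move=> h A /cnbhsP[e e0 eA]; have [d d0 dP] := h e e0.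
  by apply/cnbhsP; exists d => // z /dP /eA.
Qed.

Lemma nbhsC_gt0 a (r : R) : 0 < r -> nbhs a (fun z => normc (z - a) < r).
Proof. by move=> r0; apply/cnbhsP; exists r. Qed.

Lemma ccont_cst c a : {for a, continuous (fun=> c : C)}.
Proof. exact: cst_continuous. Qed.

Lemma ccont_id a : {for a, continuous (fun z => z)}.
Proof. by []. Qed.

Lemma ccontD f g a : {for a, continuous f} -> {for a, continuous g} ->
  {for a, continuous (fun z => f z + g z)}.
Proof.
move=> /ccontP fc /ccontP gc; apply/ccontP => e e0.
have [d d0 dP] := fc _ (divr_gt0 e0 (ltr0Sn _ 1)).
have [d' d'0 d'P] := gc _ (divr_gt0 e0 (ltr0Sn _ 1)).
exists (Num.min d d'); first by rewrite lt_min d0.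
move=> z; rewrite lt_min => /andP[/dP h1 /d'P h2].
have -> : f z + g z - (f a + g a) = (f z - f a) + (g z - g a) by ring.
by rewrite (le_lt_trans (ler_normcD _ _)) // [ltRHS]splitr ltrD.
Qed.

Lemma ccontM f g a : {for a, continuous f} -> {for a, continuous g} ->
  {for a, continuous (fun z => f z * g z)}.
Proof. by move=> fc gc; exact: (@continuousM R[i] C f g a fc gc). Qed.

Lemma ccontN f a : {for a, continuous f} -> {for a, continuous (fun z => - f z)}.
Proof.
move=> /ccontP fc; apply/ccontP => e /fc[d d0 dP]; exists d => // z /dP.
by rewrite -opprD normc_opp.
Qed.

Lemma ccontB f g a : {for a, continuous f} -> {for a, continuous g} ->
  {for a, continuous (fun z => f z - g z)}.
Proof. by move=> fc gc; exact: (ccontD fc (ccontN gc)). Qed.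

Lemma ccontV f a : f a != 0 -> {for a, continuous f} ->
  {for a, continuous (fun z => (f z)^-1)}.
Proof. by move=> fa fc; exact: (@continuousV R[i] C f a fa fc). Qed.

Lemma ccont_comp f g a : {for g a, continuous f} -> {for a, continuous g} ->
  {for a, continuous (fun z => f (g z))}.
Proof. by move=> fc gc; exact: (@continuous_comp _ _ _ g f a gc fc). Qed.

Lemma near_eq_cont f g a : (\forall z \near a, f z = g z) -> f a = g a ->
  {for a, continuous f} -> {for a, continuous g}.
Proof.
move=> fg fga /ccontP cf; apply/ccontP => e /cf[d d0 dP].
move/cnbhsP: fg => [d' d'0 d'P]; exists (Num.min d d').
  by rewrite lt_min d0.
by move=> z; rewrite lt_min => /andP[zd zd']; rewrite -d'P // -fga; exact: dP.
Qed.

(** * Complex differentiability *)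

(** Caratheodory's form of the derivative: the slope function [q] is continuous at
[a]. Product, chain and inverse rules become identities between slopes. *)
Definition cder f a d := exists q : C -> C,
  [/\ {for a, continuous q}, q a = d &
      \forall z \near a, f z - f a = q z * (z - a)].

Lemma cder_cont f a d : cder f a d -> {for a, continuous f}.
Proof.
move=> [q [qc qa qf]].
apply: (@near_eq_cont (fun z => f a + q z * (z - a))).
- by apply: filterS qf => z <-; rewrite addrCA subrr addr0.
- by rewrite subrr mulr0 addr0.
- have h1 := ccontB (@ccont_id a) (@ccont_cst a a).
  exact: (ccontD (@ccont_cst (f a) a) (ccontM qc h1)).
Qed.

Lemma cder_near f g a d : (\forall z \near a, f z = g z) ->
  cder f a d -> cder g a d.
Proof.
move=> fg [q [qc qa qf]]; exists q; split => //.
have fga : f a = g a by exact: (nbhs_singleton fg).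
near=> z; rewrite -fga.
have <- : f z = g z by near: z.
by near: z.
Unshelve. all: end_near. Qed.

Lemma cder_id a : cder id a 1.
Proof.
exists (fun=> 1); split => //; first exact: ccont_cst.
by near=> z; rewrite mul1r.
Unshelve. all: end_near. Qed.

Lemma cder_cst c a : cder (fun=> c) a 0.
Proof.
exists (fun=> 0); split => //; first exact: ccont_cst.
by near=> z; rewrite mul0r subrr.
Unshelve. all: end_near. Qed.

Lemma cderD f g a d e : cder f a d -> cder g a e ->
  cder (fun z => f z + g z) a (d + e).
Proof.
move=> [q [qc qa qf]] [p [pc pa pf]]; exists (fun z => q z + p z); split.
- exact: (ccontD qc pc).
- by rewrite qa pa.
- near=> z; rewrite mulrDl.
  have <- : f z - f a = q z * (z - a) by near: z.
  have <- : g z - g a = p z * (z - a) by near: z.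
  by ring.
Unshelve. all: end_near. Qed.

Lemma cderM f g a d e : cder f a d -> cder g a e ->
  cder (fun z => f z * g z) a (d * g a + f a * e).
Proof.
move=> fd [p [pc pa pf]]; have fc := cder_cont fd; case: fd => [q [qc qa qf]].
exists (fun z => q z * g a + f z * p z); split.
- exact: (ccontD (ccontM qc (@ccont_cst (g a) a)) (ccontM fc pc)).
- by rewrite qa pa.
- near=> z.
  have -> : (q z * g a + f z * p z) * (z - a) =
    q z * (z - a) * g a + f z * (p z * (z - a)) by ring.
  have <- : f z - f a = q z * (z - a) by near: z.
  have <- : g z - g a = p z * (z - a) by near: z.
  by ring.
Unshelve. all: end_near. Qed.

Lemma cderZ c f a d : cder f a d -> cder (fun z => c * f z) a (c * d).
Proof.
move=> fd; have := cderM (cder_cst c a) fd; by rewrite mul0r add0r.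
Qed.

Lemma cderN f a d : cder f a d -> cder (fun z => - f z) a (- d).
Proof.
move=> fd; have := cderZ (-1) fd; rewrite mulN1r.
by apply: cder_near; near=> z; rewrite mulN1r.
Unshelve. all: end_near. Qed.

Lemma cderB f g a d e : cder f a d -> cder g a e ->
  cder (fun z => f z - g z) a (d - e).
Proof. by move=> fd ge; apply: cderD => //; exact: cderN. Qed.

Lemma cont_neq0 f a : {for a, continuous f} -> f a != 0 ->
  \forall z \near a, f z != 0.
Proof.
move=> /ccontP fc fa; apply/cnbhsP; have := fc (normc (f a)).
rewrite normc_gt0 => /(_ fa)[d d0 dP]; exists d => // z /dP.
by apply: contraTneq => ->; rewrite sub0r normc_opp ltxx.
Qed.

Lemma cderV f a d : f a != 0 -> cder f a d ->
  cder (fun z => (f z)^-1) a (- d / f a ^+ 2).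
Proof.
move=> fa0 fd; have fc := cder_cont fd; case: (fd) => [q [qc qa qf]].
exists (fun z => - q z / (f z * f a)); split.
- apply: (ccontM (ccontN qc) (@ccontV (fun z => f z * f a) a _ _)).
    by rewrite mulf_neq0.
  exact: (ccontM fc (@ccont_cst (f a) a)).
- by rewrite qa expr2.
- near=> z.
  have fz0 : f z != 0 by near: z; exact: cont_neq0.
  rewrite mulrAC mulNr.
  have <- : f z - f a = q z * (z - a) by near: z.
  by field; apply/andP; split.
Unshelve. all: end_near. Qed.

Lemma cder_comp f g a d e : cder f (g a) d -> cder g a e ->
  cder (fun z => f (g z)) a (d * e).
Proof.
move=> [q [qc qa qf]] ge; have gc := cder_cont ge; case: ge => [p [pc pa pf]].
exists (fun z => q (g z) * p z); split.
- by apply: (ccontM (ccont_comp _ gc) pc); exact: qc.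
- by rewrite qa pa.
- near=> z; rewrite -mulrA.
  have <- : g z - g a = p z * (z - a) by near: z.
  by near: z; exact: (gc (fun w => f w - f (g a) = q w * (w - g a))).
Unshelve. all: end_near. Qed.

(** The chain rule read backwards. It makes continuous lifts through holomorphic
maps without critical points holomorphic. *)
Lemma cder_lift f g h a d e : {for a, continuous g} -> cder f (g a) d -> d != 0 ->
  cder h a e -> (\forall z \near a, f (g z) = h z) -> cder g a (e / d).
Proof.
move=> gc [q [qc qa qf]] d0 [p [pc pa pf]] fgh.
have qgc : {for a, continuous (q \o g)} by exact: (ccont_comp qc gc).
have qg0 : \forall z \near a, q (g z) != 0.
  by apply: (cont_neq0 qgc); rewrite /= qa.
exists (fun z => p z / q (g z)); split.
- by apply: (ccontM pc (ccontV _ qgc)); rewrite /= qa.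
- by rewrite pa qa.
- near=> z; rewrite mulrAC.
  have <- : h z - h a = p z * (z - a) by near: z.
  have <- : f (g z) = h z by near: z.
  rewrite -(nbhs_singleton fgh).
  have -> : f (g z) - f (g a) = q (g z) * (g z - g a).
    by near: z; exact: (gc (fun w => f w - f (g a) = q w * (w - g a))).
  by rewrite mulrAC mulfV ?mul1r //; near: z.
Unshelve. all: end_near. Qed.

Lemma derivable_cder f a : derivable f a 1 -> exists d, cder f a d.
Proof.
move=> /cvg_ex[d fd]; exists d.
exists (fun z => if z == a then d else (f z - f a) / (z - a)); split.
- apply/ccontP => e e0; rewrite eqxx.
  have /cnbhsP[r r0 rP] := fd _ (nbhsC_gt0 d e0).
  exists r => // z zr; case: eqVneq => [_|za]; first by rewrite subrr normc0.
  have := rP (z - a); rewrite subr0 => /(_ zr).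
  rewrite subr_eq0 => /(_ za) /=.
  by rewrite [(z - a)%:A]mulr1 subrK mulrC.
- by rewrite eqxx.
- near=> z; case: eqVneq => [->|za]; first by rewrite !subrr mulr0.
  by rewrite divfK // subr_eq0.
Unshelve. all: end_near. Qed.

Lemma cderX f a d n : cder f a d -> exists e, cder (fun z => f z ^+ n) a e.
Proof.
move=> fd; elim: n => [|n [e ih]].
  exists 0; apply: cder_near (cder_cst 1 a); near=> z; by rewrite expr0.
eexists; apply: cder_near (cderM fd ih); near=> z; by rewrite exprS.
Unshelve. all: end_near. Qed.

End Basics.

(** * Maxima on closed balls and the mean value inequality *)

Section ClosedBalls.
Variable R : realType.
Local Notation C := (cplx R).
Implicit Types (z w a d : C) (f g : C -> C).

Lemma cont_pair (p : R * R) :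
  {for p, continuous (fun p : R * R => (Complex p.1 p.2 : C))}.
Proof.
move=> A /cnbhsP[d d0 dA].
have d20 : 0 < d / 2 by rewrite divr_gt0.
apply/nbhs_ballP; exists (d / 2) => // q [/= q1 q2]; apply: dA.
rewrite (le_lt_trans (normc_ReIm _)) // ReD ImD ReN ImN /= [ltRHS]splitr ltrD //.
  by rewrite distrC; exact: q1.
by rewrite distrC; exact: q2.
Qed.

Lemma compact_closed_ball (r : R) : compact [set z : C | normc z <= r].
Proof.
pose K := `[- r, r]%classic `*` `[- r, r]%classic : set (R * R).
have Kc : compact K by apply: compact_setX; exact: segment_compact.
have Ic : compact ((fun p : R * R => (Complex p.1 p.2 : C)) @` K).
  apply: continuous_compact => //; apply: continuous_subspaceT => p.
  exact: cont_pair.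
apply: (subclosed_compact _ Ic).
- have -> : [set z : C | normc z <= r] = ~` [set z | r < normc z].
    by apply/seteqP; split => z /=; rewrite leNgt => /negP.
  apply: open_closedC; apply/copenP => z /= rz.
  exists (normc z - r); first by rewrite subr_gt0.
  move=> w; rewrite normc_sub => zw /=.
  have := lerB_normc z (z - w); have -> : z - (z - w) = w by ring.
  lra.
- move=> z zr; exists (complex.Re z, complex.Im z); last by case: z zr.
  split; rewrite /= in_itv /= -ler_norml.
    by rewrite (le_trans (normc_Re z)).
  by rewrite (le_trans (normc_Im z)).
Qed.

(** Continuity of [u] is asked relatively to the ball, so that suprema of radii
of subballs (see [lebesgue_ball]) qualify. *)
Lemma closed_ball_max (r : R) (u : C -> R) : 0 <= r ->
  (forall z, normc z <= r -> forall e : R, 0 < e -> exists2 d : R, 0 < d &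
    forall w, normc w <= r -> normc (w - z) < d -> `|u w - u z| < e) ->
  exists2 c : C, normc c <= r & forall z, normc z <= r -> u z <= u c.
Proof.
move=> r0 uc.
have [||c] := @compact_EVT_max C R u [set z : C | normc z <= r] _
  (@compact_closed_ball r).
- have h : normc (0 : C) <= r by rewrite normcC0.
  by exists (0 : C); exact: h.
- apply/subspace_continuousP => z /= zr.
  move=> A /nbhs_ballP[e /= e0 eA]; have [d d0 dP] := uc z zr e e0.
  apply/cnbhsP; exists d => // w wd wr; apply: eA.
  by rewrite /ball /= distrC; exact: dP.
- rewrite inE => cr cP; exists c => // z zr; apply: cP; by rewrite inE.
Qed.

Lemma quotient_dist (l D h e : R) : h != 0 ->
  `|D - l * h| <= e * `|h| -> `|l - h^-1 * D| <= e.
Proof.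
move=> h0 le; rewrite -(ler_pM2r (_ : 0 < `|h|)) ?normr_gt0 // -normrM.
by rewrite mulrBl mulrAC mulVf // mul1r -normrN opprB.
Qed.

Lemma is_derive_eps (u : R -> R) (s l : R) :
  (forall e : R, 0 < e -> exists2 d : R, 0 < d &
    forall h, `|h| < d -> `|u (s + h) - u s - l * h| <= e * `|h|) ->
  is_derive s 1 u l.
Proof.
move=> ul.
have cl : h^-1 *: (u (h *: 1 + s) - u s) @[h --> 0^'] --> l.
  apply/cvgrPdist_le => e e0; have [d d0 dP] := ul e e0.
  apply/nbhs_ballP; exists d => // h; rewrite /ball /= sub0r normrN => hd h0.
  have := dP h hd; rewrite [h *: 1]mulr1 (addrC h) => le.
  exact: (quotient_dist h0 le).
by apply: DeriveDef; [apply/cvg_ex; exists l|exact: cvg_lim].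
Qed.

Lemma cder_eps f a d : cder f a d -> forall e : R, 0 < e ->
  exists2 r : R, 0 < r & forall z, normc (z - a) < r ->
    normc (f z - f a - d * (z - a)) <= e * normc (z - a).
Proof.
move=> [q [/ccontP qc qa /cnbhsP[r1 r10 qf]]] e e0.
have [r2 r20 r2P] := qc e e0.
exists (Num.min r1 r2); first by rewrite lt_min r10.
move=> z; rewrite lt_min => /andP[/qf -> /r2P h].
by rewrite -qa -mulrBl normcM ler_wpM2r ?normc_ge0 // ltW.
Qed.

Lemma cder_is_derive_Re f a v d (s : R) : cder f (a + s%:C%C * v) d ->
  is_derive s 1 (fun s : R => complex.Re (f (a + s%:C%C * v))) (complex.Re (d * v)).
Proof.
move=> /cder_eps fd; apply: is_derive_eps => e e0.
have v1 : 0 < normc v + 1 by rewrite ltr_wpDl ?normc_ge0.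
have [r r0 rP] := fd _ (divr_gt0 e0 v1).
exists (r / (normc v + 1)); first exact: divr_gt0.
move=> h; rewrite ltr_pdivlMr // => hr.
pose z := a + (s + h)%:C%C * v.
have zE : z - (a + s%:C%C * v) = h%:C%C * v.
  by rewrite /z rmorphD /=; ring.
have hv : `|h| * normc v <= `|h| * (normc v + 1).
  by rewrite ler_wpM2l // lerDl.
have zr : normc (z - (a + s%:C%C * v)) < r.
  by rewrite zE normc_mulr (le_lt_trans hv).
have := rP z zr; rewrite zE => le.
have -> : complex.Re (f (a + (s + h)%:C%C * v)) - complex.Re (f (a + s%:C%C * v))
  - complex.Re (d * v) * h =
  complex.Re (f z - f (a + s%:C%C * v) - d * (h%:C%C * v)).
  rewrite !ReD !ReN -/z; congr (_ - _).
  by case: (d) (v) => x y [x' y'] /=; ring.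
rewrite (le_trans (normc_Re _)) // (le_trans le) // normc_mulr.
rewrite mulrAC -mulrA ler_pM2l // ler_pdivrMr //.
Qed.

Lemma MVT_unit (u du : R -> R) :
  (forall s : R, 0 <= s <= 1 -> is_derive s 1 u (du s)) ->
  exists2 s : R, 0 <= s <= 1 & u 1 - u 0 = du s.
Proof.
move=> ud.
have uc : {within `[0, 1], continuous u}.
  apply: derivable_within_continuous => x; rewrite in_itv /= => /ud[].
  by [].
have ud' (x : R) : x \in `]0, 1[ -> is_derive x 1 u (du x).
  by rewrite in_itv /= => /andP[x0 x1]; apply: ud; rewrite !ltW.
have [s s01 ->] := MVT ltr01 ud' uc.
exists s; last by rewrite subr0 mulr1.
by move: s01; rewrite in_itv /= => /andP[x0 x1]; rewrite !ltW.
Qed.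

(** The real mean value theorem, applied to the component of [f] in the direction
of the increment [f b - f a]. *)
Lemma cmvt (f df : C -> C) (a b : C) (M : R) :
  (forall s : R, 0 <= s <= 1 -> let z := a + s%:C%C * (b - a) in
     cder f z (df z) /\ normc (df z) <= M) ->
  normc (f b - f a) <= M * normc (b - a).
Proof.
move=> h; pose c : C := f b - f a; pose cb : C := (c^*)%C.
have [c0|c0] := eqVneq c 0.
  rewrite -/c c0 normcC0 mulr_ge0 ?normc_ge0 //.
  have [|_ ] := h 0; first by rewrite lexx ler01.
  exact: le_trans (normc_ge0 _).
pose g (z : C) : C := cb * f z.
have gd (s : R) : 0 <= s <= 1 -> let z := a + s%:C%C * (b - a) in
    cder g z (cb * df z).
  by move=> /h[fd _]; exact: cderZ.
pose u (s : R) := complex.Re (g (a + s%:C%C * (b - a))).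
pose du (s : R) := complex.Re (cb * df (a + s%:C%C * (b - a)) * (b - a)).
have ud (s : R) : 0 <= s <= 1 -> is_derive s 1 u (du s).
  by move=> /gd; exact: cder_is_derive_Re.
have [s s01] := MVT_unit ud.
have -> : u 1 - u 0 = normc c ^+ 2.
  rewrite /u -ReN -ReD mul1r mul0r addr0 (addrC a) subrK /g -mulrBr -/c normc_sqr.
  by rewrite /cb; case: (c) => x y /=; ring.
move=> eq.
have [_ leM] : cder f (a + s%:C%C * (b - a)) (df (a + s%:C%C * (b - a))) /\
    normc (df (a + s%:C%C * (b - a))) <= M.
  exact: h.
have cbE : normc cb = normc c by rewrite /cb; case: (c) => x y /=; rewrite sqrrN.
have : normc c ^+ 2 <= normc c * (M * normc (b - a)).
  rewrite eq (le_trans (ler_norm _)) // (le_trans (normc_Re _)) //.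
  by rewrite !normcM cbE -mulrA ler_wpM2l ?normc_ge0 // ler_wpM2r ?normc_ge0.
by rewrite expr2 ler_pM2l // normc_gt0.
Qed.

End ClosedBalls.

(** * Maximum modulus for functions with a primitive *)

Section MaxPrimitive.
Variable R : realType.
Local Notation C := (cplx R).
Implicit Types (z w a d : C) (f g : C -> C).

Lemma taylor2 (G G1 : C -> C) (a g2 : C) :
  (\forall z \near a, cder G z (G1 z)) -> cder G1 a g2 ->
  forall e : R, 0 < e -> exists2 r : R, 0 < r & forall h : C, normc h < r ->
    normc (G (a + h) - (G a + G1 a * h + g2 / 2%:R * h ^+ 2)) <= e * normc h ^+ 2.
Proof.
move=> /cnbhsP[r1 r10 GG1] /cder_eps G1a e e0.
have [r2 r20 r2P] := G1a e e0.
exists (Num.min r1 r2); first by rewrite lt_min r10.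
move=> h; rewrite lt_min => /andP[hr1 hr2].
pose E (z : C) : C := G z - (G1 a * (z - a) + g2 / 2%:R * ((z - a) * (z - a))).
pose E1 (z : C) : C := G1 z - (G1 a * (1 - 0) +
  g2 / 2%:R * ((1 - 0) * (z - a) + (z - a) * (1 - 0))).
have Ed (z : C) : normc (z - a) < r1 -> cder E z (E1 z).
  move=> /GG1 Gz; have ida := cderB (cder_id z) (cder_cst a z).
  exact: (cderB Gz (cderD (cderZ (G1 a) ida) (cderZ (g2 / 2%:R) (cderM ida ida)))).
have seg (s : R) : 0 <= s <= 1 ->
    normc (a + s%:C%C * (a + h - a) - a) <= normc h.
  move=> /andP[s0 s1].
  have -> : a + s%:C%C * (a + h - a) - a = s%:C%C * h by ring.
  by rewrite normc_mulr ger0_norm // ler_piMl // normc_ge0.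
have := @cmvt R E E1 a (a + h) (e * normc h).
have -> : a + h - a = h by ring.
have -> : E (a + h) - E a = G (a + h) - (G a + G1 a * h + g2 / 2%:R * h ^+ 2).
  by rewrite /E; ring.
have -> : e * normc h ^+ 2 = e * normc h * normc h by ring.
apply => s s01 z.
have zle : normc (z - a) <= normc h.
  by have := seg s s01; have -> : a + h - a = h by ring.
split; first by apply: Ed; rewrite (le_lt_trans zle).
have -> : E1 z = G1 z - G1 a - g2 * (z - a).
  by rewrite /E1; field.
apply: (le_trans (r2P _ (le_lt_trans zle hr2))).
by apply: ler_wpM2l => //; exact: ltW.
Qed.

(** The second order terms in the directions 1, -1, i, -i carry the squares
1, 1, -1, -1 and cancel; the fourth powers of [h] add up. *)
Lemma four_points (a0 a1 a2 : C) (h : R) :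
  let P (w : C) := a0 + a1 * w + a2 * w ^+ 2 in
  let h1 : C := h%:C%C in let hi : C := Complex 0 h in
  normc (P h1) ^+ 2 + normc (P (- h1)) ^+ 2 + normc (P hi) ^+ 2 +
  normc (P (- hi)) ^+ 2 = 4 * normc a0 ^+ 2 + 4 * normc a1 ^+ 2 * h ^+ 2
    + 4 * normc a2 ^+ 2 * h ^+ 4.
Proof.
rewrite /= !normc_sqr; case: a0 a1 a2 => x0 y0 [x1 y1] [x2 y2].
by rewrite !expr2 /=; ring.
Qed.

Lemma normc_add_sqr_ge (z e : C) (B : R) : normc z <= B ->
  normc z ^+ 2 - 2 * B * normc e <= normc (z + e) ^+ 2.
Proof.
move=> zB; have h := lerB_normcD z e; have e0 := normc_ge0 e.
have z0 := normc_ge0 z; have ze0 := normc_ge0 (z + e).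
have [le|lt] := leP (normc z) (normc e).
  apply: (@le_trans _ _ 0); last exact: sqr_ge0.
  nra.
have : (normc z - normc e) ^+ 2 <= normc (z + e) ^+ 2.
  by rewrite ler_pXn2r // nnegrE ?subr_ge0 // ltW.
nra.
Qed.

(** By [four_points], the mean of [normc (G z) ^+ 2] over four neighbours of [a] is
at least its value at [a], up to [o(h ^+ 2)], while the mean of
[eps * normc z ^+ 2] exceeds its value at [a] by [eps * h ^+ 2]. *)
Lemma no_local_max (G G1 : C -> C) (a g2 : C) (eps : R) : 0 < eps ->
  (\forall z \near a, cder G z (G1 z)) -> cder G1 a g2 ->
  ~ (\forall z \near a, normc (G z) ^+ 2 + eps * normc z ^+ 2 <=
       normc (G a) ^+ 2 + eps * normc a ^+ 2).
Proof.
move=> eps0 GG1 G1a /cnbhsP[r0 r00 amax].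
pose B := normc (G a) + normc (G1 a) + normc (g2 / 2%:R).
have B0 : 0 <= B by rewrite !addr_ge0 ?normc_ge0.
(* Small enough for the Taylor error, which enters multiplied by [2 * B], to stay
   below the gain [eps * h ^+ 2]. *)
have e0 : 0 < eps / (4 * (B + 1)) by rewrite divr_gt0 // mulr_gt0 // ltr_wpDl.
have [r1 r10 tay] := taylor2 GG1 G1a e0.
pose h : R := Num.min (Num.min r0 r1) 1 / 2.
have h0 : 0 < h by rewrite divr_gt0 // !lt_min r00 r10 /=.
have hm : h < Num.min (Num.min r0 r1) 1.
  by rewrite /h ltr_pdivrMr // ltr_pMr ?ltr1n // !lt_min r00 r10 /=.
move: hm; rewrite !lt_min => /andP[/andP[hr0 hr1] h1].
pose P (w : C) := G a + G1 a * w + g2 / 2%:R * w ^+ 2.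
have PB (w : C) : normc w = h -> normc (P w) <= B.
  move=> wh; rewrite /P /B (le_trans (ler_normcD _ _)) // lerD //.
    rewrite (le_trans (ler_normcD _ _)) // lerD // normcCM wh.
    by rewrite ler_piMr ?normc_ge0 // ltW.
  rewrite normcCM normcX wh ler_piMr ?normc_ge0 // expr_le1 //; exact: ltW.
have key (w : C) : normc w = h -> normc (P w) ^+ 2
    - 2 * B * (eps / (4 * (B + 1)) * h ^+ 2) + eps * normc (a + w) ^+ 2 <=
    normc (G a) ^+ 2 + eps * normc a ^+ 2.
  move=> wh; have wa : a + w - a = w by ring.
  have := amax (a + w); rewrite wa wh => /(_ hr0); apply: le_trans.
  rewrite lerD2r.
  have := tay w; rewrite wh => /(_ hr1); rewrite -/(P w) => tw.
  have -> : G (a + w) = P w + (G (a + w) - P w) by ring.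
  apply: le_trans (normc_add_sqr_ge _ (PB w wh)).
  by rewrite lerD2l lerN2 ler_wpM2l // mulr_ge0.
have n1 : normc (h%:C%C : C) = h by rewrite normc_real gtr0_norm.
have n2 : normc (Complex 0 h : C) = h.
  by rewrite /normc expr0n add0r sqrtr_sqr gtr0_norm.
have k1 := key _ n1; have k2 := key (- h%:C%C); have k3 := key _ n2.
have k4 := key (- Complex 0 h).
rewrite normc_opp in k2; have {}k2 := k2 n1.
rewrite normc_opp in k4; have {}k4 := k4 n2.
have fp := four_points (G a) (G1 a) (g2 / 2%:R) h.
rewrite /= -!/(P _) in fp.
have fq := four_points a 1 0 h.
cbv zeta in fq; rewrite !mul0r !addr0 !mul1r normcC0 normcC1 in fq.
rewrite expr1n mulr1 expr0n /= mulr0 mul0r addr0 in fq.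
have s2 : 0 <= normc (G1 a) ^+ 2 * h ^+ 2 by rewrite mulr_ge0 // sqr_ge0.
have s3 : 0 <= normc (g2 / 2%:R) ^+ 2 * h ^+ 4.
  by rewrite mulr_ge0 ?sqr_ge0 // exprn_ge0 // ltW.
have s4 : 2 * B * (eps / (4 * (B + 1)) * h ^+ 2) < eps * h ^+ 2.
  rewrite mulrA ltr_pM2r ?exprn_gt0 //.
  have -> : 2 * B * (eps / (4 * (B + 1))) = eps * (B / (2 * (B + 1))).
    by field; rewrite gt_eqF // ltr_wpDl.
  rewrite gtr_pMr // ltr_pdivrMr ?mulr_gt0 ?ltr_wpDl //.
  by rewrite mul1r; lra.
nra.
Qed.

(** The perturbation by [eps * normc z ^+ 2] pushes the maximum to the boundary,
by [no_local_max]. *)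
Lemma max_mod_twice (G G1 G2 : C -> C) (r M : R) : 0 <= r ->
  (forall z : C, normc z < r -> cder G z (G1 z) /\ cder G1 z (G2 z)) ->
  (forall z : C, normc z <= r -> {for z, continuous G}) ->
  (forall z : C, normc z = r -> normc (G z) <= M) ->
  forall z : C, normc z <= r -> normc (G z) <= M.
Proof.
move=> r0 Gd Gc GM.
pose u (eps : R) (z : C) : R := normc (G z) ^+ 2 + eps * normc z ^+ 2.
have ucont (eps : R) (z : C) : normc z <= r -> forall e : R, 0 < e ->
    exists2 d : R, 0 < d & forall w : C, normc w <= r -> normc (w - z) < d ->
    `|u eps w - u eps z| < e.
  move=> zr e e0; pose v (w : C) : C := G w * (G w)^*%C +
    eps%:C%C * (w * (w^*)%C).
  have conj_cont (g : C -> C) (x : C) : {for x, continuous g} ->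
      {for x, continuous (fun w => (g w)^*%C : C)}.
    move=> /ccontP gc; apply/ccontP => e' /gc[d d0 dP]; exists d => // w /dP.
    rewrite -rmorphB /=; case: (g w - g x) => p q /=.
    by rewrite sqrrN.
  have vc : {for z, continuous v}.
    have h1 := ccontM (Gc z zr) (conj_cont _ _ (Gc z zr)).
    have h2 := ccontM (@ccont_id R z) (conj_cont _ _ (@ccont_id R z)).
    exact: (ccontD h1 (ccontM (@ccont_cst R (eps%:C%C) z) h2)).
  have [d d0 dP] := (ccontP v z).1 vc e e0.
  have uE (w : C) : u eps w = complex.Re (v w).
    by rewrite /u /v ReD ReZ !Re_mul_conj.
  exists d => // w _ /dP; apply: le_lt_trans.
  by rewrite !uE -ReN -ReD normc_Re.
have main (eps : R) : 0 < eps -> 0 <= M /\ forall z : C, normc z <= r ->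
    normc (G z) ^+ 2 <= M ^+ 2 + eps * r ^+ 2.
  move=> eps0; have [c cr cmax] := closed_ball_max r0 (ucont eps).
  have [clt|cge] := ltP (normc c) r.
    exfalso; have cn : \forall z \near c, normc z < r.
      apply/cnbhsP; exists (r - normc c); first by rewrite subr_gt0.
      move=> z zc; have := lerB_normc z c; lra.
    apply: (@no_local_max G G1 c (G2 c) eps eps0).
    - by apply: filterS cn => z /Gd[].
    - by have [] := Gd c clt.
    - by apply: filterS cn => z zr; apply: cmax; exact: ltW.
  have cE : normc c = r by apply/eqP; rewrite eq_le cr.
  have M0 : 0 <= M by rewrite (le_trans _ (GM c cE)) // normc_ge0.
  split => // z zr; apply: (@le_trans _ _ (u eps z)).
    by rewrite lerDl mulr_ge0 ?sqr_ge0 // ltW.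
  rewrite (le_trans (cmax z zr)) // /u cE lerD2r ler_pXn2r ?nnegrE ?normc_ge0 //.
  exact: GM.
move=> z zr; have [M0 _] := main 1 ltr01.
rewrite -(ler_pXn2r (n := 2)) ?nnegrE ?normc_ge0 //.
apply/ler_addgt0Pr => e e0.
have r1 : 0 < r ^+ 2 + 1 by rewrite ltr_wpDl ?sqr_ge0.
have [_ /(_ z zr) h] := main _ (divr_gt0 e0 r1).
rewrite (le_trans h) // lerD2l mulrAC ler_pdivrMr // ler_pM2l //; lra.
Qed.

(** Lebesgue number of a cover of a closed ball: the supremum of the radii of
the good balls about a point is a 1-Lipschitz positive function. *)
Lemma lebesgue_ball (good : set C -> Prop) (r : R) : 0 <= r ->
  (forall A B, A `<=` B -> good B -> good A) ->
  (forall z : C, normc z <= r -> exists2 d : R, 0 < d &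
    good [set w : C | normc (w - z) < d]) ->
  exists2 d : R, 0 < d & forall z : C, normc z <= r ->
    good [set w : C | normc (w - z) < d].
Proof.
move=> r0 gsub gloc.
pose D (z : C) := [set d : R | 0 < d <= 1 /\ good [set w : C | normc (w - z) < d]].
have Dne (z : C) : normc z <= r -> D z !=set0.
  move=> /gloc[d d0 dg]; exists (Num.min d 1); split.
    by rewrite lt_min d0 /= ltr01 ge_min lexx orbT.
  by apply: gsub dg => w /=; rewrite lt_min => /andP[].
have Dub (z : C) : has_ubound (D z) by exists 1 => d [/andP[_ d1] _].
pose u (z : C) : R := sup (D z).
have Dle (z : C) (d : R) : D z d -> d <= u z by move=> Dd; apply: ub_le_sup.
have lip (z w : C) : normc z <= r -> normc w <= r ->
    u z - normc (z - w) <= u w.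
  move=> zr wr; rewrite lerBlDr; apply: ge_sup; first exact: Dne.
  move=> d [/andP[d0 d1] dg].
  have [dw|dw] := leP d (normc (z - w)).
    rewrite (le_trans dw) // lerDr.
    have [e De] := Dne w wr; rewrite (le_trans _ (Dle _ _ De)) //.
    by case: De => /andP[/ltW].
  rewrite -lerBlDr; apply: Dle; split.
    rewrite subr_gt0 dw /= (le_trans _ d1) // gerBl; exact: normc_ge0.
  apply: gsub dg => x /= xw; have := normc_triangle w x z.
  rewrite (normc_sub w z); lra.
have [z zr e e0|c cr cmin] := @closed_ball_max R r (fun z => - u z) r0.
  exists e => // w wr wz; rewrite opprK addrC ltr_distl.
  have h1 := lip z w zr wr; have h2 := lip w z wr zr.
  move: h1; rewrite normc_sub => h1; apply/andP; split; lra.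
have uc0 : 0 < u c.
  have [d d0 dg] := gloc c cr.
  apply: (@lt_le_trans _ _ (Num.min d 1)); first by rewrite lt_min d0 ltr01.
  apply: Dle; split; first by rewrite lt_min d0 /= ltr01 ge_min lexx orbT.
  by apply: gsub dg => w /=; rewrite lt_min => /andP[].
exists (u c / 2); first exact: divr_gt0.
move=> z zr; have uz : u c / 2 < u z.
  have := cmin z zr; lra.
have [d [_ dg] ud] : exists2 d, D z d & u c / 2 < d.
  have hs : has_sup (D z) by split; [exact: Dne|exact: Dub].
  have u0 : 0 < u z - u c / 2 by rewrite subr_gt0.
  have [d Dd] := sup_adherent u0 hs.
  by rewrite -/(u z) opprB addrCA subrr addr0 => ?; exists d.
apply: gsub dg => w /= /lt_trans; apply; exact: ud.
Qed.

(** Good sets are those on which [f] oscillates by less than [e]. *)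
Lemma unif_cont_ball f (r : R) : 0 <= r ->
  (forall z : C, normc z <= r -> {for z, continuous f}) ->
  forall e : R, 0 < e -> exists2 d : R, 0 < d & forall z w : C, normc z <= r ->
    normc (w - z) < d -> normc (f w - f z) < e.
Proof.
move=> r0 fc e e0.
pose good (A : set C) := forall z w, A z -> A w -> normc (f w - f z) < e.
have [A B AB Bg z w Az Aw|z zr|d d0 dP] := @lebesgue_ball good r r0.
- by apply: Bg; exact: AB.
- have [d d0 dP] := (ccontP f z).1 (fc z zr) _ (divr_gt0 e0 (ltr0Sn _ 1)).
  exists d => // v w /= /dP h1 /dP h2.
  rewrite (le_lt_trans (normc_triangle (f z) _ _)) // [ltRHS]splitr ltrD //.
  by rewrite normc_sub.
- exists d => // z w /dP good_z wz; apply: good_z => //=.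
  by rewrite subrr normcC0.
Qed.

(** Nothing is known about [f1] beyond its existence, so [f] cannot be handled by
[max_mod_twice]. The difference quotients of the primitive [F] can: they are twice
differentiable, and tend to [f] uniformly on the closed ball. *)
Lemma max_mod_primitive (F f f1 : C -> C) (r rho M : R) : 0 <= r -> r < rho ->
  (forall z : C, normc z < rho -> cder F z (f z) /\ cder f z (f1 z)) ->
  (forall z : C, normc z = r -> normc (f z) <= M) ->
  forall z : C, normc z <= r -> normc (f z) <= M.
Proof.
move=> r0 rrho Fd fM.
have fc (z : C) : normc z <= r -> {for z, continuous f}.
  by move=> zr; have [_ /cder_cont] := Fd z (le_lt_trans zr rrho).
move=> z zr; apply/ler_addgt0Pr => e' e'0.
pose e := e' / 2; have e0 : 0 < e by exact: divr_gt0.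
have [d d0 dP] := unif_cont_ball r0 fc e0.
pose h : R := Num.min d (rho - r) / 2.
have m0 : 0 < Num.min d (rho - r) by rewrite lt_min d0 subr_gt0.
have h0 : 0 < h by exact: divr_gt0.
have : h < Num.min d (rho - r) by rewrite /h ltr_pdivrMr // ltr_pMr // ltr1n.
rewrite lt_min => /andP[hd hrho].
have nh : normc (h%:C%C : C) = h by rewrite normc_real gtr0_norm.
have hC0 : (h%:C%C : C) != 0 by rewrite -normc_eq0 nh gt_eqF.
pose D (k : C -> C) (z : C) : C := (h%:C%C)^-1 * (k (z + h%:C%C) - k z).
have inside (w : C) (s : R) : normc w <= r -> 0 <= s <= 1 ->
    normc (w + s%:C%C * h%:C%C) < rho.
  move=> wr /andP[s0 s1]; rewrite (le_lt_trans (ler_normcD _ _)) //.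
  rewrite normc_mulr ger0_norm // nh.
  have : s * h <= h by rewrite ler_piMl // ltW.
  lra.
have shift_der (k k1 : C -> C) (w : C) : cder k (w + h%:C%C) (k1 (w + h%:C%C)) ->
    cder (fun w => k (w + h%:C%C)) w (k1 (w + h%:C%C)).
  move=> kd; have := cderD (cder_id w) (cder_cst (h%:C%C) w).
  rewrite addr0 => sd.
  have := @cder_comp R k (fun w => w + h%:C%C) w _ _ kd sd.
  by rewrite mulr1.
have Dd (w : C) : normc w <= r -> cder (D F) w (D f w) /\ cder (D f) w (D f1 w).
  move=> wr; have [w1 w2] := Fd w (le_lt_trans wr rrho).
  have := inside w 1 wr; rewrite mul1r ler01 lexx => /(_ isT) /Fd[v1 v2].
  split; apply: cderZ.
    exact: (cderB (shift_der _ _ _ v1) w1).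
  exact: (cderB (shift_der _ _ _ v2) w2).
have Dclose (w : C) : normc w <= r -> normc (D F w - f w) <= e.
  move=> wr; pose k (v : C) : C := F v - f w * v.
  have kd (v : C) : normc v < rho -> cder k v (f v - f w * 1).
    by move=> /Fd[v1 _]; exact: (cderB v1 (cderZ (f w) (cder_id v))).
  have vE : w + h%:C%C - w = h%:C%C by rewrite addrC addKr.
  have := @cmvt R k (fun v => f v - f w * 1) w (w + h%:C%C) e.
  rewrite vE nh => mv.
  have -> : D F w - f w = (h%:C%C)^-1 * (k (w + h%:C%C) - k w).
    by rewrite /D /k; field.
  rewrite normcCM normcCV nh mulrC ler_pdivrMr //; apply: mv => s s01 v.
  split; first by apply: kd; exact: inside.
  rewrite mulr1 ltW // dP // /v addrC addKr normc_mulr nh.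
  case/andP: s01 => s0 s1; rewrite ger0_norm // (le_lt_trans _ hd) //.
  by rewrite ler_piMl // ltW.
have Dmax (w : C) : normc w = r -> normc (D F w) <= M + e.
  move=> wr; have := Dclose w; rewrite wr lexx => /(_ isT) h1.
  have -> : D F w = f w + (D F w - f w) by rewrite addrC subrK.
  by rewrite (le_trans (ler_normcD _ _)) // lerD // fM.
have := @max_mod_twice (D F) (D f) (D f1) r (M + e) r0 _ _ Dmax z zr.
move=> /(_ _ _) main; have {}main : normc (D F z) <= M + e.
  apply: main => w wr; first by apply: Dd; exact: ltW.
  by have [/cder_cont] := Dd w wr.
have -> : f z = D F z - (D F z - f z) by rewrite opprB addrCA subrr addr0.
rewrite (le_trans (ler_normcB _ _)) //.
have := Dclose z zr; rewrite /e in main *; lra.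
Qed.
End MaxPrimitive.

(** * Goursat's theorem on rectangles *)

Section Dyadic.
Variable R : realType.
Local Notation C := (cplx R).
Implicit Types (z w : C).

(** Oriented integrals along segments are increments of an antiderivative, which
makes Chasles' relation an identity. *)
Lemma antiderivative (g : R -> R) (A : R) : continuous g ->
  exists G : R -> R, forall x : R, - A < x < A -> is_derive x 1 G (g x).
Proof.
move=> gc; exists (fun x => \int[lebesgue_measure]_(t in `[- A, x]) g t).
move=> x /andP[Ax xA].
have gi : lebesgue_measure.-integrable `[- A, A] (EFin \o g).
  apply: continuous_compact_integrable; first exact: segment_compact.
  exact: continuous_subspaceT.
have := continuous_FTC1_closed xA gi Ax (gc x); cbv zeta => -[d dE].
by apply: DeriveDef; [exact: d|rewrite -derive1E].
Qed.

Lemma segment_bound (k k1 : R -> R) (a b M : R) :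
  (forall t : R, 0 <= t <= 1 -> let s := a + (b - a) * t in
     is_derive s 1 k (k1 s) /\ `|k1 s| <= M) ->
  `|k b - k a| <= M * `|b - a|.
Proof.
have main (x y : R) : x <= y ->
    (forall s : R, x <= s <= y -> is_derive s 1 k (k1 s) /\ `|k1 s| <= M) ->
    `|k y - k x| <= M * `|y - x|.
  move=> xy h.
  have kc : {within `[x, y], continuous k}.
    apply: derivable_within_continuous => s; rewrite in_itv /= => /h[[kd _] _].
    exact: kd.
  have kd (s : R) : s \in `]x, y[ -> is_derive s 1 k (k1 s).
    rewrite in_itv /= => /andP[s1 s2]; have [] := h s; last by [].
    by rewrite !ltW.
  have [s sxy ->] := MVT_segment xy kd kc.
  rewrite normrM ler_wpM2r //; move: sxy; rewrite in_itv /= => /h; by case.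
move=> h; have [ab|ba] := leP a b.
  apply: main => // s /andP[as_ sb].
  have [ab0|ab0] := eqVneq (b - a) 0.
    have -> : s = a + (b - a) * 0 by rewrite mulr0 addr0; lra.
    by apply: h; rewrite lexx ler01.
  have ba0 : 0 < b - a by rewrite lt_def ab0 subr_ge0.
  have -> : s = a + (b - a) * ((s - a) / (b - a)) by field.
  apply: h; rewrite divr_ge0 ?subr_ge0 //= ler_pdivrMr // mul1r; lra.
rewrite distrC (distrC b); apply: main; first exact: ltW.
move=> s /andP[bs sa]; have ba0 : 0 < a - b by rewrite subr_gt0.
have -> : s = a + (b - a) * ((a - s) / (a - b)) by field; rewrite gt_eqF.
by apply: h; rewrite divr_ge0 ?subr_ge0 //= ?ler_pdivrMr // ?mul1r; lra.
Qed.

(** Bisection in two directions. [P n t u] concerns the square with lower left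
corner [(t, u)] and side [2 ^- n]; [(t0, u0)] lies in all the chosen squares. *)
Lemma dyadic_nested (P : nat -> R -> R -> Prop) : P 0%N 0 0 ->
  (forall n t u, P n t u -> exists t' u', [/\ P n.+1 t' u',
     t' = t \/ t' = t + (2^-1) ^+ n.+1 & u' = u \/ u' = u + (2^-1) ^+ n.+1]) ->
  exists t0 u0, forall n, exists t u, [/\ P n t u,
    0 <= t <= t0, t0 <= t + (2^-1) ^+ n <= 1,
    0 <= u <= u0 & u0 <= u + (2^-1) ^+ n <= 1].
Proof.
move=> P0 step.
have h2 n : (2^-1 : R) ^+ n = (2^-1) ^+ n.+1 + (2^-1) ^+ n.+1.
  by rewrite exprS; field.
have p2 n : (0 : R) < (2^-1) ^+ n by rewrite exprn_gt0 // invr_gt0.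
pose S := {x : nat * (R * R) | P x.1 x.2.1 x.2.2}.
have stepS (x : S) : exists y : S, [/\ (sval y).1 = (sval x).1.+1,
   (sval y).2.1 = (sval x).2.1 \/
   (sval y).2.1 = (sval x).2.1 + (2^-1) ^+ (sval x).1.+1 &
   (sval y).2.2 = (sval x).2.2 \/
   (sval y).2.2 = (sval x).2.2 + (2^-1) ^+ (sval x).1.+1].
  case: x => -[n [t u]] /= Pn; have [t' [u' [P' tt' uu']]] := step n t u Pn.
  by exists (exist _ (n.+1, (t', u')) P').
have [f fP] := choice stepS.
pose s n : S := iter n f (exist (fun x : nat * (R * R) => P x.1 x.2.1 x.2.2) (0%N, (0, 0)) P0).
have sn n : (sval (s n)).1 = n.
  by elim: n => [//|n ih]; have [] := fP (s n); rewrite /s iterS -/(s n) ih.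
have main (t : nat -> R) : t 0%N = 0 ->
    (forall n, t n.+1 = t n \/ t n.+1 = t n + (2^-1) ^+ n.+1) ->
    exists t0, forall n, 0 <= t n <= t0 /\ t0 <= t n + (2^-1) ^+ n <= 1.
  move=> t00 ts.
  have up n m : t n <= t (n + m)%N.
    elim: m => [|m ih]; first by rewrite addn0.
    rewrite addnS (le_trans ih) //.
    by case: (ts (n + m)%N) => -> //; rewrite lerDl ltW.
  have dn n m : t (n + m)%N + (2^-1) ^+ (n + m) <= t n + (2^-1) ^+ n.
    elim: m => [|m ih]; first by rewrite addn0.
    rewrite addnS (le_trans _ ih) // (h2 (n + m)%N).
    have := p2 (n + m).+1; case: (ts (n + m)%N) => ->; lra.
  have bd n m : t m <= t n + (2^-1) ^+ n.
    have [nm|mn] := leqP n m.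
      rewrite (le_trans _ (dn n (m - n)%N)) // subnKC //.
      by rewrite lerDl ltW.
    have := up m (n - m)%N; rewrite (subnKC (ltnW mn)) => /le_trans; apply.
    by rewrite lerDl ltW.
  pose E := range t; have Eub : has_ubound E.
    by exists (t 0%N + (2^-1) ^+ 0%N) => _ [m _ <-]; exact: bd.
  exists (sup E) => n; split.
    have := up 0%N n; rewrite t00 add0n => -> /=; apply: ub_le_sup => //.
    by exists n.
  have := dn 0%N n; rewrite add0n t00 add0r expr0 => ->; rewrite andbT.
  apply: ge_sup; first by exists (t n); exists n.
  by move=> _ [m _ <-]; exact: bd.
have [||t0 t0P] := main (fun n => (sval (s n)).2.1).
- by [].
- by move=> n; have [_] := fP (s n); rewrite sn.
have [||u0 u0P] := main (fun n => (sval (s n)).2.2).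
- by [].
- by move=> n; have [_ _] := fP (s n); rewrite sn.
exists t0, u0 => n; exists (sval (s n)).2.1, (sval (s n)).2.2.
have := svalP (s n); rewrite sn => Pn.
by split => //; [case: (t0P n)|case: (t0P n)|case: (u0P n)|case: (u0P n)].
Qed.
End Dyadic.

Section Rectangles.
Variable R : realType.
Local Notation C := (cplx R).
Implicit Types (z w : C).

Lemma cder_horizontal (B : C -> C) (x y : R) (d : C) :
  cder B (Complex x y) d ->
  is_derive x 1 (fun s : R => complex.Re (B (Complex s y))) (complex.Re d).
Proof.
have E (s : R) : (Complex s y : C) = Complex 0 y + s%:C%C * 1.
  by rewrite mulr1; apply: cplx_eq; rewrite /= ?add0r ?addr0.
rewrite E => /cder_is_derive_Re; rewrite mulr1.
have -> : (fun s : R => complex.Re (B (Complex 0 y + s%:C%C * 1))) =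
  (fun s : R => complex.Re (B (Complex s y))) by apply/funext => s; rewrite -E.
by [].
Qed.

Lemma cder_vertical (B : C -> C) (x y : R) (d : C) :
  cder B (Complex x y) d ->
  is_derive y 1 (fun s : R => complex.Re (B (Complex x s))) (- complex.Im d).
Proof.
have E (s : R) : (Complex x s : C) = Complex x 0 + s%:C%C * Complex 0 1.
  by apply: cplx_eq => /=; ring.
rewrite E => /cder_is_derive_Re.
have -> : (fun s : R => complex.Re (B (Complex x 0 + s%:C%C * Complex 0 1))) =
  (fun s : R => complex.Re (B (Complex x s))) by apply/funext => s; rewrite -E.
have -> : complex.Re (d * Complex 0 1) = - complex.Im d by rewrite ReM /=; ring.
by [].
Qed.

Lemma halfpow_small (S d : R) : 0 < d -> exists n, S * (2^-1) ^+ n < d.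
Proof.
move=> d0; have [n] : exists n : nat, S / d < 2 ^+ n.
  exists (Num.trunc (S / d)).+1.
  apply: (lt_trans (truncnS_gt _)); rewrite -natrX ltr_nat; exact: ltn_expl.
move=> h; exists n; rewrite exprVn.
by rewrite ltr_pdivrMr ?exprn_gt0 // mulrC -ltr_pdivrMr.
Qed.

(** [U y] and [V x] are antiderivatives of the real part of [f] along horizontal
lines and of its imaginary part along vertical lines. Then [J a b c d] is the
integral along the boundary of a rectangle of the real part of [f z dz]. *)
Section Potential.
Variables (f : C -> C) (A : R) (U V : R -> R -> R).
Hypothesis UP : forall y x : R, - A < x < A ->
  is_derive x 1 (U y) (complex.Re (f (Complex x y))).
Hypothesis VP : forall x y : R, - A < y < A ->
  is_derive y 1 (V x) (complex.Im (f (Complex x y))).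

Let J a b c d := (U c b - U c a) - (U d b - U d a) - (V b d - V b c) +
  (V a d - V a c).

(** The affine approximation [f z0 + D * (z - z0)] has the primitive [B], so its
boundary integral telescopes to zero; what remains is the approximation error times
the perimeter. *)
Lemma form_small_square (z0 D : C) (e a b c d : R) :
  (forall x y : R, (x = a \/ x = b \/ y = c \/ y = d) ->
     (exists2 t : R, 0 <= t <= 1 & x = a + (b - a) * t) ->
     (exists2 t : R, 0 <= t <= 1 & y = c + (d - c) * t) ->
     [/\ - A < x < A, - A < y < A &
     normc (f (Complex x y) - f z0 - D * (Complex x y - z0)) <= e]) ->
  `|J a b c d| <= e * (2 * `|b - a| + 2 * `|d - c|).
Proof.
move=> h.
pose B (z : C) : C := f z0 * (z - z0) + D / 2%:R * ((z - z0) * (z - z0)).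
have Bd (z : C) : cder B z (f z0 + D * (z - z0)).
  have i0 := cderB (cder_id z) (cder_cst z0 z).
  have := cderD (cderZ (f z0) i0) (cderZ (D / 2%:R) (cderM i0 i0)).
  rewrite /B; congr (cder _ _ _); by field.
have hor (y : R) : (exists2 t : R, 0 <= t <= 1 & y = c + (d - c) * t) -> y = c \/ y = d ->
    `|(U y b - complex.Re (B (Complex b y))) -
      (U y a - complex.Re (B (Complex a y)))| <= e * `|b - a|.
  move=> yt ycd.
  apply: (@segment_bound R (fun s => U y s - complex.Re (B (Complex s y)))
    (fun s => complex.Re (f (Complex s y)) -
              complex.Re (f z0 + D * (Complex s y - z0)))) => t t01 s.
  have [|||sA _ sf] := h s y; [by tauto|by exists t|by []|].
  split; first by apply: is_deriveB; [exact: UP|exact: cder_horizontal].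
  by rewrite -ReN -ReD opprD addrA (le_trans (normc_Re _)).
have ver (x : R) : (exists2 t : R, 0 <= t <= 1 & x = a + (b - a) * t) -> x = a \/ x = b ->
    `|(- V x d - complex.Re (B (Complex x d))) -
      (- V x c - complex.Re (B (Complex x c)))| <= e * `|d - c|.
  move=> xt xab.
  apply: (@segment_bound R (fun s => - V x s - complex.Re (B (Complex x s)))
    (fun s => - complex.Im (f (Complex x s)) -
              - complex.Im (f z0 + D * (Complex x s - z0)))) => t t01 s.
  have [|||_ sA sf] := h x s; [by tauto|by []|by exists t|].
  split.
    apply: is_deriveB; last exact: cder_vertical.
    by apply: is_deriveN; exact: VP.
  rewrite -opprD normrN -ImN -ImD opprD addrA; apply: le_trans sf; exact: normc_Im.
have t0 (x y : R) : exists2 t : R, 0 <= t <= 1 & x = x + (y - x) * t.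
  by exists 0; rewrite ?lexx ?ler01 // mulr0 addr0.
have t1 (x y : R) : exists2 t : R, 0 <= t <= 1 & y = x + (y - x) * t.
  by exists 1; rewrite ?lexx ?ler01 // mulr1 addrC subrK.
have h1 := hor c (t0 c d) (or_introl erefl).
have h2 := hor d (t1 c d) (or_intror erefl).
have h3 := ver a (t0 a b) (or_introl erefl).
have h4 := ver b (t1 a b) (or_intror erefl).
rewrite !ler_norml in h1 h2 h3 h4 *; rewrite /J mulrDr.
by case/andP: h1 h2 h3 h4 => ? ? /andP[? ?] /andP[? ?] /andP[? ?]; apply/andP; split; lra.
Qed.

(** A nonzero integral over the rectangle persists, divided by four at each step,
in nested rectangles. At their common point it contradicts differentiability,
which makes the integral [o] of the squared diameter. *)
Lemma goursat (a c p q : R) :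
  (forall t u : R, 0 <= t <= 1 -> 0 <= u <= 1 ->
     let x := a + p * t in let y := c + q * u in
     [/\ - A < x < A, - A < y < A & exists d, cder f (Complex x y) d]) ->
  J a (a + p) c (c + q) = 0.
Proof.
move=> inA; apply/eqP; apply/negPn/negP => J0.
pose al := `|J a (a + p) c (c + q)|; have al0 : 0 < al by rewrite normr_gt0.
pose Jn (s t u : R) := J (a + p * t) (a + p * (t + s)) (c + q * u) (c + q * (u + s)).
pose P (n : nat) (t u : R) := al * (2^-1) ^+ n * (2^-1) ^+ n <= `|Jn ((2^-1) ^+ n) t u|.
have P0 : P 0%N 0 0.
  by rewrite /P expr0 !mulr1 /Jn !mulr0 !addr0 add0r !mulr1.
have step (n : nat) (t u : R) : P n t u -> exists t' u', [/\ P n.+1 t' u',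
    t' = t \/ t' = t + (2^-1) ^+ n.+1 & u' = u \/ u' = u + (2^-1) ^+ n.+1].
  rewrite /P; have -> : (2^-1 : R) ^+ n = (2^-1) ^+ n.+1 + (2^-1) ^+ n.+1.
    by rewrite exprS; field.
  set m := _ ^+ n.+1 => Pn.
  have JE : Jn (m + m) t u = Jn m t u + Jn m (t + m) u + Jn m t (u + m) +
      Jn m (t + m) (u + m) by rewrite /Jn /J !addrA; ring.
  rewrite JE in Pn.
  have [h|h1] := leP (al * m * m) `|Jn m t u|; first by exists t, u; split; auto.
  have [h|h2] := leP (al * m * m) `|Jn m (t + m) u|.
    by exists (t + m), u; split; auto.
  have [h|h3] := leP (al * m * m) `|Jn m t (u + m)|.
    by exists t, (u + m); split; auto.
  have [h|h4] := leP (al * m * m) `|Jn m (t + m) (u + m)|.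
    by exists (t + m), (u + m); split; auto.
  exfalso; rewrite !ltr_norml in h1 h2 h3 h4.
  move: Pn; apply/negP; rewrite -ltNge ltr_norml.
  case/andP: h1 h2 h3 h4 => ? ? /andP[? ?] /andP[? ?] /andP[? ?].
  by apply/andP; split; lra.
have [t0 [u0 nest]] := dyadic_nested P0 step.
have h01 : (0 <= t0 <= 1) /\ (0 <= u0 <= 1).
  have [t [u [_ t1 t2 u1 u2]]] := nest 0%N.
  case/andP: t1 t2 u1 u2 => ? ? /andP[? ?] /andP[? ?] /andP[? ?].
  by split; apply/andP; split; lra.
have [t001 u001] := h01.
pose z0 : C := Complex (a + p * t0) (c + q * u0).
have [_ _ [D /cder_eps fD]] := inA t0 u0 t001 u001.
pose S := `|p| + `|q|; have S0 : 0 <= S by rewrite addr_ge0.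
have S1 : 0 < 2 * S ^+ 2 + 1 by rewrite ltr_wpDl // mulr_ge0 // sqr_ge0.
(* With this relative error, the integral over the small rectangle is at most
   [2 * S ^+ 2 / (2 * S ^+ 2 + 1) < 1] times its lower bound. *)
have [d d0 dP] := fD _ (divr_gt0 al0 S1).
have [n nd] := halfpow_small S d0.
have [t [u [Pn /andP[t_0 t_1] /andP[t_2 t_3] /andP[u_0 u_1] /andP[u_2 u_3]]]] := nest n.
move: Pn nd; rewrite /P; set s := _ ^+ n in t_2 t_3 u_2 u_3 * => Pn nd.
have s0 : 0 < s by rewrite exprn_gt0 // invr_gt0.
have small (x y : R) :
    (exists2 v : R, 0 <= v <= 1 & x = a + p * t + p * s * v) ->
    (exists2 v : R, 0 <= v <= 1 & y = c + q * u + q * s * v) ->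
    [/\ - A < x < A, - A < y < A & normc (Complex x y - z0 : C) <= S * s].
  move=> [v v01 xE] [v' v01' yE].
  have [vs0 vs1] : 0 <= s * v /\ s * v <= s.
    by case/andP: v01 => ? ?; rewrite mulr_ge0 ?ler_piMr // ltW.
  have [vs0' vs1'] : 0 <= s * v' /\ s * v' <= s.
    by case/andP: v01' => ? ?; rewrite mulr_ge0 ?ler_piMr // ltW.
  have [||xA yA _] := inA (t + s * v) (u + s * v').
  - by apply/andP; split; lra.
  - by apply/andP; split; lra.
  have xE' : x = a + p * (t + s * v) by rewrite xE; ring.
  have yE' : y = c + q * (u + s * v') by rewrite yE; ring.
  split; [by rewrite xE'|by rewrite yE'|].
  rewrite (le_trans (normc_ReIm _)) // ReD ImD ReN ImN /= mulrDl lerD //.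
    have -> : x - (a + p * t0) = p * (t + s * v - t0) by rewrite xE'; ring.
    by rewrite normrM ler_wpM2l // ler_norml; apply/andP; split; lra.
  have -> : y - (c + q * u0) = q * (u + s * v' - u0) by rewrite yE'; ring.
  by rewrite normrM ler_wpM2l // ler_norml; apply/andP; split; lra.
have := @form_small_square z0 D (al / (2 * S ^+ 2 + 1) * (S * s)) (a + p * t)
  (a + p * (t + s)) (c + q * u) (c + q * (u + s)).
have -> : a + p * (t + s) - (a + p * t) = p * s by ring.
have -> : c + q * (u + s) - (c + q * u) = q * s by ring.
move=> fs; have {}fs : `|Jn s t u| <= al / (2 * S ^+ 2 + 1) * (S * s) * (2 * `|p * s| + 2 * `|q * s|).
  apply: fs => // x y _ hx hy; have [xA yA zz] := small x y hx hy.
  split => //; rewrite (le_trans (dP _ _)) //; first exact: le_lt_trans zz nd.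
  by rewrite ler_wpM2l // divr_ge0 // ltW.
have := le_trans Pn fs; apply/negP; rewrite -ltNge !normrM (gtr0_norm s0).
have -> : al / (2 * S ^+ 2 + 1) * (S * s) * (2 * (`|p| * s) + 2 * (`|q| * s)) =
  (al * s * s) * (2 * S ^+ 2 / (2 * S ^+ 2 + 1)).
  by rewrite /S; field; rewrite gt_eqF.
rewrite gtr_pMr ?mulr_gt0 // ltr_pdivrMr // mul1r; lra.
Qed.

End Potential.
End Rectangles.

(** * Primitives and the maximum modulus principle *)

Section MaxModulus.
Variable R : realType.
Local Notation C := (cplx R).
Implicit Types (z w : C).

Definition cderivable (f : C -> C) (a : C) := exists d, cder f a d.

(** The potential integrates the real part of [f z dz] along the real axis and then
vertically; by [goursat] the path may also end with a horizontal segment, which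
gives both partial derivatives. *)
Lemma goursat_potential (f : C -> C) (r : R) : 0 < r ->
  (forall z : C, {for z, continuous f}) ->
  (forall z : C, normc z < r -> cderivable f z) ->
  exists Phi : C -> R, forall z : C, normc z < r -> forall e : R, 0 < e ->
    exists2 d : R, 0 < d & forall h : C, normc h < d ->
      `|Phi (z + h) - Phi z - complex.Re (f z * h)| <= e * normc h.
Proof.
move=> r0 fc fd; pose A := r + 1.
have line (g : R -> C) (pr : C -> R) : (forall z, `|pr z| <= normc z) ->
    (forall z w, pr (z - w) = pr z - pr w) ->
    (forall x y : R, normc (g x - g y) <= `|x - y|) ->
    continuous (fun x => pr (f (g x))).
  move=> pr1 prB g1 x B /nbhs_ballP[e /= e0 eB].
  have [d d0 dP] := (ccontP f (g x)).1 (fc (g x)) e e0.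
  apply/nbhs_ballP; exists d => // y; rewrite /ball /= => xy.
  apply: eB; rewrite /ball /= distrC -prB (le_lt_trans (pr1 _)) // dP //.
  by rewrite (le_lt_trans (g1 _ _)) // distrC.
have Uex (y : R) : exists G : R -> R, forall x : R, - A < x < A ->
    is_derive x 1 G (complex.Re (f (Complex x y))).
  apply: antiderivative; apply: (line (fun x => Complex x y : C)).
  - exact: normc_Re.
  - by move=> z w; rewrite ReD ReN.
  - move=> x x'; rewrite (le_trans (normc_ReIm _)) // ReD ImD ReN ImN /=.
    by rewrite subrr normr0 addr0.
have Vex (x : R) : exists G : R -> R, forall y : R, - A < y < A ->
    is_derive y 1 G (complex.Im (f (Complex x y))).
  apply: antiderivative; apply: (line (fun y => Complex x y : C)).
  - exact: normc_Im.
  - by move=> z w; rewrite ImD ImN.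
  - move=> y y'; rewrite (le_trans (normc_ReIm _)) // ReD ImD ReN ImN /=.
    by rewrite subrr normr0 add0r.
have [U UP] := choice Uex; have [V VP] := choice Vex.
pose Phi (z : C) : R := (U 0 (complex.Re z) - U 0 0) -
  (V (complex.Re z) (complex.Im z) - V (complex.Re z) 0).
exists Phi => z zr e e0.
have e20 : 0 < e / 2 by exact: divr_gt0.
have [d d0 dP] := (ccontP f z).1 (fc z) _ e20.
exists (Num.min d (r - normc z)); first by rewrite lt_min d0 subr_gt0.
move=> h; rewrite lt_min => /andP[hd hr].
set x := complex.Re z; set y := complex.Im z.
set p := complex.Re h; set q := complex.Im h.
have zE : z = Complex x y by apply: cplx_eq.
have zhr : normc z + normc h < r by lra.
have ph := normc_Re h; have qh := normc_Im h; rewrite -/p -/q in ph qh.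
have xz := normc_Re z; have yz := normc_Im z; rewrite -/x -/y in xz yz.
have tp (t v : R) : 0 <= t <= 1 -> `|v * t| <= `|v|.
  by move=> /andP[t0 t1]; rewrite normrM (ger0_norm t0) ler_piMr.
have tp2 (t v : R) : 0 <= t <= 1 -> (v * t) ^+ 2 <= v ^+ 2.
  by move=> /andP[t0 t1]; rewrite exprMn ler_piMr ?sqr_ge0 // expr_le1.
have inA (v : R) : `|v| <= normc z + normc h -> - A < v < A.
  by move=> vle; rewrite -ltr_norml (le_lt_trans vle) // /A; lra.
have h0 := normc_ge0 h.
have rect := @goursat R f A U V UP VP x 0 p y.
have {}rect := rect _; cbv zeta in rect; rewrite !add0r in rect.
have {}rect : (U 0 (x + p) - U 0 x) - (U y (x + p) - U y x) -
    (V (x + p) y - V (x + p) 0) + (V x y - V x 0) = 0.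
  apply: rect => t u t01 u01; rewrite add0r.
  have xpt : `|x + p * t| <= normc z + normc h.
    by rewrite (le_trans (ler_normD _ _)) // lerD // (le_trans (tp _ _ t01)).
  have yu : `|y * u| <= normc z by rewrite (le_trans (tp _ _ u01)).
  split; first exact: inA.
    by apply: inA; rewrite (le_trans yu) // lerDl.
  apply: fd.
  have -> : (Complex (x + p * t) (y * u) : C) =
      Complex x (y * u) + Complex (p * t) 0.
    by apply: cplx_eq; rewrite /= ?addr0.
  rewrite (le_lt_trans (ler_normcD _ _)) // (le_lt_trans _ zhr) // lerD //.
    rewrite -(ler_pXn2r (n := 2)) ?nnegrE ?normc_ge0 // !normc_sqr /= lerD2l.
    exact: tp2.
  rewrite (le_trans (normc_ReIm _)) //= normr0 addr0.
  by rewrite (le_trans (tp _ _ t01)).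
have h1 : `|(U y (x + p) - complex.Re (f z) * (x + p)) -
    (U y x - complex.Re (f z) * x)| <= e / 2 * `|x + p - x|.
  apply: (@segment_bound R (fun s => U y s - complex.Re (f z) * s)
    (fun s => complex.Re (f (Complex s y)) - complex.Re (f z))) => t t01 s.
  have sE : s = x + p * t by rewrite /s; ring.
  split.
    apply: is_deriveB; first apply: UP.
      rewrite sE; apply: inA.
      by rewrite (le_trans (ler_normD _ _)) // lerD // (le_trans (tp _ _ t01)).
    by apply: is_derive_eq; rewrite /GRing.scale /= mulr1.
  rewrite -ReN -ReD (le_trans (normc_Re _)) // ltW // dP //.
  have -> : (Complex s y : C) - z = Complex (p * t) 0.
    by rewrite sE zE; apply: cplx_eq => /=; ring.
  rewrite (le_lt_trans (normc_ReIm _)) //= normr0 addr0.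
  by rewrite (le_lt_trans (tp _ _ t01)) // (le_lt_trans ph).
have h2 : `|(V (x + p) (y + q) - complex.Im (f z) * (y + q)) -
    (V (x + p) y - complex.Im (f z) * y)| <= e / 2 * `|y + q - y|.
  apply: (@segment_bound R (fun s => V (x + p) s - complex.Im (f z) * s)
    (fun s => complex.Im (f (Complex (x + p) s)) - complex.Im (f z))) => t t01 s.
  have sE : s = y + q * t by rewrite /s; ring.
  split.
    apply: is_deriveB; first apply: VP.
      rewrite sE; apply: inA.
      by rewrite (le_trans (ler_normD _ _)) // lerD // (le_trans (tp _ _ t01)).
    by apply: is_derive_eq; rewrite /GRing.scale /= mulr1.
  rewrite -ImN -ImD (le_trans (normc_Im _)) // ltW // dP //.
  have -> : (Complex (x + p) s : C) - z = Complex p (q * t).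
    by rewrite sE zE; apply: cplx_eq => /=; ring.
  apply: le_lt_trans hd.
  rewrite -(ler_pXn2r (n := 2)) ?nnegrE ?normc_ge0 // !normc_sqr /= lerD2l.
  exact: tp2.
rewrite [x + p - x]addrC addKr in h1; rewrite [y + q - y]addrC addKr in h2.
have -> : Phi (z + h) - Phi z - complex.Re (f z * h) =
   ((U y (x + p) - complex.Re (f z) * (x + p)) -
    (U y x - complex.Re (f z) * x)) - 
   ((V (x + p) (y + q) - complex.Im (f z) * (y + q)) -
    (V (x + p) y - complex.Im (f z) * y)).
  by rewrite /Phi !ReD !ImD ReM -/x -/y -/p -/q; lra.
rewrite (le_trans (ler_normB _ _)) // [e]splitr mulrDl lerD //.
  by rewrite (le_trans h1) // ler_wpM2l // ltW.
by rewrite (le_trans h2) // ler_wpM2l // ltW.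
Qed.

Lemma eps_cder (f : C -> C) (a d : C) :
  (forall e : R, 0 < e -> exists2 r : R, 0 < r & forall h : C, normc h < r ->
    normc (f (a + h) - f a - d * h) <= e * normc h) -> cder f a d.
Proof.
move=> fd.
exists (fun z => if z == a then d else (f z - f a) / (z - a)); split.
- apply/ccontP => e e0; rewrite eqxx.
  have [r r0 rP] := fd _ (divr_gt0 e0 (ltr0Sn _ 1)).
  exists r => // z zr; case: eqVneq => [_|za]; first by rewrite subrr normcC0.
  have := rP (z - a) zr; rewrite (addrC a) subrK => le.
  have za0 : z - a != 0 by rewrite subr_eq0.
  have -> : (f z - f a) / (z - a) - d = (f z - f a - d * (z - a)) / (z - a).
    by field.
  rewrite normcCM normcCV ltr_pdivrMr ?normc_gt0 // (le_lt_trans le) //.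
  by rewrite ltr_pM2r ?normc_gt0 // ltr_pdivrMr // ltr_pMr // ltr1n.
- by rewrite eqxx.
- near=> z; case: eqVneq => [->|za]; first by rewrite !subrr mulr0.
  by rewrite divfK // subr_eq0.
Unshelve. all: end_near. Qed.

(** Compose with the radial retraction onto the closed ball. *)
Lemma continuous_extension (f : C -> C) (r : R) : 0 < r ->
  (forall z : C, normc z <= r -> {for z, continuous f}) ->
  exists g : C -> C, (forall z : C, {for z, continuous g}) /\
    (forall z : C, normc z <= r -> g z = f z).
Proof.
move=> r0 fc; pose m (z : C) : C := (Num.max r (normc z))%:C%C.
have m0 (z : C) : 0 < Num.max r (normc z) by rewrite lt_max r0.
have mC0 (z : C) : m z != 0.
  by rewrite -normc_eq0 normc_real gtr0_norm // gt_eqF.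
have mc (z : C) : {for z, continuous m}.
  apply/ccontP => e e0; exists e => // w wz; rewrite /m -rmorphB normc_real.
  apply: le_lt_trans wz.
  have h1 := lerB_normc w z; have h2 := lerB_normc z w.
  rewrite normc_sub in h2; rewrite ler_norml.
  have [a|a] := leP r (normc w); have [b|b] := leP r (normc z);
    apply/andP; split; lra.
pose ret (z : C) : C := r%:C%C * (z / m z).
have retc (z : C) : {for z, continuous ret}.
  have h1 := ccontM (@ccont_id R z) (ccontV (mC0 z) (mc z)).
  exact: (ccontM (@ccont_cst R (r%:C%C) z) h1).
have retr (z : C) : normc (ret z) <= r.
  rewrite /ret !normcCM normcCV !normc_real (gtr0_norm r0) (gtr0_norm (m0 z)).
  rewrite ler_piMr //; first exact: ltW.
  by rewrite ler_pdivrMr // mul1r le_max lexx orbT.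
exists (fun z => f (ret z)); split.
  by move=> z; apply: ccont_comp; [exact: (fc _ (retr z))|exact: retc].
move=> z zr; congr f; rewrite /ret /m max_l // mulrCA mulfV ?mulr1 //.
by rewrite -normc_eq0 normc_real normr_eq0 gt_eqF.
Qed.

(** The real potentials of [f] and of [- i f] are the real and imaginary parts of a
primitive. *)
Lemma primitive_ball (f : C -> C) (r rho : R) : 0 < r -> r < rho ->
  (forall z : C, normc z < rho -> cderivable f z) ->
  exists F : C -> C, forall z : C, normc z < r -> cder F z (f z).
Proof.
move=> r0 rrho fd.
have fc (z : C) : normc z <= r -> {for z, continuous f}.
  by move=> zr; have [d /cder_cont] := fd z (le_lt_trans zr rrho).
have [g [gc gf]] := continuous_extension r0 fc.
have near_ball (z : C) : normc z < r -> \forall w \near z, normc w < r.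
  move=> zr; apply/cnbhsP; exists (r - normc z); first by rewrite subr_gt0.
  by move=> w wz; have := lerB_normc w z; lra.
have gd (z : C) : normc z < r -> cderivable g z.
  move=> zr; have [d fzd] := fd z (lt_trans zr rrho); exists d.
  by apply: cder_near fzd; apply: filterS (near_ball z zr) => w /ltW /gf ->.
pose i : C := Complex 0 1.
have [P1 P1P] := goursat_potential r0 gc gd.
have [||P2 P2P] := @goursat_potential (fun z => - i * g z) r r0.
- by move=> z; apply: (ccontM (@ccont_cst R (- i) z) (gc z)).
- by move=> z /gd[d gzd]; exists (- i * d); exact: cderZ.
exists (fun z => Complex (P1 z) (P2 z)) => z zr; apply: eps_cder => e e0.
have e20 : 0 < e / 2 by exact: divr_gt0.
have [d1 d10 h1] := P1P z zr _ e20; have [d2 d20 h2] := P2P z zr _ e20.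
exists (Num.min d1 d2); first by rewrite lt_min d10.
move=> h; rewrite lt_min => /andP[/h1 {}h1 /h2 {}h2].
rewrite (le_trans (normc_ReIm _)) // [e]splitr mulrDl lerD //.
  by apply: le_trans h1; rewrite !ReD !ReN /= (gf z (ltW zr)).
apply: le_trans h2; rewrite !ImD !ImN /= (gf z (ltW zr)).
suff -> : complex.Im (f z * h) = complex.Re (- i * f z * h) by [].
by rewrite -mulrA (ReM (- i)) /=; ring.
Qed.

(** Goursat's theorem provides the primitive which [max_mod_primitive] asks for, on
a ball between the two radii. *)
Lemma max_modulus (f : C -> C) (r rho M : R) : 0 <= r -> r < rho ->
  (forall z : C, normc z < rho -> cderivable f z) ->
  (forall z : C, normc z = r -> normc (f z) <= M) ->
  forall z : C, normc z <= r -> normc (f z) <= M.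
Proof.
move=> r0 rrho fd fM.
pose r1 := (r + rho) / 2.
have r10 : 0 < r1 by rewrite /r1; lra.
have rr1 : r < r1 by rewrite /r1; lra.
have r1rho : r1 < rho by rewrite /r1; lra.
have [F FP] := primitive_ball r10 r1rho fd.
have [f1 f1P] : exists f1 : C -> C, forall z : C, normc z < r1 -> cder f z (f1 z).
  have : forall z : C, exists d : C, normc z < r1 -> cder f z d.
    move=> z; have [zr|zr] := ltP (normc z) r1; last by exists 0.
    by have [d fzd] := fd z (lt_trans zr r1rho); exists d.
  by move=> /choice[f1 f1P]; exists f1.
apply: (@max_mod_primitive R F f f1 r r1 M r0 rr1) => // z zr.
by split; [exact: FP|exact: f1P].
Qed.
End MaxModulus.

(** * Schwarz-Pick inequalities *)

Section SchwarzPick.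
Variable R : realType.
Local Notation C := (cplx R).
Implicit Types (z w a : C) (f g : C -> C).
Local Notation cderivable := (@cderivable R).

Lemma cderivable_cst (c a : C) : cderivable (fun=> c) a.
Proof. by exists 0; exact: cder_cst. Qed.

Lemma cderivable_id a : cderivable (fun z => z) a.
Proof. by exists 1; exact: cder_id. Qed.

Lemma cderivableM f g a : cderivable f a -> cderivable g a ->
  cderivable (fun z => f z * g z) a.
Proof. by move=> [d fd] [e ge]; eexists; exact: cderM fd ge. Qed.

Lemma cderivableB f g a : cderivable f a -> cderivable g a ->
  cderivable (fun z => f z - g z) a.
Proof. by move=> [d fd] [e ge]; eexists; exact: cderB fd ge. Qed.

Lemma cderivableV f a : f a != 0 -> cderivable f a ->
  cderivable (fun z => (f z)^-1) a.
Proof. by move=> fa [d fd]; eexists; exact: cderV fa fd. Qed.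

Lemma cderivableX f a n : cderivable f a -> cderivable (fun z => f z ^+ n) a.
Proof. by move=> [d fd]; have [e h] := cderX n fd; exists e. Qed.

Lemma cderivable_comp f g a : cderivable f (g a) -> cderivable g a ->
  cderivable (fun z => f (g z)) a.
Proof. by move=> [d fd] [e ge]; eexists; exact: cder_comp fd ge. Qed.

Lemma cderivable_cont f a : cderivable f a -> {for a, continuous f}.
Proof. by move=> [d /cder_cont]. Qed.

Lemma cderivable_near f g a : (\forall z \near a, f z = g z) ->
  cderivable f a -> cderivable g a.
Proof. by move=> fg [d fd]; exists d; exact: cder_near fg fd. Qed.

(** A continuous factor is harmless at a zero of the other factor. *)
Lemma cderM_zero f g a : {for a, continuous f} -> cderivable g a -> g a = 0 ->
  cderivable (fun z => f z * g z) a.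
Proof.
move=> fc [d [q [qc qa qg]]] ga0; exists (f a * d).
exists (fun z => f z * q z); split.
- exact: (ccontM fc qc).
- by rewrite qa.
- near=> z; rewrite ga0 mulr0 subr0 -mulrA; congr (_ * _).
  by rewrite -[LHS]subr0 -ga0; near: z.
Unshelve. all: end_near. Qed.

Lemma ccontX f a n : {for a, continuous f} ->
  {for a, continuous (fun z => f z ^+ n)}.
Proof.
move=> fc; elim: n => [|n ih].
  by apply: (near_eq_cont _ _ (@ccont_cst R 1 a)); [near=> z|].
apply: (near_eq_cont _ _ (ccontM fc ih)); [near=> z|]; by rewrite exprS.
Unshelve. all: end_near. Qed.

Lemma bernoulli (d : R) n : 0 <= d -> 1 + n%:R * d <= (1 + d) ^+ n.
Proof.
move=> d0; elim: n => [|n ih]; first by rewrite mul0r addr0 expr0.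
have n0 : 0 <= n%:R * d by rewrite mulr_ge0.
have : (1 + d) * (1 + n%:R * d) <= (1 + d) * (1 + d) ^+ n.
  by rewrite ler_wpM2l // addr_ge0.
rewrite exprS; apply: le_trans; rewrite -natr1; nra.
Qed.

Lemma le_of_powers (x M c D : R) : 0 <= x -> 0 <= M -> 0 < c ->
  (forall n, x ^+ n * c <= M ^+ n * D) -> x <= M.
Proof.
move=> x0 M0 c0 h; rewrite leNgt; apply/negP => Mx.
have [M00|M00] := eqVneq M 0.
  have := h 1%N; rewrite !expr1 M00 mul0r leNgt mulr_gt0 //.
  by rewrite -M00.
have Mp : 0 < M by rewrite lt_def M00.
pose d := x / M - 1; have d0 : 0 < d by rewrite subr_gt0 ltr_pdivlMr // mul1r.
have bern n : 1 + n%:R * d <= (x / M) ^+ n.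
  have -> : x / M = 1 + d by rewrite /d addrCA subrr addr0.
  by apply: bernoulli; exact: ltW.
pose n := (Num.trunc (D / c / d)).+1.
have : D / c / d < n%:R by exact: truncnS_gt.
rewrite ltr_pdivrMr // => h1.
have := h n; rewrite -ler_pdivrMl ?exprn_gt0 // mulrA -exprVn -exprMn.
rewrite (mulrC M^-1) -ler_pdivlMr //.
have := bern n; lra.
Qed.

Lemma avoid_seq (s : seq C) (a : C) (e : R) : 0 < e ->
  exists w : C, normc (w - a) < e /\ w \notin s.
Proof.
move=> e0; pose p (k : nat) : C := a + (e / k.+2%:R)%:C%C.
have pinj : injective p.
  move=> i j /addrI/(congr1 (@complex.Re R)) /= /(mulfI (lt0r_neq0 e0)) /invr_inj.
  by move=> /eqP; rewrite eqr_nat => /eqP[].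
pose l := [seq p k | k <- iota 0 (size s).+1].
have lu : uniq l by rewrite map_inj_uniq ?iota_uniq.
have [|/allPn[_ /mapP[k _ ->] ks]] := boolP (all (mem s) l).
  by move=> /allP /(uniq_leq_size lu); rewrite size_map size_iota ltnn.
exists (p k); split => //; rewrite /p addrC addKr normc_real gtr0_norm.
  by rewrite ltr_pdivrMr // ltr_pMr // ltr1n.
by rewrite divr_gt0.
Qed.

(** With [P] the product of the [z - a], the function [f ^+ n * P] is differentiable
also at the exceptional points. The bound it inherits loses a factor independent
of [n], which disappears after taking [n]-th roots. *)
Lemma max_modulus_except (s : seq C) f (r rho M : R) : 0 <= r -> r < rho ->
  (forall z, normc z < rho -> {for z, continuous f}) ->
  (forall z, normc z < rho -> z \notin s -> cderivable f z) ->
  (forall z, normc z = r -> normc (f z) <= M) ->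
  forall z, normc z <= r -> normc (f z) <= M.
Proof.
move=> r0 rrho fc fd fM.
have M0 : 0 <= M.
  apply: (le_trans (normc_ge0 (f r%:C%C))); apply: fM.
  by rewrite normc_real ger0_norm.
pose P (z : C) : C := \prod_(a <- s) (z - a).
have Pd z : cderivable P z.
  rewrite /P; elim: s {fd P} => [|a s ih].
    apply: cderivable_near (cderivable_cst 1 z).
    by near=> w; rewrite big_nil.
  apply: cderivable_near (cderivableM
    (cderivableB (cderivable_id z) (cderivable_cst a z)) ih).
  by near=> w; rewrite big_cons.
have P0 z : (P z == 0) = (z \in s).
  rewrite /P prodf_seq_eq0; apply/hasP/idP => [[a sa]|zs].
    by rewrite subr_eq0 => /eqP ->.
  by exists z => //=; rewrite subrr.
have PM z : normc z <= r -> normc (P z) <= \prod_(a <- s) (r + normc a).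
  move=> zr; rewrite /P; elim: (s) => [|a l ih].
    by rewrite !big_nil normcC1.
  rewrite !big_cons normcCM ler_pM ?normc_ge0 //.
  by rewrite (le_trans (ler_normcB _ _)) // lerD2r.
have off z : normc z <= r -> z \notin s -> normc (f z) <= M.
  move=> zr zs; apply: (@le_of_powers _ _ (normc (P z))
    (\prod_(a <- s) (r + normc a))); rewrite ?normc_ge0 ?normc_gt0 ?P0 //.
  move=> n; rewrite -normcX -normcCM.
  apply: (@max_modulus R (fun z => f z ^+ n * P z) r rho) => // w wr.
    have [ws|ws] := boolP (w \in s).
      have Pw : P w = 0 by apply/eqP; rewrite P0.
      have h1 := @ccontX f w n (fc w wr).
      have h2 := cderM_zero h1 (Pd w) Pw.
      exact: h2.
    exact: (cderivableM (@cderivableX f w n (fd w wr ws)) (Pd w)).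
  rewrite normcCM normcX ler_pM ?exprn_ge0 ?normc_ge0 ?PM ?wr //.
  by apply: lerXn2r; rewrite ?nnegrE ?normc_ge0 ?fM.
move=> z zr; move: (zr); rewrite le_eqVlt => /orP[/eqP/fM//|zlt].
apply/ler_addgt0Pr => e e0.
have [d d0 dP] := (ccontP f z).1 (fc z (le_lt_trans zr rrho)) e e0.
have m0 : 0 < Num.min d (r - normc z) by rewrite lt_min d0 subr_gt0.
have [w []] := avoid_seq s z m0; rewrite lt_min => /andP[wd wr] ws.
have h1 : normc (f w) <= M.
  apply: off => //; have := lerB_normc w z; lra.
have := dP w wd; have := lerB_normc (f z) (f w); rewrite normc_sub; lra.
Unshelve. all: end_near. Qed.

Lemma normc_blaschke a z : normc (1 - (a^*)%C * z) ^+ 2 =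
  normc (z - a) ^+ 2 + (1 - normc a ^+ 2) * (1 - normc z ^+ 2).
Proof. by rewrite !normc_sqr; case: a z => x y [p q] /=; ring. Qed.

Lemma normc_conj a : normc ((a^*)%C : C) = normc a.
Proof. by case: a => x y /=; rewrite sqrrN. Qed.

Lemma one_sub_conj_neq0 a z : normc a < 1 -> normc z <= 1 ->
  1 - (a^*)%C * z != 0.
Proof.
move=> a1 z1; rewrite -normc_gt0.
apply: lt_le_trans (lerB_normc _ _); rewrite normcC1 subr_gt0 normcCM normc_conj.
have a0 := normc_ge0 a; have z0 := normc_ge0 z; nra.
Qed.

Lemma blaschke_le a z : normc a <= 1 -> normc z <= 1 ->
  normc (z - a) <= normc (1 - (a^*)%C * z).
Proof.
move=> a1 z1; rewrite -(ler_pXn2r (n := 2)) ?nnegrE ?normc_ge0 //.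
have a0 := normc_ge0 a; have z0 := normc_ge0 z.
by rewrite normc_blaschke lerDl mulr_ge0 // subr_ge0 expr_le1.
Qed.

(** The slope of [f] at [a], completed by the value [d] at [a] itself. *)
Definition dquot f (a d : C) : C -> C :=
  fun w => if w == a then d else (f w - f a) / (w - a).

Lemma dquot_off f (a d w : C) : w != a ->
  \forall v \near w, (f v - f a) / (v - a) = dquot f a d v.
Proof.
move=> wa; have : \forall v \near w, v - a != 0.
  have h := ccontB (@ccont_id R w) (@ccont_cst R a w).
  by apply: (cont_neq0 h); rewrite subr_eq0.
by apply: filterS => v; rewrite subr_eq0 /dquot => /negbTE ->.
Qed.

Lemma dquot_cont f (a d w : C) : cder f a d -> {for w, continuous f} ->
  {for w, continuous (dquot f a d)}.
Proof.
move=> [q [qc qa qf]] fc; have [->|wa] := eqVneq w a.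
  apply: (near_eq_cont _ _ qc); last by rewrite /dquot eqxx.
  near=> v; rewrite /dquot; case: eqVneq => [->//|va].
  have -> : f v - f a = q v * (v - a) by near: v.
  by rewrite mulfK // subr_eq0.
have wa0 : w - a != 0 by rewrite subr_eq0.
have h1 := @ccontV R (fun v => v - a) w wa0
  (ccontB (@ccont_id R w) (@ccont_cst R a w)).
have h2 := ccontB fc (@ccont_cst R (f a) w).
apply: (near_eq_cont (dquot_off f d wa) _ (ccontM h2 h1)).
by rewrite /dquot (negbTE wa).
Unshelve. all: end_near. Qed.

Lemma dquot_cderivable f (a d w : C) : w != a -> cderivable f w ->
  cderivable (dquot f a d) w.
Proof.
move=> wa fw; apply: (cderivable_near (dquot_off f d wa)).
apply: (cderivableM (cderivableB fw (cderivable_cst (f a) w))).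
apply: cderivableV; first by rewrite subr_eq0.
exact: (cderivableB (cderivable_id w) (cderivable_cst a w)).
Qed.

(** Divide the Moebius transform of [f] vanishing at [a] by the one of [z]. The
quotient is continuous on the disc, differentiable except on [a :: s], and its
modulus on the circle of radius [r] is at most [1 + O(1 - r)]. *)
Lemma schwarz_pick (s : seq C) f a z :
  (forall w, normc w < 1 -> {for w, continuous f}) ->
  (forall w, normc w < 1 -> w \notin s -> cderivable f w) ->
  (forall w, normc w < 1 -> normc (f w) < 1) ->
  normc a < 1 -> a \notin s -> normc z < 1 ->
  normc (f z - f a) * normc (1 - (a^*)%C * z) <=
  normc (1 - ((f a)^*)%C * f z) * normc (z - a).
Proof.
move=> fc fd f1 a1 as_ z1.
have den0 w : normc w < 1 -> 1 - ((f a)^*)%C * f w != 0.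
  by move=> w1; apply: one_sub_conj_neq0; [exact: f1|rewrite ltW // f1].
pose N (w : C) : C := (f w - f a) * (1 - ((f a)^*)%C * f w)^-1 * (1 - (a^*)%C * w).
have Nc w : normc w < 1 -> {for w, continuous N}.
  move=> w1; have h1 := ccontB (fc w w1) (@ccont_cst R (f a) w).
  have h2 := ccontB (@ccont_cst R 1 w)
    (ccontM (@ccont_cst R ((f a)^*)%C w) (fc w w1)).
  have h3 := ccontB (@ccont_cst R 1 w)
    (ccontM (@ccont_cst R (a^*)%C w) (@ccont_id R w)).
  exact: (ccontM (ccontM h1 (@ccontV R (fun v => 1 - ((f a)^*)%C * f v) w (den0 w w1) h2)) h3).
have Nd w : normc w < 1 -> w \notin s -> cderivable N w.
  move=> w1 ws; have fw := fd w w1 ws.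
  have h1 := cderivableB fw (cderivable_cst (f a) w).
  have h2 := cderivableB (cderivable_cst 1 w)
    (cderivableM (cderivable_cst ((f a)^*)%C w) fw).
  have h3 := cderivableB (cderivable_cst 1 w)
    (cderivableM (cderivable_cst (a^*)%C w) (cderivable_id w)).
  exact: (cderivableM (cderivableM h1 (@cderivableV (fun v => 1 - ((f a)^*)%C * f v) w (den0 w w1) h2)) h3).
have Na : N a = 0 by rewrite /N subrr !mul0r.
have [d Nda] := Nd a a1 as_; pose k := dquot N a d.
have kE w : w != a -> k w = N w / (w - a).
  by move=> wa; rewrite /k /dquot (negbTE wa) Na subr0.
have kc w : normc w < 1 -> {for w, continuous k}.
  by move=> w1; exact: (dquot_cont Nda (Nc w w1)).
have kd w : normc w < 1 -> w \notin a :: s -> cderivable k w.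
  rewrite inE negb_or => w1 /andP[wa ws].
  exact: (dquot_cderivable _ wa (Nd w w1 ws)).
have kM (r : R) : normc a < r -> r < 1 -> forall w, normc w = r ->
    normc (k w) <= 1 + (1 - r) / (r - normc a) ^+ 2.
  move=> ar r1 w wr; have ra0 : 0 < r - normc a by rewrite subr_gt0.
  have wa : w != a by apply: contraTneq ar => <-; rewrite wr ltxx.
  rewrite kE // /N normcCM normcCV normcCM.
  have wal : r - normc a <= normc (w - a) by rewrite -wr; exact: lerB_normc.
  have wa0 : 0 < normc (w - a) by exact: lt_le_trans wal.
  have r0 : 0 <= r by rewrite (le_trans (normc_ge0 a)) // ltW.
  have B1 : normc ((f w - f a) / (1 - ((f a)^*)%C * f w)) <= 1.
    have w1 : normc w < 1 by rewrite wr.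
    rewrite normcCM normcCV ler_pdivrMr ?normc_gt0 ?den0 // mul1r.
    by apply: blaschke_le; rewrite ltW // f1.
  rewrite ler_pdivrMr //.
  apply: (@le_trans _ _ (normc (1 - (a^*)%C * w))).
    by rewrite ler_piMl ?normc_ge0.
  set x := normc (w - a) in wal wa0 *.
  have x1 : (1 - r) / x ^+ 2 <= (1 - r) / (r - normc a) ^+ 2.
    rewrite ler_wpM2l ?subr_ge0 ?(ltW r1) // lef_pV2 ?posrE ?exprn_gt0 //.
    by rewrite ler_pXn2r ?nnegrE // ltW.
  apply: (@le_trans _ _ ((1 + (1 - r) / x ^+ 2) * x)); last first.
    by rewrite ler_pM2r // lerD2l.
  have xE : (1 + (1 - r) / x ^+ 2) * x = x + (1 - r) / x.
    by field; rewrite gt_eqF.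
  have y0 : 0 <= (1 - r) / x by rewrite divr_ge0 ?subr_ge0 // ltW.
  rewrite xE -(ler_pXn2r (n := 2)) ?nnegrE ?normc_ge0 ?addr_ge0 // ?(ltW wa0) //.
  rewrite normc_blaschke -/x wr sqrrD -addrA lerD2l.
  have -> : x * ((1 - r) / x) *+ 2 = 2 * (1 - r) by field; rewrite gt_eqF.
  have a0 := sqr_ge0 (normc a); have y2 := sqr_ge0 ((1 - r) / x).
  have r2 : 0 <= 1 - r ^+ 2 by rewrite subr_ge0 expr_le1 // ltW.
  have e1 : (1 - normc a ^+ 2) * (1 - r ^+ 2) <= 1 - r ^+ 2.
    by rewrite ler_piMl // gerBl.
  have e2 := sqr_ge0 (1 - r); rewrite sqrrB expr1n mul1r in e2.
  lra.
have k1 : normc (k z) <= 1.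
  apply/ler_addgt0Pr => e e0.
  pose D := (1 - Num.max (normc a) (normc z)) / 2.
  have [D0 Da Dz] : [/\ 0 < D, normc a <= 1 - 2 * D & normc z <= 1 - 2 * D].
    rewrite /D; have [az|za] := leP (normc a) (normc z); split; lra.
  have e1 : 0 < Num.min D (e * D ^+ 2).
    by rewrite lt_min D0 mulr_gt0 // exprn_gt0.
  pose r := 1 - Num.min D (e * D ^+ 2).
  have [rD re] : 1 - r <= D /\ 1 - r <= e * D ^+ 2.
    by rewrite /r opprB addrCA subrr addr0; split; rewrite ge_min lexx ?orbT.
  have r1 : r < 1 by rewrite /r; lra.
  have ar : normc a < r by lra.
  have zr : normc z <= r by lra.
  have r0 : 0 <= r by rewrite (le_trans (normc_ge0 a)) // ltW.
  have h := @max_modulus_except (a :: s) k r 1 _ r0 r1 kc kd (kM r ar r1) z zr.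
  rewrite (le_trans h) // lerD2l ler_pdivrMr ?exprn_gt0 ?subr_gt0 //.
  rewrite (le_trans re) // ler_wpM2l ?(ltW e0) // ler_pXn2r ?nnegrE ?(ltW D0) //.
    by lra.
  by rewrite subr_ge0 ltW.
have [->|za] := eqVneq z a; first by rewrite !subrr normcC0 mulr0 mul0r.
have za0 : 0 < normc (z - a) by rewrite normc_gt0 subr_eq0.
move: k1; rewrite kE // /N normcCM normcCV ler_pdivrMr // mul1r.
rewrite !normcCM normcCV mulrAC ler_pdivrMr ?normc_gt0 ?den0 //.
by rewrite (mulrC (normc (z - a))).
Qed.

(** The Cayley transform [(P - s) / (P + s)] maps into the disc and vanishes at [0]. *)
Lemma schwarz_half_plane (P : C -> C) (s : R) : 0 < s -> P 0 = s%:C%C ->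
  (forall w, normc w < 1 -> cderivable P w) ->
  (forall w, normc w < 1 -> 0 < complex.Re (P w)) ->
  forall z, normc z < 1 ->
  normc (P z - s%:C%C) <= normc z * normc (P z + s%:C%C).
Proof.
move=> s0 P0 Pd Pp z z1.
have cayley (p : C) : 0 < complex.Re p ->
    normc (p - s%:C%C) < normc (p + s%:C%C).
  move=> p0; rewrite -(ltr_pXn2r (n := 2)) ?nnegrE ?normc_ge0 // !normc_sqr.
  by case: p p0 => x y /= p0; nra.
have den0 w : normc w < 1 -> P w + s%:C%C != 0.
  move=> /Pp /cayley h; rewrite -normc_gt0; apply: le_lt_trans h.
  exact: normc_ge0.
pose f (w : C) : C := (P w - s%:C%C) * (P w + s%:C%C)^-1.
have fd w : normc w < 1 -> cderivable f w.
  move=> w1; have h1 := cderivableB (Pd w w1) (cderivable_cst (s%:C%C) w).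
  have h2 := cderivableB (Pd w w1) (cderivable_cst (- s%:C%C) w).
  have h3 : P w - - s%:C%C != 0 by rewrite opprK den0.
  have := cderivableM h1 (@cderivableV (fun v => P v - - s%:C%C) w h3 h2).
  by apply: cderivable_near; near=> v; rewrite opprK.
have f1 w : normc w < 1 -> normc (f w) < 1.
  move=> w1; rewrite /f normcCM normcCV ltr_pdivrMr ?normc_gt0 ?den0 // mul1r.
  exact/cayley/Pp.
have n01 : normc (0 : C) < 1 by rewrite normcC0.
have fc w : normc w < 1 -> {for w, continuous f}.
  by move=> /fd /cderivable_cont.
have fd' w : normc w < 1 -> w \notin ([::] : seq C) -> cderivable f w.
  by move=> /fd.
have := schwarz_pick fc fd' f1 n01 isT z1.
have -> : f 0 = 0 by rewrite /f P0 subrr mul0r.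
have -> : ((0 : C)^*)%C = (0 : C) by apply: cplx_eq; rewrite //= oppr0.
rewrite !subr0 !mul0r !subr0 normcC1 mulr1 mul1r /f normcCM normcCV.
by rewrite ler_pdivrMr // normc_gt0 den0.
Unshelve. all: end_near. Qed.

(** The disc of Apollonius given by [schwarz_half_plane] stays away from the
imaginary axis (Harnack) and is bounded (Borel-Caratheodory). *)
Lemma half_plane_bounds (p : C) (s r : R) : 0 < s -> 0 <= r < 1 ->
  normc (p - s%:C%C) <= r * normc (p + s%:C%C) ->
  s * (1 - r) / 2 <= complex.Re p /\ normc (p - s%:C%C) <= 2 * s * r / (1 - r).
Proof.
move=> s0 /andP[r0 r1] h; have r10 : 0 < 1 - r by rewrite subr_gt0.
split; last first.
  rewrite ler_pdivlMr //.
  have : normc (p + s%:C%C) <= normc (p - s%:C%C) + 2 * s.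
    have -> : p + s%:C%C = (p - s%:C%C) + (2 * s)%:C%C by rewrite rmorphM /=; ring.
    rewrite (le_trans (ler_normcD _ _)) // normc_real ger0_norm //.
    by rewrite mulr_ge0 // ltW.
  nra.
have : normc (p - s%:C%C) ^+ 2 <= (r * normc (p + s%:C%C)) ^+ 2.
  by rewrite ler_pXn2r ?nnegrE ?mulr_ge0 ?normc_ge0.
rewrite exprMn !normc_sqr; case: p {h} => x y /=; rewrite subr0 addr0 => h.
have y0 : r ^+ 2 * y ^+ 2 <= y ^+ 2.
  by rewrite ler_piMl ?sqr_ge0 // expr_le1 // ltW.
have h2 : (x - s) ^+ 2 <= (r * (x + s)) ^+ 2 by rewrite exprMn; lra.
have xs : 0 <= x + s.
  rewrite leNgt; apply/negP => xs.
  have : (r * (x + s)) ^+ 2 <= (x + s) ^+ 2.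
    by rewrite exprMn ler_piMl ?sqr_ge0 // expr_le1 // ltW.
  nra.
have h3 : s - x <= r * (x + s).
  rewrite leNgt; apply/negP => h4.
  have := mulr_ge0 r0 xs; nra.
have h4 : s * (1 - r) <= x * (1 + r) by lra.
have sr : 0 < s * (1 - r) by rewrite mulr_gt0.
have x0 : 0 <= x by rewrite leNgt; apply/negP => x0; nra.
have : x * (1 + r) <= x * 2 by rewrite ler_wpM2l //; lra.
lra.
Qed.

(** An injective holomorphic function has no critical point: if [f'(0) = 0],
the difference quotients based at nearby points are zero free, and the minimum
principle for them contradicts their value at [0]. *)
Lemma injective_cder_neq0 f (rho : R) (d : C) : 0 < rho ->
  (forall w, normc w < rho -> cderivable f w) ->
  (forall w v, normc w < rho -> normc v < rho -> f w = f v -> w = v) ->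
  cder f 0 d -> d != 0.
Proof.
move=> rho0 fd finj f0d; apply/eqP => d0; subst d.
pose r := rho / 2.
have r0 : 0 < r by exact: divr_gt0.
have rrho : r < rho by rewrite /r; lra.
have n0 : normc (0 : C) < rho by rewrite normcC0.
have fc w : normc w < rho -> {for w, continuous f}.
  by move=> /fd /cderivable_cont.
have [c0 c00 c0P] : exists2 c0 : R, 0 < c0 &
    forall w, normc w = r -> c0 <= normc (f w - f 0).
  pose u (w : C) : R := - (normc (f w - f 0) + (r - normc w)).
  have uc w : normc w <= r -> forall e : R, 0 < e -> exists2 d : R, 0 < d &
      forall v : C, normc v <= r -> normc (v - w) < d -> `|u v - u w| < e.
    move=> wr e e0; have e20 : 0 < e / 2 by exact: divr_gt0.
    have [d d0 dP] := (ccontP f w).1 (fc w (le_lt_trans wr rrho)) _ e20.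
    exists (Num.min d (e / 2)); first by rewrite lt_min d0.
    move=> v _; rewrite lt_min => /andP[/dP h1 h2].
    have h3 := lerB_normc (f v - f 0) (f w - f 0).
    have h4 := lerB_normc (f w - f 0) (f v - f 0).
    have E (x y : C) : x - f 0 - (y - f 0) = x - y by ring.
    rewrite E in h3; rewrite E (normc_sub (f w) (f v)) in h4.
    have h5 := lerB_normc v w; have h6 := lerB_normc w v.
    rewrite (normc_sub w v) in h6.
    by rewrite /u ltr_norml; apply/andP; split; lra.
  have [c cr cmax] := closed_ball_max (ltW r0) uc.
  exists (- u c).
    rewrite /u opprK; have [->|c0] := eqVneq c 0.
      by rewrite subrr normcC0 add0r subr0.
    apply: ltr_pwDl; last by rewrite subr_ge0.
    rewrite normc_gt0 subr_eq0; apply: contra_neq c0 => /finj; apply => //.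
    exact: le_lt_trans rrho.
  move=> w wr; have := cmax w; rewrite wr lexx /u wr => /(_ isT).
  by rewrite subrr addr0; lra.
have [q [/ccontP qc q0 /cnbhsP[d1 d10 qf]]] := f0d.
pose eps := c0 / (4 * r).
have eps0 : 0 < eps by rewrite divr_gt0 // mulr_gt0.
have [d2 d20 d2P] := qc _ eps0.
have [d3 d30 d3P] := (ccontP f 0).1 (fc 0 n0) _ (divr_gt0 c00 (ltr0Sn _ 1)).
pose m := Num.min (Num.min d1 d2) (Num.min d3 r).
have m0 : 0 < m by rewrite /m !lt_min d10 d20 d30 r0.
(* a nearby point which is not critical *)
(* Otherwise the derivative vanishes near [0] and [f] is constant there. *)
have [a [a0 am [da fda da0]]] : exists a : C, [/\ a != 0, normc a < m &
    exists2 da : C, cder f a da & da != 0].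
  apply: contrapT => nex.
  have crit w : normc w < m -> cder f w 0.
    move=> wm; have [->//|w0] := eqVneq w 0; have [|e fwe] := fd w.
      apply: (lt_trans wm); apply: le_lt_trans rrho.
      by rewrite /m !ge_min lexx !orbT.
    have [e0|e0] := eqVneq e 0; first by rewrite -e0.
    by exfalso; apply: nex; exists w; split => //; exists e.
  pose b : C := (m / 2)%:C%C.
  have bm : normc b < m.
    by rewrite normc_real gtr0_norm ?divr_gt0 // ltr_pdivrMr // ltr_pMr // ltr1n.
  have := @cmvt R f (fun=> 0) 0 b 0; rewrite mul0r => h.
  have {}h : normc (f b - f 0) <= 0.
    apply: h => s /andP[s0 s1] w; split; last by rewrite normcC0.
    apply: crit; rewrite /w subr0 add0r normc_mulr ger0_norm //.
    by apply: le_lt_trans bm; rewrite ler_piMl ?normc_ge0.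
  have /eqP : normc (f b - f 0) == 0 by rewrite eq_le h normc_ge0.
  move=> /eq0_normc /eqP; rewrite subr_eq0 => /eqP /finj.
  have brho : normc b < rho.
    apply: (lt_trans bm); apply: le_lt_trans rrho.
    by rewrite /m !ge_min lexx !orbT.
  move=> /(_ brho n0) /(congr1 (@complex.Re R)) /= /eqP.
  by rewrite gt_eqF // divr_gt0.
move: am; rewrite /m !lt_min => /andP[/andP[ad1 ad2] /andP[ad3 ar]].
have arho : normc a < rho by exact: lt_trans rrho.
pose Q := dquot f a da.
have Q0 w : normc w < rho -> Q w != 0.
  move=> wr; rewrite /Q /dquot; have [//|wa] := eqVneq w a.
  rewrite mulf_neq0 // ?invr_eq0 subr_eq0 //.
  by apply: contra_neq wa => /finj; exact.
have fa0 : normc (f a - f 0) < c0 / 2 by apply: d3P; rewrite subr0.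
have QM w : normc w = r -> normc (Q w)^-1 <= eps^-1.
  move=> wr; have wa : w != a by apply: contraTneq ar => <-; rewrite wr ltxx.
  have wa0 : 0 < normc (w - a) by rewrite normc_gt0 subr_eq0.
  rewrite normcCV lef_pV2 ?posrE ?normc_gt0 ?Q0 ?wr //.
  rewrite /Q /dquot (negbTE wa) normcCM normcCV ler_pdivlMr //.
  have h1 := c0P w wr; have h2 := normc_triangle (f a) (f w) (f 0).
  have h3 := ler_normcB w a; rewrite wr in h3.
  apply: (@le_trans _ _ (eps * (2 * r))).
    by rewrite ler_pM2l //; lra.
  have -> : eps * (2 * r) = c0 / 2 by rewrite /eps; field; rewrite gt_eqF.
  lra.
have r00 : normc (0 : C) <= r by rewrite normcC0 ltW.
have Q0E : Q 0 = q a.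
  rewrite /Q /dquot eq_sym (negbTE a0) -opprB qf ?subr0 // sub0r.
  by rewrite invrN mulrNN mulfK.
have := @max_modulus_except [:: a] (fun w => (Q w)^-1) r rho eps^-1 (ltW r0)
  rrho _ _ QM 0 r00.
rewrite Q0E.
have qa : normc (q a) < eps by have := d2P a; rewrite q0 !subr0; exact.
have qa0 : 0 < normc (q a).
  by rewrite normc_gt0 -Q0E Q0.
rewrite normcCV lef_pV2 ?posrE // leNgt qa => h.
suff : ~~ true by []; apply: h => w wr.
  exact: (@ccontV R Q w (Q0 w wr) (dquot_cont fda (fc w wr))).
rewrite inE => wa.
exact: (cderivableV (Q0 w wr) (dquot_cderivable _ wa (fd w wr))).
Qed.

End SchwarzPick.

(** * Lifting maps defined on a disc *)

Section Lifting.
Variable R : realType.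
Local Notation C := (cplx R).
Implicit Types (z w a : C).

Definition cont_on (A : set C) (f : C -> C) := forall z : C, A z ->
  forall e : R, 0 < e -> exists2 d : R, 0 < d &
  forall w : C, A w -> normc (w - z) < d -> normc (f w - f z) < e.

Definition convex (A : set C) := forall (z w : C) (s : R), A z -> A w ->
  0 <= s <= 1 -> A (z + s%:C%C * (w - z)).

Lemma cont_on_sub (A B : set C) f : A `<=` B -> cont_on B f -> cont_on A f.
Proof.
move=> AB fc z Az e e0; have [d d0 dP] := fc z (AB z Az) e e0.
by exists d => // w /AB; exact: dP.
Qed.

Lemma cont_on_open (A : set C) (f : C -> C) z : open A -> A z -> cont_on A f ->
  {for z, continuous f}.
Proof.
move=> /copenP Ao Az fc; apply/ccontP => e e0.
have [d d0 dP] := fc z Az e e0; have [d' d'0 d'P] := Ao z Az.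
exists (Num.min d d'); first by rewrite lt_min d0.
by move=> w; rewrite lt_min => /andP[wd /d'P Aw]; exact: dP.
Qed.

Lemma cont_cont_on (A : set C) (f : C -> C) :
  (forall z, A z -> {for z, continuous f}) -> cont_on A f.
Proof.
move=> fc z /fc /ccontP h e /h[d d0 dP]; by exists d => // w _; exact: dP.
Qed.

Lemma open_ball0 (r : R) : open [set w : C | normc w < r].
Proof.
apply/copenP => a ar; exists (r - normc a); first by rewrite subr_gt0.
by move=> v va /=; have := lerB_normc v a; move: va ar => /=; lra.
Qed.

Lemma convex_ball (a : C) (r : R) : convex [set w : C | normc (w - a) < r].
Proof.
move=> z w s /= zr wr /andP[s0 s1].
have -> : z + s%:C%C * (w - z) - a =
    (1 - s)%:C%C * (z - a) + s%:C%C * (w - a) by rewrite rmorphB /=; ring.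
rewrite (le_lt_trans (ler_normcD _ _)) // !normc_mulr !ger0_norm ?subr_ge0 //.
have [->|s00] := eqVneq s 0; first by rewrite subr0 mul1r mul0r addr0.
have sp : 0 < s by rewrite lt_def s00.
have : s * normc (w - a) < s * r by rewrite ltr_pM2l.
have : (1 - s) * normc (z - a) <= (1 - s) * r.
  by rewrite ler_wpM2l ?subr_ge0 // ltW.
lra.
Qed.

Lemma convex_ball0 (r : R) : convex [set w : C | normc w < r].
Proof.
move=> z w s /= zr wr s01.
by have := @convex_ball 0 r z w s; rewrite /= !subr0; apply.
Qed.

Lemma convexI (A B : set C) : convex A -> convex B -> convex (A `&` B).
Proof. by move=> cA cB z w s [? ?] [? ?] ?; split; [exact: cA|exact: cB]. Qed.

(** Connectedness of the unit interval. *)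
Lemma locally_constant (P : R -> Prop) :
  (forall s : R, 0 <= s <= 1 -> exists2 d : R, 0 < d & forall v : R, 0 <= v <= 1 ->
     `|v - s| < d -> (P v <-> P s)) -> P 0 -> P 1.
Proof.
move=> lc P0; pose S := [set s : R | 0 <= s <= 1 /\
  forall u, 0 <= u <= s -> P u].
have S0 : S 0.
  split; first by rewrite lexx ler01.
  by move=> u /andP[u0 u1]; have -> : u = 0 by apply/eqP; rewrite eq_le u0 u1.
have Sub : has_ubound S by exists 1 => s [/andP[]].
have Sup : has_sup S by split; [exists 0|].
have sg0 : 0 <= sup S by apply: ub_le_sup.
have sg1 : sup S <= 1 by apply: ge_sup; [exists 0|move=> s [/andP[]]].
have sg01 : 0 <= sup S <= 1 by rewrite sg0.
have [d d0 dP] := lc _ sg01.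
have [s [s01 sP] ds] := sup_adherent d0 Sup.
have ssg : s <= sup S by apply: ub_le_sup.
have s0 : 0 <= s by case/andP: s01.
have Psg : P (sup S).
  apply/(dP s s01); last by apply: sP; rewrite s0 lexx.
  by rewrite distrC ger0_norm ?subr_ge0 // ltrBlDr -ltrBlDl.
pose m := Num.min 1 (sup S + d / 2).
have Sm : S m.
  split; first by rewrite /m ge_min lexx le_min ler01 /= andbT addr_ge0 // ltW // divr_gt0.
  move=> u /andP[u0]; rewrite le_min => /andP[u1 u2].
  have [us|su] := leP u s; first by apply: sP; rewrite u0.
  apply/(dP u); rewrite ?u0 //.
  by rewrite ltr_norml; apply/andP; split; lra.
have := ub_le_sup Sub Sm; rewrite /m ge_min => /orP[h|]; last by lra.
by have -> : 1 = sup S by apply/eqP; rewrite eq_le h sg1.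
Qed.

Section Lift.
Variables (T : Type) (p : C -> T) (E : set C).

Definition locally_injective := forall e : C, E e -> exists2 d : R, 0 < d &
  forall v w : C, E v -> E w -> normc (v - e) < d -> normc (w - e) < d ->
  p v = p w -> v = w.

Definition is_lift (F : C -> T) (A : set C) (g : C -> C) :=
  [/\ forall w, A w -> E (g w), forall w, A w -> p (g w) = F w & cont_on A g].

(** The property of evenly covered sets which is needed for lifting; it also makes
sense for the flow, whose domain is not a disc. *)
Definition sections_over (F : C -> T) (A : set C) := forall (z e : C), A z -> E e ->
  p e = F z -> exists g, is_lift F A g /\ g z = e.

Lemma is_lift_sub (F : C -> T) (A B : set C) g : A `<=` B ->
  is_lift F B g -> is_lift F A g.
Proof.
move=> AB [h1 h2 h3]; split; [by move=> w /AB /h1|by move=> w /AB /h2|].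
exact: cont_on_sub h3.
Qed.

(** Along a segment of [A], the set where the two lifts agree is open by local
injectivity and closed by continuity. *)
Lemma lift_unique (F : C -> T) (A : set C) (g1 g2 : C -> C) (z0 : C) :
  locally_injective -> convex A -> is_lift F A g1 -> is_lift F A g2 ->
  A z0 -> g1 z0 = g2 z0 -> forall z : C, A z -> g1 z = g2 z.
Proof.
move=> pinj Acvx [g1E g1F g1c] [g2E g2F g2c] Az0 g0 z Az.
pose c (s : R) : C := z0 + s%:C%C * (z - z0).
have cA (s : R) : 0 <= s <= 1 -> A (c s) by exact: Acvx.
have cc (s v d : R) : 0 < d -> `|v - s| < d / (normc (z - z0) + 1) ->
    normc (c v - c s) < d.
  move=> d0; have n0 : 0 < normc (z - z0) + 1 by rewrite ltr_wpDl // normc_ge0.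
  rewrite ltr_pdivlMr // => h.
  have -> : c v - c s = (v - s)%:C%C * (z - z0) by rewrite /c rmorphB /=; ring.
  rewrite normc_mulr; apply: le_lt_trans h; rewrite ler_wpM2l // lerDl //.
have n0 : 0 < normc (z - z0) + 1 by rewrite ltr_wpDl // normc_ge0.
suff : g1 (c 1) = g2 (c 1) by rewrite /c mul1r addrC subrK.
apply: (locally_constant (P := fun s => g1 (c s) = g2 (c s))); last first.
  by rewrite /c mul0r addr0.
move=> s s01; have As := cA s s01.
have [eqs|neqs] := pselect (g1 (c s) = g2 (c s)).
  have [d d0 dinj] := pinj _ (g1E _ As).
  have [d1 d10 d1P] := g1c _ As d d0; have [d2 d20 d2P] := g2c _ As d d0.
  have m0 : 0 < Num.min d1 d2 by rewrite lt_min d10.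
  exists (Num.min d1 d2 / (normc (z - z0) + 1)); first exact: divr_gt0.
  move=> v v01 /(cc s v _ m0); rewrite lt_min => /andP[h1 h2]; split => // _.
  have Av := cA v v01; apply: dinj.
  - exact: g1E.
  - exact: g2E.
  - exact: d1P.
  - by rewrite eqs; exact: d2P.
  - by rewrite g1F ?g2F.
have ne0 : 0 < normc (g1 (c s) - g2 (c s)) / 2.
  by rewrite divr_gt0 // normc_gt0 subr_eq0; exact/eqP.
have [d1 d10 d1P] := g1c _ As _ ne0; have [d2 d20 d2P] := g2c _ As _ ne0.
have m0 : 0 < Num.min d1 d2 by rewrite lt_min d10.
exists (Num.min d1 d2 / (normc (z - z0) + 1)); first exact: divr_gt0.
move=> v v01 /(cc s v _ m0); rewrite lt_min => /andP[h1 h2]; split => // eqv.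
have Av := cA v v01; have := d1P _ Av h1; have := d2P _ Av h2.
rewrite eqv (normc_sub _ (g1 (c s))) => a1 a2; exfalso.
have := normc_triangle (g2 (c v)) (g1 (c s)) (g2 (c s)); lra.
Qed.

(** Extend a lift radially by a factor [1 + k]: at [w], use the section through
the known value at the contracted point [w / (1 + k)], which is closer than the
Lebesgue number [d]. Two such sections agree on the intersection of their balls,
which is convex. *)
Lemma lift_step (F : C -> T) (rho r1 r2 d k : R) (g : C -> C) :
  locally_injective -> 0 < r1 -> 0 < k -> r2 <= r1 * (1 + k) -> r2 <= rho ->
  r1 <= rho -> r2 * k <= d / 2 -> 0 < d ->
  (forall z, normc z < r1 -> sections_over F
     [set w | normc (w - z) < d /\ normc w < rho]) ->
  is_lift F [set w | normc w < r1] g ->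
  exists g', is_lift F [set w | normc w < r2] g' /\ g' 0 = g 0.
Proof.
move=> pinj r10 k0 r2r1 r2rho r1rho r2k d0 secs [gE gF gc].
pose D (z : C) : set C := [set w | normc (w - z) < d /\ normc w < rho].
have [s sP] : exists s : C -> C -> C, forall z : C, normc z < r1 ->
    is_lift F (D z) (s z) /\ s z z = g z.
  have : forall z : C, exists s : C -> C, normc z < r1 ->
      is_lift F (D z) s /\ s z = g z.
    move=> z; have [zr|zr] := ltP (normc z) r1; last by exists id.
    have [|||s [sl sz]] := secs z zr z (g z).
    - by split; rewrite ?subrr ?normcC0 // (lt_le_trans zr).
    - exact: gE.
    - exact: gF.
    by exists s.
  by move=> /choice[s sP]; exists s.
have Dcvx (z : C) : convex (D z).
  by apply: convexI; [exact: convex_ball|exact: convex_ball0].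
have k10 : 0 < 1 + k by rewrite addr_gt0.
pose q (w : C) : C := ((1 + k)^-1)%:C%C * w.
have qr w : normc w < r2 -> normc (q w) < r1.
  move=> wr; rewrite normc_mulr gtr0_norm ?invr_gt0 // mulrC ltr_pdivrMr //.
  exact: lt_le_trans r2r1.
have qd w : normc w < r2 -> normc (w - q w) < d / 2.
  move=> wr; have -> : w - q w = (k / (1 + k))%:C%C * w.
    have -> : k / (1 + k) = 1 - (1 + k)^-1 by field; rewrite gt_eqF.
    by rewrite /q rmorphB /= mulrBl mul1r.
  rewrite normc_mulr gtr0_norm ?divr_gt0 //; apply: lt_le_trans r2k.
  rewrite mulrAC ltr_pdivrMr // mulrC.
  have w0 := normc_ge0 w.
  apply: (@lt_le_trans _ _ (r2 * k)); first by rewrite ltr_pM2r.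
  by rewrite ler_peMr ?mulr_ge0 ?(ltW k0) ?lerDl ?(ltW k0) // (le_trans w0) // ltW.
have qq v w : normc (q v - q w) <= normc (v - w).
  rewrite -mulrBr normc_mulr gtr0_norm ?invr_gt0 //.
  by rewrite ler_piMl ?normc_ge0 // invf_le1 // lerDl ltW.
have inD w : normc w < r2 -> D (q w) w.
  move=> wr; split; last exact: lt_le_trans r2rho.
  by apply: (lt_trans (qd w wr)); rewrite ltr_pdivrMr // ltr_pMr // ltr1n.
exists (fun w => s (q w) w); split; last first.
  have q0 : q 0 = 0 by rewrite /q mulr0.
  by rewrite q0; have [|_ ->] := sP 0; rewrite ?normcC0.
have agree v w : normc v < r2 -> normc w < r2 -> normc (v - w) < d / 2 ->
    D (q w) v /\ s (q v) v = s (q w) v.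
  move=> vr wr vw.
  have [lv gv] := sP _ (qr v vr); have [lw gw] := sP _ (qr w wr).
  have qwv : D (q w) (q v).
    split; last exact: lt_le_trans (qr v vr) r1rho.
    by rewrite (le_lt_trans (qq v w)) // (lt_trans vw) // ltr_pdivrMr // ltr_pMr // ltr1n.
  have Dwv : D (q w) v.
    split; last exact: lt_le_trans r2rho.
    have := normc_triangle w v (q w); have := qd w wr; lra.
  split=> //.
  have sqv : s (q w) (q v) = g (q v).
    pose A := D (q w) `&` [set x | normc x < r1].
    have Ac : convex A by apply: convexI; [exact: Dcvx|exact: convex_ball0].
    apply: (lift_unique pinj Ac _ _ _ gw).
    - by apply: is_lift_sub lw => x [].
    - by apply: (@is_lift_sub F _ [set x | normc x < r1]); [move=> x []|split].
    - split; last exact: qr.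
      split; last exact: lt_le_trans (qr w wr) r1rho.
      by rewrite subrr normcC0.
    - by split => //; exact: qr.
  pose A := D (q w) `&` D (q v).
  have Ac : convex A by apply: convexI; exact: Dcvx.
  apply: (lift_unique pinj Ac _ _ _ (_ : s (q v) (q v) = s (q w) (q v))).
  - by apply: is_lift_sub lv => x [].
  - by apply: is_lift_sub lw => x [].
  - split => //; split; last exact: lt_le_trans (qr v vr) r1rho.
    by rewrite subrr normcC0.
  - by rewrite gv.
  - by split => //; exact: inD.
split.
- move=> w wr; have [[sE _ _] _] := sP _ (qr w wr); exact/sE/inD.
- move=> w wr; have [[_ sF _] _] := sP _ (qr w wr); exact/sF/inD.
- move=> w wr e e0; have [[_ _ sc] _] := sP _ (qr w wr).
  have [dl dl0 dlP] := sc w (inD w wr) e e0.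
  exists (Num.min dl (d / 2)); first by rewrite lt_min dl0 divr_gt0.
  move=> v vr; rewrite lt_min => /andP[vdl vd].
  have [Dv ->] := agree v w vr wr vd; exact: dlP.
Qed.

(** A common radius for local sections exists by compactness, so that finitely many
applications of [lift_step] reach the radius [r]. *)
Lemma lift_exists (F : C -> T) (rho r : R) (e0 : C) :
  locally_injective -> 0 < r -> r < rho ->
  (forall z : C, normc z < rho -> exists2 d : R, 0 < d & sections_over F
     [set w | normc (w - z) < d /\ normc w < rho]) ->
  E e0 -> p e0 = F 0 ->
  exists g, is_lift F [set w | normc w < r] g /\ g 0 = e0.
Proof.
move=> pinj r0 rrho secs Ee0 pe0.
pose good (A : set C) := sections_over F (A `&` [set w | normc w < rho]).
have [A B AB gB z e [Az zr] Ee pe|z zr|d d0 dP] := @lebesgue_ball R good r (ltW r0).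
- have [|g [gl gz]] := gB z e _ Ee pe; first by split => //; exact: AB.
  by exists g; split => //; apply: is_lift_sub gl => w [/AB].
- exact: (secs z (le_lt_trans zr rrho)).
pose k := d / (2 * r); have k0 : 0 < k by rewrite divr_gt0 // mulr_gt0.
pose d1 := Num.min d r; have d10 : 0 < d1 by rewrite lt_min d0.
have main n : exists g, is_lift F
    [set w | normc w < Num.min r (d1 * (1 + k) ^+ n)] g /\ g 0 = e0.
  elim: n => [|n [g [gl g0]]].
    have n0 : normc (0 : C) <= r by rewrite normcC0 ltW.
    have [|g [gl g0]] := dP 0 n0 0 e0 _ Ee0 pe0.
      have hz : normc ((0 : C) - 0) < d by rewrite subr0 normcC0.
      by split; [exact: hz|exact: le_lt_trans n0 rrho].
    exists g; split => //; apply: is_lift_sub gl => w /=.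
    rewrite expr0 mulr1 /d1 !lt_min subr0 => /andP[wr /andP[wd _]].
    by split => //; exact: lt_trans rrho.
  rewrite -g0; apply: (@lift_step F rho _ _ d k g pinj _ k0 _ _ _ _ d0 _ gl).
  - by rewrite lt_min r0 mulr_gt0 // exprn_gt0 // addr_gt0.
  - have [le|lt] := leP r (d1 * (1 + k) ^+ n).
      rewrite ge_min; apply/orP; left.
      by apply: ler_peMr; rewrite ?lerDl; exact: ltW.
    by rewrite ge_min; apply/orP; right; rewrite exprSr mulrA.
  - by rewrite ge_min ltW.
  - by rewrite ge_min ltW.
  - apply: (@le_trans _ _ (r * k)).
      by rewrite ler_pM2r // ge_min lexx.
    by rewrite /k le_eqVlt; apply/orP; left; apply/eqP; field; rewrite gt_eqF.
  - move=> z; rewrite lt_min => /andP[zr _] w e [] wd wrho Ee pe.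
    have [|g' [gl' gw]] := dP z (ltW zr) w e _ Ee pe; first by split.
    by exists g'; split.
have [n nr] : exists n : nat, r < d1 * (1 + k) ^+ n.
  exists (Num.trunc (r / d1 / k)).+1.
  have := truncnS_gt (r / d1 / k); set n := _.+1 => h.
  rewrite ltr_pdivrMr // ltr_pdivrMr // in h.
  have b := bernoulli n (ltW k0).
  have : d1 * (1 + n%:R * k) <= d1 * (1 + k) ^+ n by rewrite ler_pM2l.
  lra.
have [g [gl g0]] := main n; exists g; split => //.
by apply: is_lift_sub gl => w /= wr; rewrite lt_min wr (lt_trans wr nr).
Qed.

End Lift.

End Lifting.

(** * The complex exponential *)

Section Exponential.
Variable R : realType.
Local Notation C := (cplx R).
Implicit Types (z w a : C).

Lemma cexp0 : cexp (0 : C) = 1.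
Proof. by apply: cplx_eq; rewrite /= expR0 ?cos0 ?sin0 ?mulr1 ?mulr0. Qed.

Lemma cexpD z w : cexp (z + w) = cexp z * cexp w.
Proof.
by case: z w => [a b] [c d]; apply: cplx_eq => /=;
   rewrite expRD ?cosD ?sinD; ring.
Qed.

Lemma normc_cexp z : normc (cexp z) = expR (complex.Re z).
Proof.
case: z => a b; apply/eqP; rewrite -(eqrXn2 (n := 2)) ?normc_ge0 ?expR_ge0 //.
rewrite normc_sqr /= !exprMn -mulrDr cos2Dsin2 mulr1 //.
Qed.

Lemma cexp_neq0 z : cexp z != 0.
Proof. by rewrite -normc_gt0 normc_cexp expR_gt0. Qed.

(** Converse of [is_derive_eps]. *)
Lemma derive_eps (u : R -> R) (s l : R) : is_derive s 1 u l ->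
  forall e : R, 0 < e -> exists2 d : R, 0 < d &
    forall h, `|h| < d -> `|u (s + h) - u s - l * h| <= e * `|h|.
Proof.
move=> [/cvg_ex[l' ul] dl] e e0.
have ll : l' = l by rewrite -dl; apply/esym/cvg_lim.
rewrite ll in ul.
have /ul /nbhs_ballP[d /= d0 dP] : nbhs l [set x : R | `|l - x| < e].
  by apply/nbhs_ballP; exists e.
exists d => // h hd; have [->|h0] := eqVneq h 0.
  by rewrite addr0 subrr mulr0 subrr !normr0 mulr0.
have := dP h; rewrite /ball /= sub0r normrN => /(_ hd h0).
rewrite [h *: 1]mulr1 (addrC h) => le.
have -> : u (s + h) - u s - l * h = - (l - h^-1 * (u (s + h) - u s)) * h.
  by field.
by rewrite normrM normrN ler_wpM2r // ltW.
Qed.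

(** The first order expansions of the real exponential, cosine and sine at [0] are
all accurate up to [e / 8] times the modulus; eight such errors add up. *)
Lemma cder_cexp0 : cder (@cexp R) 0 1.
Proof.
apply: eps_cder => e e0.
pose c := Num.min 1 (e / 8); have c0 : 0 < c by rewrite lt_min ltr01 divr_gt0.
have c1 : c <= 1 by rewrite ge_min lexx.
have ce : c <= e / 8 by rewrite ge_min lexx orbT.
have [d1 d10 h1] := derive_eps (is_derive_expR 0) c0.
have [d2 d20 h2] := derive_eps (is_derive_cos 0) c0.
have [d3 d30 h3] := derive_eps (is_derive_sin 0) c0.
pose m := Num.min (Num.min d1 d2) (Num.min d3 c).
have m0 : 0 < m by rewrite 3!lt_min d10 d20 d30.
exists m => // h; rewrite 3!lt_min => /andP[/andP[n1 n2] /andP[n3 n4]].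
rewrite add0r cexp0 mul1r.
have hr := normc_Re h; have hi := normc_Im h.
set a := complex.Re h in hr *; set b := complex.Im h in hi *.
have := h1 a (le_lt_trans hr n1); rewrite add0r expR0 mul1r => k1.
have := h2 b (le_lt_trans hi n2).
rewrite add0r cos0 sin0 oppr0 mul0r subr0 => k2.
have := h3 b (le_lt_trans hi n3); rewrite add0r sin0 subr0 cos0 mul1r => k3.
set E := expR a in k1; set K := cos b in k2; set S := sin b in k3.
set H := normc h in hr hi n4 *.
have H0 : 0 <= H by exact: normc_ge0.
have l1 : `|E - 1 - a| <= c * H by rewrite (le_trans k1) // ler_wpM2l // ltW.
have l2 : `|K - 1| <= c * H by rewrite (le_trans k2) // ler_wpM2l // ltW.
have l3 : `|S - b| <= c * H by rewrite (le_trans k3) // ler_wpM2l // ltW.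
have cH : c * H <= H by rewrite ler_piMl.
have K1 : `|K| <= 1 by rewrite ler_norml cos_geN1 cos_le1.
have S2 : `|S| <= 2 * H.
  have -> : S = (S - b) + b by rewrite subrK.
  by rewrite (le_trans (ler_normD _ _)) //; lra.
have a1 : `|1 + a| <= 2.
  rewrite (le_trans (ler_normD _ _)) // normr1; lra.
have E1 : `|E - 1| <= 2 * H.
  have -> : E - 1 = (E - 1 - a) + a by rewrite subrK.
  by rewrite (le_trans (ler_normD _ _)) //; lra.
rewrite (le_trans (normc_ReIm _)) // !ReD !ImD !ReN !ImN.
have -> : complex.Re (cexp h) = E * K by [].
have -> : complex.Im (cexp h) = E * S by [].
rewrite -/a -/b /= subr0.
have r1 : `|E * K - 1 - a| <= 3 * (c * H).
  have -> : E * K - 1 - a = (E - 1 - a) * K + (1 + a) * (K - 1) by ring.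
  rewrite (le_trans (ler_normD _ _)) // !normrM.
  have : `|E - 1 - a| * `|K| <= c * H * 1 by rewrite ler_pM.
  have : `|1 + a| * `|K - 1| <= 2 * (c * H) by rewrite ler_pM.
  lra.
have r2 : `|E * S - b| <= 3 * (c * H) + 2 * (c * H).
  have -> : E * S - b = (E - 1) * S + (S - b) by ring.
  rewrite (le_trans (ler_normD _ _)) // normrM.
  have : `|E - 1| * `|S| <= 2 * H * (2 * H) by rewrite ler_pM.
  have : H * H <= c * H by rewrite ler_wpM2r // ltW.
  lra.
have : c * H <= e / 8 * H by rewrite ler_wpM2r.
lra.
Qed.

Lemma cder_cexp z : cder (@cexp R) z (cexp z).
Proof.
have h := cderB (cder_id z) (cder_cst z z); rewrite subr0 in h.
have h0 : cder (@cexp R) (z - z) 1 by rewrite subrr; exact: cder_cexp0.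
have := cderZ (cexp z) (@cder_comp R (@cexp R) (fun w => w - z) z 1 1 h0 h).
rewrite !mulr1; apply: cder_near; near=> w.
by rewrite -cexpD addrC subrK.
Unshelve. all: end_near. Qed.

Lemma cexp_eq1_near0 : exists2 d : R, 0 < d &
  forall h : C, normc h < d -> cexp h = 1 -> h = 0.
Proof.
have [q [/ccontP qc q0 /cnbhsP[d1 d10 qf]]] := cder_cexp0.
have [d2 d20 h2] := qc 1 ltr01.
exists (Num.min d1 d2); first by rewrite lt_min d10.
move=> h; rewrite lt_min => /andP[hd1 hd2] h1.
have := qf h; rewrite subr0 => /(_ hd1); rewrite h1 cexp0 subrr => /esym/eqP.
rewrite mulf_eq0 => /orP[/eqP qh|/eqP//].
by have := h2 h; rewrite subr0 qh q0 sub0r normc_opp normcC1 ltxx => /(_ hd2).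
Qed.

End Exponential.

(** * Coverings of a leaf *)

Section Coverings.
Variables (R : realType) (k : nat) (lam : 'I_k -> cplx R).
Local Notation C := (cplx R).
Local Notation rV := 'rV[C]_k.
Hypothesis lam0 : forall j, lam j != 0.
Implicit Types (x y : rV) (z w : C) (f : C -> rV).

Lemma flowE x w j : flow lam x w 0 j = x 0 j * cexp (lam j * w).
Proof. by rewrite mxE. Qed.

Lemma flow0 x : flow lam x 0 = x.
Proof. by apply/rowP => j; rewrite flowE mulr0 cexp0 mulr1. Qed.

(** Two times with the same image differ by a period of the flow. *)
Lemma flow_translate x (a b h : C) : flow lam x a = flow lam x b ->
  flow lam x (a + h) = flow lam x (b + h).
Proof.
move=> ab; apply/rowP => j; rewrite !flowE !mulrDr !cexpD !mulrA.
by rewrite -!flowE ab.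
Qed.

Lemma row_neq0 x : x != 0 -> exists j, x 0 j != 0.
Proof.
move=> x0; apply: contrapT => nj; case/negP: x0; apply/eqP/rowP => j.
by rewrite mxE; apply/eqP; apply: contrapT => xj; apply: nj; exists j; apply/negP.
Qed.

Lemma flow_locally_injective x (E : set C) : x != 0 ->
  locally_injective (flow lam x) E.
Proof.
move=> /row_neq0[j xj] e _; have [d d0 dP] := @cexp_eq1_near0 R.
have l0 : 0 < normc (lam j) by rewrite normc_gt0.
exists (d / (2 * normc (lam j))); first by rewrite divr_gt0 // mulr_gt0.
move=> v w _ _; rewrite !ltr_pdivlMr ?mulr_gt0 // => ve we.
move=> /(congr1 (fun y : rV => y 0 j)); rewrite !flowE => /(mulfI xj) vw.
have : lam j * (v - w) = 0.
  apply: dP.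
    rewrite normcCM; have := normc_triangle e v w; rewrite (normc_sub e w) => tr.
    have : normc (lam j) * normc (v - w) <=
      normc (lam j) * (normc (v - e) + normc (w - e)) by rewrite ler_pM2l.
    lra.
  by apply: (mulfI (cexp_neq0 (lam j * w))); rewrite -cexpD mulr1 -mulrDr addrC subrK.
by move/eqP; rewrite mulf_eq0 (negbTE (lam0 j)) subr_eq0 => /eqP.
Qed.

Lemma flow_domain_eq x (a b : C) : flow lam x a = flow lam x b ->
  flow_domain lam x b -> flow_domain lam x a.
Proof. by rewrite /flow_domain /preimage /= => ->. Qed.

Section OneLeaf.
Variables (x : rV) (f : C -> rV).
Hypothesis (x0 : x != 0) (fcov : universal_covering lam x f).

Lemma covering_leaf w : normc w < 1 -> exists2 v : C, flow_domain lam x v &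
  flow lam x v = f w.
Proof. by case: fcov => _ fl _ w1; have : leaf lam x (f w) by rewrite -fl; exists w. Qed.

Lemma covering_lt1 w j : normc w < 1 -> normc (f w 0 j) < 1.
Proof. by move=> /covering_leaf[v vD <-]; exact: vD. Qed.

Lemma covering_sheet w : normc w < 1 -> exists U V, [/\ leaf_open lam x U, U (f w),
  V w, open V & [/\ forall v, V v -> normc v < 1, set_inj V f, f @` V = U &
    forall W, W `<=` V -> (open W <-> leaf_open lam x (f @` W))]].
Proof.
case: fcov => _ fl fev w1; have lw : leaf lam x (f w) by rewrite -fl; exists w.
have [U [Uo Uw [sheets [So _ Scov Sev]]]] := fev _ lw.
have [V SV Vw] : (\bigcup_(V in sheets) V) w by rewrite Scov; split.
have [Vinj VU Vo] := Sev V SV.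
exists U, V; split => //; first exact: So.
split => // v Vv; have : (\bigcup_(V in sheets) V) v by exists V.
by rewrite Scov => -[].
Qed.

Lemma covering_locally_injective : locally_injective f (@disc R).
Proof.
move=> e e1; have [U [V [_ _ Ve Vo [_ Vinj _ _]]]] := covering_sheet e1.
have [d d0 dP] := (copenP V).1 Vo e Ve.
by exists d => // v w _ _ vd wd; apply: Vinj; rewrite inE; exact: dP.
Qed.

(** For the evenly covered neighbourhood [U] of a point, the section is the inverse
of the covering on a sheet. Its continuity is the openness of the images of open
subsets of the sheet in the leaf topology. *)
Lemma covering_sections (tau : C -> C) (rho : R) :
  cont_on [set w | normc w < rho] tau ->
  (forall w, normc w < rho -> flow_domain lam x (tau w)) ->
  forall z : C, normc z < rho -> exists2 d : R, 0 < d &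
  sections_over f (@disc R) (fun w => flow lam x (tau w))
     [set w | normc (w - z) < d /\ normc w < rho].
Proof.
move=> tc tD z zr; case: (fcov) => _ fl fev.
have lz : leaf lam x (flow lam x (tau z)) by exists (tau z) => //; exact: tD.
have [U [[Usub /copenP Uo] Uz [sheets [So _ Scov Sev]]]] := fev _ lz.
have [|r r0 rP] := Uo (tau z); first by split => //; exact: tD.
have [d d0 dP] := tc z zr r r0.
exists d => // z' e [z'd z'r] e1 fe.
have [V SV Ve] : (\bigcup_(V in sheets) V) e.
  by rewrite Scov; split => //=; rewrite fe; case: (rP _ (dP _ z'r z'd)).
have [Vinj VU Vo] := Sev V SV.
have Vdisc v : V v -> disc v.
  by move=> Vv; have : (\bigcup_(V in sheets) V) v by [exists V]; rewrite Scov => -[].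
pose A := [set w : C | normc (w - z) < d /\ normc w < rho].
have AU w : A w -> U (flow lam x (tau w)).
  by move=> [wd wr]; case: (rP _ (dP _ wr wd)).
have [g gP] : exists g : C -> C, forall w, A w -> V (g w) /\ f (g w) = flow lam x (tau w).
  have : forall w : C, exists v : C, A w -> V v /\ f v = flow lam x (tau w).
    move=> w; have [Aw|nAw] := pselect (A w); last by exists 0.
    by have := AU w Aw; rewrite -VU => -[v Vv fv]; exists v.
  by move=> /choice[g gP]; exists g.
exists g; split; last first.
  have [Vg fg] := gP z' (conj z'd z'r).
  by apply: Vinj; rewrite ?inE // fg.
split.
- by move=> w /gP[/Vdisc].
- by move=> w /gP[].
move=> w Aw e' e'0; have [Vg fg] := gP w Aw.
pose W := V `&` [set v : C | normc (v - g w) < e'].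
have Wo : open W.
  apply: openI; first exact: So.
  apply/copenP => v /= vg; exists (e' - normc (v - g w)); first by rewrite subr_gt0.
  by move=> u uv; have := normc_triangle v u (g w); lra.
have [|_ /copenP fWo] := (Vo W _).1 Wo; first by move=> v [].
have [|r' r'0 r'P] := fWo (tau w).
  split; first by apply: tD; case: Aw.
  by exists (g w) => //; split => //=; rewrite subrr normcC0.
have [_ wr] := Aw; have [d' d'0 d'P] := tc w wr r' r'0.
exists d' => // v Av vw; have [vd vr] := Av; have [Vgv fgv] := gP v Av.
have [_ [u [Vu ue] fu]] := r'P _ (d'P v vr vw).
by have -> : g v = u by apply: Vinj; rewrite ?inE // fgv.
Qed.

(** In the leaf topology, the image under the flow of a small ball about [v] is a
neighbourhood of [f z]. *)
Lemma covering_local_lift (z v : C) (d : R) : normc z < 1 ->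
  flow_domain lam x v -> flow lam x v = f z -> 0 < d ->
  exists2 r : R, 0 < r & forall w : C, normc (w - z) < r ->
    exists u : C, [/\ flow_domain lam x u, normc (u - v) < d & flow lam x u = f w].
Proof.
move=> z1 vD fv d0.
have [U [V [[Usub /copenP Uo] Uz Vz Vo [Vdisc Vinj VU Vopen]]]] := covering_sheet z1.
pose W := V `&` [set w | exists u : C,
  [/\ flow_domain lam x u, normc (u - v) < d & flow lam x u = f w]].
suff Wo : open W.
  have [|r r0 rP] := (copenP W).1 Wo z.
    by split => //; exists v; split => //; rewrite subrr normcC0.
  by exists r => // w /rP[].
apply/(Vopen W); first by move=> w [].
split; first by move=> _ [w [Vw _] <-]; apply: Usub; rewrite -VU; exists w.
apply/copenP => a [aD [w [Vw [u [uD ud fu]]] fw]].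
have Ua : U (flow lam x a) by rewrite -fw -VU; exists w.
have [r r0 rP] := Uo a (conj aD Ua).
exists (Num.min r (d - normc (u - v))); first by rewrite lt_min r0 subr_gt0.
move=> b; rewrite lt_min => /andP[br bd].
have [bD Ub] := rP b br; split => //.
move: Ub; rewrite /preimage /= -VU => -[w' Vw' fw'].
exists w' => //; split => //; exists (u + (b - a)).
have E : flow lam x (u + (b - a)) = flow lam x b.
  rewrite (@flow_translate x u a); last by rewrite fu.
  by rewrite addrC subrK.
split; last by rewrite E fw'.
  exact: flow_domain_eq bD.
have -> : u + (b - a) - v = (u - v) + (b - a) by ring.
have := ler_normcD (u - v) (b - a); lra.
Qed.

(** Conversely, the flow is a covering: near one time [v] over [f z] it has a local
inverse, and the other sections are its translates by periods. *)
Lemma flow_sections (z : C) : normc z < 1 -> exists2 d : R, 0 < d &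
  sections_over (flow lam x) (flow_domain lam x) f
     [set w | normc (w - z) < d /\ normc w < 1].
Proof.
move=> z1; have [v vD fv] := covering_leaf z1.
have [d d0 dinj] := flow_locally_injective x0 vD.
have [r r0 rP] := covering_local_lift z1 vD fv d0.
exists r => // z' e [z'r z'1] eD fe.
pose A := [set w : C | normc (w - z) < r /\ normc w < 1].
have [g gP] : exists g : C -> C, forall w, A w ->
    [/\ flow_domain lam x (g w), normc (g w - v) < d & flow lam x (g w) = f w].
  have : forall w : C, exists u : C, A w ->
      [/\ flow_domain lam x u, normc (u - v) < d & flow lam x u = f w].
    move=> w; have [[wr _]|nAw] := pselect (A w); last by exists 0.
    by have [u hu] := rP w wr; exists u.
  by move=> /choice[g gP]; exists g.
have [gD' gd' fg'] := gP z' (conj z'r z'1).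
have shift (a : C) : flow lam x (a + (e - g z')) = flow lam x a.
  have -> : a + (e - g z') = e + (a - g z') by ring.
  rewrite (@flow_translate x e (g z')); last by rewrite fe fg'.
  by rewrite addrC subrK.
exists (fun w => g w + (e - g z')); split; last by rewrite addrC subrK.
split.
- by move=> w /gP[gD _ _]; apply: flow_domain_eq gD; rewrite shift.
- by move=> w /gP[_ _ <-]; rewrite shift.
move=> w Aw e' e'0; have [gD gd fg] := gP w Aw; have [wr w1] := Aw.
have m0 : 0 < Num.min e' (d - normc (g w - v)) by rewrite lt_min e'0 subr_gt0.
have [r' r'0 r'P] := covering_local_lift w1 gD fg m0.
exists r' => // b Ab /r'P[u [uD]]; rewrite lt_min => /andP[ue ud] fu.
have [gbD gbd fgb] := gP b Ab.
have -> : g b + (e - g z') - (g w + (e - g z')) = g b - g w by ring.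
suff -> : g b = u by [].
apply: dinj => //; last by rewrite fgb fu.
by have := normc_triangle (g w) u v; lra.
Qed.

Lemma flow_coordinate_cder j (w : C) :
  cder (fun w => x 0 j * cexp (lam j * w)) w
       (x 0 j * (cexp (lam j * w) * lam j)).
Proof.
apply: cderZ; apply: (@cder_comp R (@cexp R) (fun w => lam j * w)).
  exact: cder_cexp.
by have := cderZ (lam j) (cder_id w); rewrite mulr1.
Qed.

Lemma covering_cderivable j w : normc w < 1 -> cderivable (fun w => f w 0 j) w.
Proof. by case: fcov => fd _ _ w1; apply: derivable_cder; exact: fd. Qed.

(** Lifting the covering [f] through the flow gives the conformal map [tau] from the
disc onto the flow domain, here on smaller discs. *)
Lemma covering_lift (rho : R) : polydisc x -> f 0 = x -> 0 < rho -> rho < 1 ->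
  exists tau : C -> C, [/\ is_lift (flow lam x) (flow_domain lam x) f
      [set w | normc w < rho] tau, tau 0 = 0 &
    forall w, normc w < rho -> cderivable tau w].
Proof.
move=> xD f0 r0 r1.
have [tau [[tD tf tc] t0]] : exists tau, is_lift (flow lam x) (flow_domain lam x) f
    [set w | normc w < rho] tau /\ tau 0 = 0.
  apply: (@lift_exists R rV (flow lam x) (flow_domain lam x) f 1 rho 0) => //.
  - exact: flow_locally_injective.
  - exact: flow_sections.
  - by rewrite /flow_domain /preimage /= flow0.
  - by rewrite flow0 f0.
exists tau; split => // w wr; have [j xj] := row_neq0 x0.
have [e fe] := covering_cderivable j (lt_trans wr r1).
have bo := @open_ball0 R rho.
eexists; apply: (cder_lift (cont_on_open bo wr tc) (flow_coordinate_cder j _) _ fe).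
  by rewrite !mulf_neq0 // cexp_neq0.
apply/cnbhsP; have [d d0 dP] := (copenP _).1 bo w wr.
by exists d => // v /dP vr; rewrite -flowE tf.
Qed.

(** The lift [tau] of [covering_lift] is injective near [w] because [f] is, so it has
no critical point there; the coordinates of the flow have none either. *)
Lemma covering_cder_neq0 j w : polydisc x -> f 0 = x -> x 0 j != 0 -> normc w < 1 ->
  exists2 d : C, d != 0 & cder (fun w => f w 0 j) w d.
Proof.
move=> xD f0 xj w1; pose rho := (normc w + 1) / 2.
have wr : normc w < rho by rewrite /rho; lra.
have r1 : rho < 1 by rewrite /rho; lra.
have [tau [[tD tf tc] t0 td]] := covering_lift xD f0 (le_lt_trans (normc_ge0 w) wr) r1.
have [r r0 rinj] := covering_locally_injective w1.
pose m := Num.min r (rho - normc w).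
have m0 : 0 < m by rewrite lt_min r0 subr_gt0.
have inr v : normc v < m -> normc (w + v) < rho.
  rewrite lt_min => /andP[_ vr]; have := ler_normcD w v; lra.
have [t' tw'] := td w wr.
have shift v : cder (fun v => w + v) v 1.
  by have := cderD (cder_cst w v) (cder_id v); rewrite add0r.
have t'0 : t' != 0.
  apply: (@injective_cder_neq0 R (fun v => tau (w + v)) m t' m0).
  - move=> v vm; apply: cderivable_comp; first exact: td (inr v vm).
    by exists 1.
  - move=> a b am bm tab; have := rinj (w + a) (w + b).
    have ar : normc (w + a) < 1 := lt_trans (inr a am) r1.
    have br : normc (w + b) < 1 := lt_trans (inr b bm) r1.
    move=> /(_ ar br); rewrite !(addrC w) !addrK => /(_ _ _ _)/addIr; apply.
    + by move: am; rewrite lt_min => /andP[].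
    + by move: bm; rewrite lt_min => /andP[].
    + by rewrite !(addrC _ w) -!tf ?tab //; exact: inr.
  - have tw0 : cder tau (w + 0) t' by rewrite addr0.
    by have := @cder_comp R tau (fun v => w + v) 0 _ _ tw0 (shift 0); rewrite mulr1.
exists (x 0 j * (cexp (lam j * tau w) * lam j) * t').
  by rewrite !mulf_neq0 // cexp_neq0.
have := @cder_comp R _ tau w _ _ (flow_coordinate_cder j (tau w)) tw'.
apply: cder_near; apply/cnbhsP; exists (rho - normc w); first by rewrite subr_gt0.
move=> v vw; rewrite -flowE tf //=; have := lerB_normc v w; lra.
Qed.

(** This replaces the inverse of the conformal map onto the flow domain: the lift
[g] is that inverse composed with [tau]. *)
Lemma flow_lift_covering (tau : C -> C) (rho r : R) : polydisc x -> f 0 = x ->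
  0 < r -> r < rho -> tau 0 = 0 ->
  (forall w, normc w < rho -> cderivable tau w) ->
  (forall w, normc w < rho -> flow_domain lam x (tau w)) ->
  exists g : C -> C, [/\ is_lift f (@disc R) (fun w => flow lam x (tau w))
      [set w | normc w < r] g, g 0 = 0 &
    forall w, normc w < r -> cderivable g w].
Proof.
move=> xD f0 r0 rrho t0 td tD.
have tc : cont_on [set w : C | normc w < rho] tau.
  by apply: cont_cont_on => w /td /cderivable_cont.
have [g [[gE gf gc] g0]] : exists g, is_lift f (@disc R)
   (fun w => flow lam x (tau w)) [set w | normc w < r] g /\ g 0 = 0.
  apply: (@lift_exists R rV f (@disc R) _ rho r 0) => //.
  - exact: covering_locally_injective.
  - exact: covering_sections.
  - have n0 : normc (0 : C) < 1 by rewrite normcC0.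
    exact: n0.
  - by rewrite t0 flow0.
exists g; split => // w wr; have [j xj] := row_neq0 x0.
have [d d0 fd] := covering_cder_neq0 xD f0 xj (gE w wr).
have [t' tw'] := td w (lt_trans wr rrho).
have bo := @open_ball0 R r.
have he := @cder_comp R _ tau w _ _ (flow_coordinate_cder j (tau w)) tw'.
eexists; apply: (cder_lift (cont_on_open bo wr gc) fd d0 he).
apply/cnbhsP; have [e e0 eP] := (copenP _).1 bo w wr.
by exists e => // v /eP vr; rewrite -flowE -gf.
Qed.

End OneLeaf.
End Coverings.

(** * Almost isometric self maps of the disc *)

Section Rotation.
Variable R : realType.
Local Notation C := (cplx R).
Implicit Types (z w a : C).

Lemma one_sub_pow (t : R) n : 0 <= t <= 1 -> 1 - t ^+ n <= n%:R * (1 - t).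
Proof.
move=> /andP[t0 t1]; elim: n => [|n ih]; first by rewrite expr0 subrr mul0r.
rewrite exprS -natr1 mulrDl mul1r.
have -> : 1 - t * t ^+ n = (1 - t) + t * (1 - t ^+ n) by ring.
have : t * (1 - t ^+ n) <= 1 - t ^+ n.
  by rewrite ler_piMl // subr_ge0 exprn_ile1.
lra.
Qed.

Lemma schwarz_ball (g : C -> C) (rho : R) : 0 < rho ->
  (forall w : C, normc w < rho -> cderivable g w) ->
  (forall w : C, normc w < rho -> normc (g w) < 1) -> g 0 = 0 ->
  forall w : C, normc w < rho -> normc (g w) <= normc w / rho.
Proof.
move=> r0 gd g1 g0 w wr; pose G (z : C) : C := g (rho%:C%C * z).
have inr z : normc z < 1 -> normc (rho%:C%C * z : C) < rho.
  by move=> z1; rewrite normc_mulr gtr0_norm // gtr_pMr.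
have Gd z : normc z < 1 -> cderivable G z.
  move=> /inr /gd gz; apply: (@cderivable_comp R g (fun z => rho%:C%C * z)) => //.
  exact: (cderivableM (cderivable_cst _ z) (cderivable_id z)).
have Gc z : normc z < 1 -> {for z, continuous G} by move=> /Gd /cderivable_cont.
have Gd' z : normc z < 1 -> z \notin ([::] : seq C) -> cderivable G z by move=> /Gd.
have G1 z : normc z < 1 -> normc (G z) < 1 by move=> /inr /g1.
have n01 : normc (0 : C) < 1 by rewrite normcC0.
pose z : C := (rho^-1)%:C%C * w.
have zE : rho%:C%C * z = w.
  by rewrite /z mulrA -rmorphM /= mulfV ?gt_eqF // mul1r.
have nz : normc z = normc w / rho.
  by rewrite normc_mulr gtr0_norm ?invr_gt0 // mulrC.
have z1 : normc z < 1 by rewrite nz ltr_pdivrMr // mul1r.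
have := schwarz_pick Gc Gd' G1 n01 isT z1.
have -> : G 0 = 0 by rewrite /G mulr0.
have -> : ((0 : C)^*)%C = (0 : C) by apply: cplx_eq; rewrite //= oppr0.
by rewrite !mul0r !subr0 normcC1 mulr1 mul1r /G zE nz.
Qed.

(** In [schwarz_pick], both Moebius denominators are estimated by the triangle
inequality. *)
Lemma schwarz_pick_dist (f : C -> C) (a z : C) (r : R) : r < 1 ->
  (forall w : C, normc w < 1 -> cderivable f w) ->
  (forall w : C, normc w < 1 -> normc (f w) < 1) ->
  normc a <= r -> normc z < 1 ->
  normc (f z - f a) <= 2 * normc (z - a) / (1 - r).
Proof.
move=> r1 fd f1 ar z1; have a1 : normc a < 1 := le_lt_trans ar r1.
have fc w : normc w < 1 -> {for w, continuous f} by move=> /fd /cderivable_cont.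
have fd' w : normc w < 1 -> w \notin ([::] : seq C) -> cderivable f w by move=> /fd.
have sp := schwarz_pick fc fd' f1 a1 isT z1.
rewrite ler_pdivlMr ?subr_gt0 //.
have l1 : 1 - r <= normc (1 - (a^*)%C * z).
  apply: le_trans (lerB_normc _ _); rewrite normcC1 lerD2l lerN2 normcCM normc_conj.
  have a0 := normc_ge0 a; have z0 := normc_ge0 z.
  by rewrite (le_trans _ ar) // ler_piMr // ltW.
have l2 : normc (1 - ((f a)^*)%C * f z) <= 2.
  rewrite (le_trans (ler_normcB _ _)) // normcC1 normcCM normc_conj.
  have h1 := f1 a a1; have h2 := f1 z z1.
  have a0 := normc_ge0 (f a); have z0 := normc_ge0 (f z).
  have : normc (f a) * normc (f z) <= 1 by rewrite mulr_ile1 // ltW.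
  lra.
apply: (@le_trans _ _ (normc (f z - f a) * normc (1 - (a^*)%C * z))).
  by rewrite ler_wpM2l // normc_ge0.
by rewrite (le_trans sp) // ler_wpM2r // normc_ge0.
Qed.

(** The quotient [q = G z / z] maps into the disc and has modulus close to [1] near
[0], so by Schwarz-Pick it hardly varies; the rotation is its normalized value at
a base point [a]. The exponents are those provided by [compare_contraction]. *)
Lemma near_rotation (G : C -> C) (t r : R) : 3 / 4 <= t -> t < 1 ->
  0 <= r -> r < 1 -> (forall z : C, normc z < 1 -> cderivable G z) ->
  (forall z : C, normc z < 1 -> normc (G z) <= t * normc z) ->
  (forall z : C, normc z < t ^+ 2 -> t ^+ 7 * normc z <= normc (G z)) ->
  exists u : C, normc u = 1 /\ forall z : C, normc z <= r ->
    normc (G z - u * z) <= 35 * (1 - t) / (1 - r).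
Proof.
move=> t34 t1 r0 r1 Gd Gle Gge.
have t0 : 0 < t by lra.
have n01 : normc (0 : C) < 1 by rewrite normcC0.
have G0 : G 0 = 0.
  apply/eq0_normc/eqP; rewrite eq_le normc_ge0 andbT.
  by have := Gle 0 n01; rewrite normcC0 mulr0.
have [d Gd0] := Gd 0 n01; pose q := dquot G 0 d.
have qE z : z != 0 -> q z = G z / z.
  by move=> z0; rewrite /q /dquot (negbTE z0) G0 !subr0.
have qc z : normc z < 1 -> {for z, continuous q}.
  by move=> z1; apply: (dquot_cont Gd0); exact: cderivable_cont (Gd z z1).
have qd z : normc z < 1 -> z \notin [:: (0 : C)] -> cderivable q z.
  by rewrite inE => z1 z0; exact: (dquot_cderivable _ z0 (Gd z z1)).
have qt z : normc z < 1 -> z != 0 -> normc (q z) <= t.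
  move=> z1 z0; rewrite qE // normcCM normcCV ler_pdivrMr ?normc_gt0 //.
  exact: Gle.
have q1 z : normc z < 1 -> normc (q z) < 1.
  move=> z1; have [->|z0] := eqVneq z 0; last exact: le_lt_trans (qt z z1 z0) t1.
  rewrite ltNge; apply/negP => q1.
  have [e e0 eP] := (ccontP q 0).1 (qc 0 n01) (1 - t) (ltac:(lra)).
  have m0 : 0 < Num.min e 1 by rewrite lt_min e0 ltr01.
  have [w []] := avoid_seq [:: (0 : C)] 0 m0.
  rewrite subr0 lt_min inE => /andP[we w1] w0.
  have := eP w; rewrite subr0 => /(_ we); have := qt w w1 w0.
  have := lerB_normc (q 0) (q w); rewrite (normc_sub (q 0)); lra.
(* The base point avoids [0], where [q] is only continuous, and is small enough
   for the pseudo-hyperbolic distance to [z] to stay away from [1]. *)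
pose a : C := ((1 - r) / 4)%:C%C.
have na : normc a = (1 - r) / 4 by rewrite normc_real gtr0_norm //; lra.
have a1 : normc a < 1 by rewrite na; lra.
have a0 : a != 0 by rewrite -normc_gt0 na; lra.
have as_ : a \notin [:: (0 : C)] by rewrite inE.
have at2 : normc a < t ^+ 2 by rewrite na; nra.
have qa : t ^+ 7 <= normc (q a).
  by rewrite qE // normcCM normcCV ler_pdivlMr ?normc_gt0 // Gge.
have t7 : 0 < t ^+ 7 by rewrite exprn_gt0.
have qa0 : 0 < normc (q a) by exact: lt_le_trans qa.
have t01 : 0 <= t <= 1 by rewrite !ltW.
pose u : C := ((normc (q a))^-1)%:C%C * q a.
exists u; split.
  by rewrite normc_mulr gtr0_norm ?invr_gt0 // mulVf // gt_eqF.
have qau : normc (q a - u) <= 7 * (1 - t).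
  have -> : q a - u = (1 - (normc (q a))^-1)%:C%C * q a.
    by rewrite /u rmorphB /=; ring.
  rewrite normc_mulr -{2}(gtr0_norm qa0) -normrM mulrBl mul1r mulVf ?gt_eqF //.
  rewrite distrC ger0_norm ?subr_ge0; last exact: ltW (q1 a a1).
  by have := one_sub_pow 7 t01; lra.
move=> z zr; have z1 : normc z < 1 := le_lt_trans zr r1.
have sp := schwarz_pick qc qd q1 a1 as_ z1.
set D := normc (q z - q a) in sp.
have D0 : 0 <= D by exact: normc_ge0.
have l1 : 1 - normc a <= normc (1 - (a^*)%C * z).
  apply: le_trans (lerB_normc _ _); rewrite normcC1 lerD2l lerN2 normcCM normc_conj.
  by rewrite ler_piMr ?normc_ge0 // ltW.
have l2 : normc (1 - ((q a)^*)%C * q z) <= 14 * (1 - t) + D.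
  have -> : 1 - ((q a)^*)%C * q z = (1 - normc (q a) ^+ 2)%:C%C -
      ((q a)^*)%C * (q z - q a).
    rewrite mulrBr normc_sqr; case: (q a) (q z) => x y [x' y'].
    by apply: cplx_eq => /=; ring.
  rewrite (le_trans (ler_normcB _ _)) // normc_real ger0_norm; last first.
    by rewrite subr_ge0 expr_le1 ?normc_ge0 // ltW // q1.
  rewrite lerD //.
    have : t ^+ 7 * t ^+ 7 <= normc (q a) ^+ 2.
      by rewrite expr2 ler_pM // ltW.
    rewrite -exprD => h; have := one_sub_pow 14 t01; lra.
  rewrite normcCM normc_conj -/D ler_piMl //; exact: ltW (q1 a a1).
have l3 : normc (z - a) <= r + normc a.
  by rewrite (le_trans (ler_normcB _ _)) // lerD2r.
have l4 : D * (1 - normc a) <= (14 * (1 - t) + D) * (r + normc a).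
  apply: (@le_trans _ _ (D * normc (1 - (a^*)%C * z))).
    by rewrite ler_wpM2l.
  by rewrite (le_trans sp) // ler_pM ?normc_ge0.
have l5 : D <= 28 * (1 - t) / (1 - r).
  rewrite ler_pdivlMr ?subr_gt0 //; rewrite na in l4.
  have : (1 - t) * (r + (1 - r) / 4) <= (1 - t) * 1 by rewrite ler_wpM2l; lra.
  lra.
have [->|z0] := eqVneq z 0.
  rewrite G0 mulr0 subrr normcC0 divr_ge0 //; lra.
have -> : G z - u * z = (q z - u) * z by rewrite qE // mulrBl divfK.
rewrite normcCM; apply: (@le_trans _ _ (normc (q z - u))).
  by rewrite ler_piMr ?normc_ge0 // ltW.
rewrite (le_trans (normc_triangle (q a) _ _)) //.
have l6 : 7 * (1 - t) <= 7 * (1 - t) / (1 - r).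
  rewrite ler_pdivlMr ?subr_gt0 // ler_piMr //; lra.
have -> : 35 * (1 - t) / (1 - r) = 28 * (1 - t) / (1 - r) + 7 * (1 - t) / (1 - r).
  by field; lra.
by rewrite lerD // (le_trans qau).
Qed.

Lemma unit_arg (u : C) : normc u = 1 -> exists theta : R, cexp (Complex 0 theta) = u.
Proof.
move=> u1; have := normc_sqr u; rewrite u1 expr1n => sq.
case: u sq {u1} => x y /= sq.
have x1 : -1 <= x <= 1.
  rewrite -ler_norml -(ler_pXn2r (n := 2)) ?nnegrE // expr1n real_normK ?num_real //.
  by rewrite sq lerDl sqr_ge0.
have c := acosK x1; have s2 := cos2Dsin2 (acos x); rewrite c in s2.
have [ys|ys] : y = sin (acos x) \/ y = - sin (acos x).
  have : y ^+ 2 == sin (acos x) ^+ 2 by apply/eqP; lra.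
  by rewrite eqf_sqr => /orP[/eqP|/eqP]; auto.
- by exists (acos x); apply: cplx_eq => /=; rewrite expR0 mul1r.
- by exists (- acos x); apply: cplx_eq => /=; rewrite expR0 mul1r ?cosN ?sinN.
Qed.

End Rotation.

(** * Comparing the coverings of two leaves *)

Section Compare.
Variables (R : realType) (k : nat) (lam : 'I_k -> cplx R).
Local Notation C := (cplx R).
Local Notation rV := 'rV[C]_k.
Hypothesis lam0 : forall j, lam j != 0.

(** The two conformal maps [tau1] and [tau2] nearly have the same image. Lifting
[tau1] through the covering of the second leaf and [tau2] through that of the
first gives [g] and [h], with [tau2 \o g = tau1] and [tau1 \o h = tau2]. Both are
Schwarz contractions up to the factor [t ^- 3], and [h \o g = id] near [0], whence
the lower bound for [g]. Every composition or Schwarz estimate costs a power of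
[t]. *)
Lemma compare_contraction (x y : rV) (f1 f2 : C -> rV) (tau1 tau2 : C -> C)
    (t : R) :
  x != 0 -> y != 0 -> polydisc x -> polydisc y ->
  universal_covering lam x f1 -> universal_covering lam y f2 ->
  f1 0 = x -> f2 0 = y -> 0 < t -> t < 1 ->
  is_lift (flow lam x) (flow_domain lam x) f1 [set w | normc w < t] tau1 ->
  is_lift (flow lam y) (flow_domain lam y) f2 [set w | normc w < t] tau2 ->
  tau1 0 = 0 -> tau2 0 = 0 ->
  (forall w : C, normc w < t -> cderivable tau1 w) ->
  (forall w : C, normc w < t -> cderivable tau2 w) ->
  (forall w : C, normc w < t ^+ 2 -> flow_domain lam y (tau1 w)) ->
  (forall w : C, normc w < t ^+ 2 -> flow_domain lam x (tau2 w)) ->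
  exists g : C -> C, [/\ forall w : C, normc w < t ^+ 3 -> cderivable g w,
    forall w : C, normc w < t ^+ 3 -> normc (g w) <= normc w / t ^+ 3,
    forall w : C, normc w < t ^+ 3 -> f2 (g w) = flow lam y (tau1 w) &
    forall w : C, normc w < t ^+ 6 -> t ^+ 3 * normc w <= normc (g w)].
Proof.
move=> x0 y0 xD yD cov1 cov2 f10 f20 t0 t1 [t1D t1F t1c] [t2D t2F t2c] t10 t20
  d1 d2 i1 i2.
have powlt m n : (m < n)%N -> t ^+ n < t ^+ m by move=> mn; rewrite ltr_iXn2l.
have powgt n : 0 < t ^+ n by exact: exprn_gt0.
have tt : t ^+ 2 < t by rewrite -{2}(expr1 t); exact: powlt.
have d1' (w : C) : normc w < t ^+ 2 -> cderivable tau1 w.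
  by move=> wr; apply: d1; exact: lt_trans tt.
have d2' (w : C) : normc w < t ^+ 2 -> cderivable tau2 w.
  by move=> wr; apply: d2; exact: lt_trans tt.
have [g [[gE gF gc] g0 gd]] := flow_lift_covering lam0 y0 cov2 yD f20 (powgt 3%N)
  (powlt 2%N 3%N isT) t10 d1' i1.
have [h [[hE hF hc] h0 hd]] := flow_lift_covering lam0 x0 cov1 xD f10 (powgt 3%N)
  (powlt 2%N 3%N isT) t20 d2' i2.
have gs (w : C) : normc w < t ^+ 3 -> normc (g w) <= normc w / t ^+ 3.
  exact: (schwarz_ball (powgt 3%N) gd gE g0).
have hs (w : C) : normc w < t ^+ 3 -> normc (h w) <= normc w / t ^+ 3.
  exact: (schwarz_ball (powgt 3%N) hd hE h0).
exists g; split => //.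
have g4 (w : C) : normc w < t ^+ 4 -> normc (g w) < t.
  move=> wr; have w3 := lt_trans wr (powlt 3%N 4%N isT).
  by rewrite (le_lt_trans (gs w w3)) // ltr_pdivrMr // -exprS.
have g6 (w : C) : normc w < t ^+ 6 -> normc (g w) < t ^+ 3.
  move=> wr; have w3 := lt_trans wr (powlt 3%N 6%N isT).
  by rewrite (le_lt_trans (gs w w3)) // ltr_pdivrMr // -exprD.
have contg (w : C) : normc w < t ^+ 3 -> {for w, continuous g}.
  by move=> /gd /cderivable_cont.
have n0 n : normc (0 : C) < t ^+ n by rewrite normcC0.
have tg (w : C) : normc w < t ^+ 4 -> tau2 (g w) = tau1 w.
  move=> w4.
  apply: (@lift_unique R rV (flow lam y) (flow_domain lam y)
    (fun w => flow lam y (tau1 w)) [set w : C | normc w < t ^+ 4]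
    (fun w => tau2 (g w)) tau1 0 _ _ _ _ (n0 4%N)) => //.
  - exact: flow_locally_injective.
  - exact: convex_ball0.
  - split => [v v4|v v4|].
    + exact/t2D/g4.
    + by rewrite (t2F _ (g4 v v4)) gF //; exact: lt_trans v4 (powlt 3%N 4%N isT).
    + apply: cont_cont_on => v v4.
      apply: ccont_comp; first exact: cderivable_cont (d2 _ (g4 v v4)).
      by apply: contg; exact: lt_trans v4 (powlt 3%N 4%N isT).
  - split => [v v4|v v4|] //.
      by apply: i1; exact: lt_trans v4 (powlt 2%N 4%N isT).
    apply: cont_cont_on => v v4; apply/cderivable_cont/d1'.
    exact: lt_trans v4 (powlt 2%N 4%N isT).
  - by rewrite g0 t20 t10.
have hg (w : C) : normc w < t ^+ 6 -> h (g w) = w.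
  move=> w6.
  apply: (@lift_unique R rV f1 (@disc R) f1 [set w : C | normc w < t ^+ 6]
    (fun w => h (g w)) id 0 _ _ _ _ (n0 6%N)) => //.
  - exact: covering_locally_injective cov1.
  - exact: convex_ball0.
  - split => [v v6|v v6|].
    + exact/hE/g6.
    + rewrite (hF _ (g6 v v6)) tg; last exact: lt_trans v6 (powlt 4%N 6%N isT).
      apply: t1F; apply: (lt_trans v6); rewrite -{2}(expr1 t); exact: powlt.
    + apply: cont_cont_on => v v6.
      apply: ccont_comp; first exact: cderivable_cont (hd _ (g6 v v6)).
      by apply: contg; exact: lt_trans v6 (powlt 3%N 6%N isT).
  - split => [v v6|v v6|] //; last by apply: cont_cont_on => v _; exact: ccont_id.
    by apply: (lt_trans v6); rewrite -[ltRHS](expr0 t); exact: powlt.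
  - by rewrite g0 h0.
move=> w w6; have := hs (g w) (g6 w w6); rewrite hg // ler_pdivlMr //.
by rewrite mulrC.
Qed.

(** Three steps lead from [f1 z] to [f2 (u * z)]: replace [z] by [t ^+ 4 * z] in
[f1]; move along the same time from the first leaf to the second one, which lands
on [f2 (G z)]; replace [G z] by the rotation [u * z]. The first and the last one are
controlled by Schwarz-Pick for coordinates of modulus less than [1]. *)
Lemma compare_leaves (x y : rV) (f1 f2 : C -> rV) (tau1 tau2 : C -> C)
    (t r : R) :
  x != 0 -> y != 0 -> polydisc x -> polydisc y ->
  universal_covering lam x f1 -> universal_covering lam y f2 ->
  f1 0 = x -> f2 0 = y -> 3 / 4 <= t -> t < 1 -> 0 <= r -> r < 1 ->
  is_lift (flow lam x) (flow_domain lam x) f1 [set w | normc w < t] tau1 ->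
  is_lift (flow lam y) (flow_domain lam y) f2 [set w | normc w < t] tau2 ->
  tau1 0 = 0 -> tau2 0 = 0 ->
  (forall w : C, normc w < t -> cderivable tau1 w) ->
  (forall w : C, normc w < t -> cderivable tau2 w) ->
  (forall w : C, normc w < t ^+ 2 -> flow_domain lam y (tau1 w)) ->
  (forall w : C, normc w < t ^+ 2 -> flow_domain lam x (tau2 w)) ->
  exists theta : R, forall z : C, normc z <= r ->
    exists2 w : C, normc w < t ^+ 2 & forall j,
    normc (f1 z 0 j - f2 (cexp (Complex 0 theta) * z) 0 j) <=
      78 * (1 - t) / (1 - r) ^+ 2 +
      normc (flow lam x (tau1 w) 0 j - flow lam y (tau1 w) 0 j).
Proof.
move=> x0 y0 xD yD cov1 cov2 f10 f20 t34 t1 r0 r1 l1 l2 t10 t20 d1 d2 i1 i2.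
have t0 : 0 < t by lra.
have [g [gd gs gF gb]] := compare_contraction x0 y0 xD yD cov1 cov2 f10 f20 t0 t1
  l1 l2 t10 t20 d1 d2 i1 i2.
clear x0 y0; have r10 : 1 - r != 0 by rewrite gt_eqF // subr_gt0.
have powlt m n : (m < n)%N -> t ^+ n < t ^+ m by move=> mn; rewrite ltr_iXn2l.
have powgt n : 0 < t ^+ n by exact: exprn_gt0.
have nt4 (z : C) : normc ((t ^+ 4)%:C%C * z) = t ^+ 4 * normc z.
  by rewrite normc_mulr gtr0_norm.
have in4 (z : C) : normc z < 1 -> normc ((t ^+ 4)%:C%C * z) < t ^+ 4.
  by move=> z1; rewrite nt4 gtr_pMr.
pose G (z : C) : C := g ((t ^+ 4)%:C%C * z).
have [|z z1|z z1|u [u1 uP]] := @near_rotation R G t r t34 t1 r0 r1.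
- move=> z z1; apply: (@cderivable_comp R g (fun z => (t ^+ 4)%:C%C * z)).
    by apply: gd; exact: lt_trans (in4 z z1) (powlt 3%N 4%N isT).
  exact: (cderivableM (cderivable_cst _ z) (cderivable_id z)).
- have := gs _ (lt_trans (in4 z z1) (powlt 3%N 4%N isT)); rewrite nt4.
  by have -> : t ^+ 4 * normc z / t ^+ 3 = t * normc z by field; rewrite gt_eqF.
- have := gb ((t ^+ 4)%:C%C * z); rewrite nt4 mulrA -exprD; apply.
  by rewrite -[ltRHS]/(t ^+ (4 + 2)) exprD ltr_pM2l.
have [theta thE] := unit_arg u1; exists theta => z zr.
have z1 : normc z < 1 := le_lt_trans zr r1.
pose w : C := (t ^+ 4)%:C%C * z.
have w4 : normc w < t ^+ 4 by exact: in4.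
exists w; first exact: lt_trans w4 (powlt 2%N 4%N isT).
move=> j; rewrite thE.
have t01 : 0 <= t <= 1 by rewrite !ltW.
have f1d (v : C) : normc v < 1 -> cderivable (fun v => f1 v 0 j) v.
  exact: (covering_cderivable cov1).
have f2d (v : C) : normc v < 1 -> cderivable (fun v => f2 v 0 j) v.
  exact: (covering_cderivable cov2).
have f11 (v : C) : normc v < 1 -> normc (f1 v 0 j) < 1.
  by move=> v1; exact: (covering_lt1 cov1 j v1).
have f21 (v : C) : normc v < 1 -> normc (f2 v 0 j) < 1.
  by move=> v1; exact: (covering_lt1 cov2 j v1).
have w1 : normc w < 1.
  by apply: (lt_trans w4); rewrite -[ltRHS](expr0 t); exact: powlt.
have e1 : normc (f1 w 0 j - f1 z 0 j) <= 8 * (1 - t) / (1 - r) ^+ 2.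
  rewrite (le_trans (schwarz_pick_dist r1 f1d f11 zr w1)) //.
  have -> : w - z = - ((1 - t ^+ 4)%:C%C * z) by rewrite /w rmorphB /=; ring.
  have h0 : 0 <= 1 - t ^+ 4 by rewrite subr_ge0; apply: exprn_ile1; exact: ltW.
  rewrite normc_opp normc_mulr (ger0_norm h0).
  have -> : 8 * (1 - t) / (1 - r) ^+ 2 = 8 * (1 - t) / (1 - r) / (1 - r).
    by field.
  rewrite ler_pM2r ?invr_gt0 ?subr_gt0 // ler_pdivlMr ?subr_gt0 //.
  have h := one_sub_pow 4 t01; have z0 := normc_ge0 z.
  have h2 : (1 - t ^+ 4) * normc z <= 1 - t ^+ 4 by apply: ler_piMr => //; exact: ltW.
  have h3 : 0 <= (1 - t ^+ 4) * normc z by rewrite mulr_ge0.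
  have : 2 * ((1 - t ^+ 4) * normc z) * (1 - r) <= 2 * ((1 - t ^+ 4) * normc z).
    by rewrite ler_piMr //; [rewrite mulr_ge0|lra].
  lra.
have uz : normc (u * z) <= r by rewrite normcCM u1 mul1r.
have Gz1 : normc (G z) < 1.
  have w3 := lt_trans w4 (powlt 3%N 4%N isT).
  rewrite (le_lt_trans (gs w w3)) // ltr_pdivrMr // mul1r //.
have e2 : normc (f2 (G z) 0 j - f2 (u * z) 0 j) <= 70 * (1 - t) / (1 - r) ^+ 2.
  rewrite (le_trans (schwarz_pick_dist r1 f2d f21 uz Gz1)) //.
  have := uP z zr; set D := normc _ => DP.
  have -> : 70 * (1 - t) / (1 - r) ^+ 2 = 2 * (35 * (1 - t) / (1 - r)) / (1 - r).
    by field.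
  by rewrite ler_pM2r ?invr_gt0 ?subr_gt0 // ler_pM2l.
have f1w : f1 w = flow lam x (tau1 w).
  case: l1 => _ l1F _; rewrite l1F //=; apply: (lt_trans w4).
  by rewrite -{2}(expr1 t); exact: powlt.
have f2G : f2 (G z) = flow lam y (tau1 w).
  by apply: gF; exact: lt_trans w4 (powlt 3%N 4%N isT).
rewrite -f1w -f2G.
have := normc_triangle (f1 w 0 j) (f1 z 0 j) (f2 (u * z) 0 j).
have := normc_triangle (f2 (G z) 0 j) (f1 w 0 j) (f2 (u * z) 0 j).
rewrite (normc_sub (f1 z 0 j) (f1 w 0 j)).
have -> : 78 * (1 - t) / (1 - r) ^+ 2 =
  8 * (1 - t) / (1 - r) ^+ 2 + 70 * (1 - t) / (1 - r) ^+ 2 by field.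
lra.
Qed.

End Compare.

(** * Leaves through nearby points *)

Section Closeness.
Variables (R : realType) (k : nat) (lam : 'I_k -> cplx R).
Local Notation C := (cplx R).
Local Notation rV := 'rV[C]_k.
Hypothesis lam0 : forall j, lam j != 0.

Lemma expR_near1 (d w : R) : `|d| <= w -> w <= 1 / 2 -> `|expR d - 1| <= 2 * w.
Proof.
rewrite ler_norml => /andP[d1 d2] w1.
have h1 := expR_ge1Dx d; have h2 := expR_ge1Dx (- d).
have e0 := expR_gt0 d.
have : expR d * (1 - d) <= 1.
  have E : expR d * expR (- d) = 1 by rewrite -expRD subrr expR0.
  by rewrite -[leRHS]E ler_pM2l.
rewrite ler_norml => h3; apply/andP; split; first by lra.
have h4 : expR d * (1 - w) <= 1.
  by apply: le_trans h3; rewrite ler_pM2l //; lra.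
nra.
Qed.

(** The function [s - lam j * tau] has positive real part, since the coordinate
[x 0 j * cexp (lam j * tau)] has modulus less than [1], and value [s] at [0]. *)
Lemma lift_bounds (x : rV) (f : C -> rV) (tau : C -> C) (t q : R) j (w : C) :
  0 < t -> is_lift (flow lam x) (flow_domain lam x) f [set w | normc w < t] tau ->
  tau 0 = 0 -> (forall w, normc w < t -> cderivable tau w) ->
  x 0 j != 0 -> normc (x 0 j) < 1 -> 0 <= q < 1 -> normc w <= q * t ->
  let s := - ln (normc (x 0 j)) in
  s * (1 - q) / 2 <= s - complex.Re (lam j * tau w) /\
  normc (lam j * tau w) <= 2 * s * q / (1 - q).
Proof.
move=> t0 [tD tf _] t00 td xj xj1 q01 wq s.
have xj0 : 0 < normc (x 0 j) by rewrite normc_gt0.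
have s0 : 0 < s by rewrite oppr_gt0 ln_lt0 // xj0.
pose P (z : C) : C := s%:C%C - lam j * tau (t%:C%C * z).
have inr z : normc z < 1 -> normc (t%:C%C * z : C) < t.
  by move=> z1; rewrite normc_mulr gtr0_norm // gtr_pMr.
have Pd z : normc z < 1 -> cderivable P z.
  move=> /inr /td tz.
  have h : cderivable (fun z => tau (t%:C%C * z)) z.
    apply: (@cderivable_comp R tau (fun z => t%:C%C * z)) => //.
    exact: (cderivableM (cderivable_cst _ z) (cderivable_id z)).
  exact: (cderivableB (cderivable_cst _ z) (cderivableM (cderivable_cst (lam j) z) h)).
have Pp z : normc z < 1 -> 0 < complex.Re (P z).
  move=> /inr /tD /(_ j); rewrite flowE normcCM normc_cexp => h.
  have h0 : 0 < normc (x 0 j) * expR (complex.Re (lam j * tau (t%:C%C * z))).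
    by rewrite mulr_gt0 // expR_gt0.
  have : ln (normc (x 0 j) * expR (complex.Re (lam j * tau (t%:C%C * z)))) < 0.
    by rewrite ln_lt0 // h0.
  rewrite lnM ?posrE ?expR_gt0 // expRK /P ReD ReN /= /s; lra.
have P0 : P 0 = s%:C%C by rewrite /P mulr0 t00 mulr0 subr0.
pose z : C := (t^-1)%:C%C * w.
have zE : t%:C%C * z = w by rewrite /z mulrA -rmorphM /= mulfV ?gt_eqF // mul1r.
have zq : normc z <= q.
  by rewrite normc_mulr gtr0_norm ?invr_gt0 // mulrC ler_pdivrMr.
case/andP: (q01) => q0 q1; have z1 := le_lt_trans zq q1.
have sp : normc (P z - s%:C%C) <= q * normc (P z + s%:C%C).
  rewrite (le_trans (schwarz_half_plane s0 P0 Pd Pp z1)) //.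
  by rewrite ler_wpM2r // normc_ge0.
have [b1 b2] := half_plane_bounds s0 q01 sp.
move: b1 b2; rewrite /P zE; split.
  by move: b1; rewrite ReD ReN.
by move: b2; rewrite addrC addKr normc_opp.
Qed.

Lemma flow_coord_bound (x : rV) j (v : C) : x 0 j != 0 ->
  normc (flow lam x v 0 j) =
  expR (- (- ln (normc (x 0 j)) - complex.Re (lam j * v))).
Proof.
move=> xj; rewrite flowE normcCM normc_cexp opprB opprK expRD lnK ?posrE ?normc_gt0 //.
by rewrite mulrC.
Qed.

(** Coordinates below [expR (- B)] stay negligible at all the times considered and
need not be comparable. The others are compared through logarithms, as the half
plane cut out by a coordinate depends on the logarithm of its modulus. *)
Definition near_coord (B w : R) (a b : C) :=
  (normc a <= expR (- B) /\ normc b <= expR (- B)) \/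
  [/\ a != 0, b != 0, `|ln (normc a) - ln (normc b)| <= w &
      normc (a / (normc a)%:C%C - b / (normc b)%:C%C) <= w].

Lemma near_coord_sym B w a b : near_coord B w a b -> near_coord B w b a.
Proof.
by case=> [[? ?]|[? ? h1 h2]]; [left|right; rewrite distrC normc_sub in h1 h2 *].
Qed.

(** A coordinate [i0] of moderate size bounds the times [tau v] by Borel-Caratheodory,
so negligible coordinates remain so. For the others, Harnack keeps the first leaf
at logarithmic distance at least [s0 * (1 - t) / 2] from the boundary of the
polydisc, more than the discrepancy [w] between the two points. *)
Lemma close_inclusion (x y : rV) (f : C -> rV) (tau : C -> C) (t S L B w s0 : R)
    (i0 : 'I_k) :
  polydisc x -> 0 < t -> t < 1 ->
  is_lift (flow lam x) (flow_domain lam x) f [set v | normc v < t] tau ->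
  tau 0 = 0 -> (forall v, normc v < t -> cderivable tau v) ->
  x 0 i0 != 0 -> - ln (normc (x 0 i0)) <= S ->
  0 < L -> (forall i j, normc (lam j) <= L * normc (lam i)) ->
  0 < B -> 4 * L * S / (1 - t) <= B ->
  (forall j, near_coord B w (x 0 j) (y 0 j)) ->
  (forall j, x 0 j != 0 -> s0 <= - ln (normc (x 0 j))) ->
  0 <= w -> w <= 1 / 2 -> 2 * w < s0 * (1 - t) ->
  forall v : C, normc v < t ^+ 2 -> flow_domain lam y (tau v) /\
    forall j, normc (flow lam x (tau v) 0 j - flow lam y (tau v) 0 j) <=
      2 * expR (- (B / 2)) + 4 * w.
Proof.
move=> xD t0 t1 lt t00 td xi0 xS L0 Llam B0 SB xy xs w0 w12 ws v vt.
have t01 : 0 <= t < 1 by rewrite ltW.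
have vt' : normc v <= t * t by rewrite -expr2 ltW.
have bnd j (xj : x 0 j != 0) := lift_bounds t0 lt t00 td xj (xD j) t01 vt'.
have e1 : 0 < 1 - t by rewrite subr_gt0.
have ltau j : normc (lam j * tau v) <= B / 2.
  have [_] := bnd i0 xi0; rewrite !normcCM => h.
  apply: (@le_trans _ _ (L * (2 * (- ln (normc (x 0 i0))) * t / (1 - t)))).
    apply: (@le_trans _ _ (L * normc (lam i0) * normc (tau v))).
      by rewrite ler_wpM2r ?normc_ge0.
    by rewrite -mulrA ler_wpM2l // ltW.
  have h1 : L * (2 * (- ln (normc (x 0 i0))) * t / (1 - t)) <= L * (2 * S / (1 - t)).
    rewrite ler_wpM2l ?(ltW L0) // ler_pM2r ?invr_gt0 //.
    have s1 : 0 <= - ln (normc (x 0 i0)).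
      rewrite oppr_ge0 ln_le0 //; exact: ltW (xD i0).
    apply: (@le_trans _ _ (2 * (- ln (normc (x 0 i0))))).
      by rewrite ler_piMr ?mulr_ge0 // ltW.
    by rewrite ler_pM2l.
  apply: (le_trans h1).
  have -> : L * (2 * S / (1 - t)) = 4 * L * S / (1 - t) / 2 by field; rewrite gt_eqF.
  by rewrite ler_pM2r.
have tiny (z : rV) j : normc (z 0 j) <= expR (- B) ->
    normc (flow lam z (tau v) 0 j) <= expR (- (B / 2)).
  move=> zB; rewrite flowE normcCM normc_cexp.
  have -> : - (B / 2) = - B + B / 2 by field.
  rewrite expRD ler_pM ?normc_ge0 ?expR_ge0 // ler_expR.
  by rewrite (le_trans (ler_norm _)) // (le_trans (normc_Re _)).
have small : expR (- (B / 2)) < 1 by rewrite expR_lt1 oppr_lt0 divr_gt0.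
have main j : normc (flow lam y (tau v) 0 j) < 1 /\
    normc (flow lam x (tau v) 0 j - flow lam y (tau v) 0 j) <=
      2 * expR (- (B / 2)) + 4 * w.
  have [[xB yB]|[xj yj lnxy uxy]] := xy j.
    have h1 := tiny x j xB; have h2 := tiny y j yB.
    split; first exact: le_lt_trans small.
    by have := ler_normcB (flow lam x (tau v) 0 j) (flow lam y (tau v) 0 j); lra.
  have [b1 _] := bnd j xj.
  have fx := flow_coord_bound (tau v) xj.
  have fy := flow_coord_bound (tau v) yj.
  have xs1 := xs j xj.
  have b2 : s0 * (1 - t) <= - ln (normc (x 0 j)) * (1 - t) by rewrite ler_pM2r.
  split.
    rewrite fy expR_lt1; move: lnxy; rewrite ler_norml => /andP[l1 l2]; lra.
  have nx : 0 < normc (x 0 j) by rewrite normc_gt0.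
  have ny : 0 < normc (y 0 j) by rewrite normc_gt0.
  have nxC : ((normc (x 0 j))%:C%C : C) != 0.
    by rewrite -normc_eq0 normc_real normr_eq0 gt_eqF.
  have nyC : ((normc (y 0 j))%:C%C : C) != 0.
    by rewrite -normc_eq0 normc_real normr_eq0 gt_eqF.
  have fx1 : normc (x 0 j) * normc (cexp (lam j * tau v)) <= 1.
    rewrite -normcCM -flowE; apply: ltW; case: lt => tD _ _.
    by apply: tD; apply: lt_trans vt _; rewrite expr2 gtr_pMr.
  rewrite !flowE -mulrBl.
  have -> : x 0 j - y 0 j = (normc (x 0 j))%:C%C *
      ((x 0 j / (normc (x 0 j))%:C%C - y 0 j / (normc (y 0 j))%:C%C) -
       (normc (y 0 j) / normc (x 0 j) - 1)%:C%C * (y 0 j / (normc (y 0 j))%:C%C)).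
    by rewrite rmorphB rmorphM /= fmorphV; field; apply/andP.
  rewrite normcCM normcCM normc_real gtr0_norm // mulrAC.
  set D := normc (_ - _).
  have Dw : D <= w + 2 * w.
    rewrite /D (le_trans (ler_normcB _ _)) // lerD // normc_mulr.
    have -> : normc (y 0 j / (normc (y 0 j))%:C%C) = 1.
      by rewrite normcCM normcCV normc_real gtr0_norm // mulfV // gt_eqF.
    rewrite mulr1.
    have -> : normc (y 0 j) / normc (x 0 j) =
        expR (ln (normc (y 0 j)) - ln (normc (x 0 j))).
      by rewrite expRB !lnK ?posrE.
    by apply: expR_near1 => //; rewrite distrC.
  have D0 : 0 <= D by exact: normc_ge0.
  have := expR_ge0 (- (B / 2)) => e0.
  apply: (@le_trans _ _ (1 * D)); last by lra.
  by rewrite ler_wpM2r.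
by split => [j|j]; have [] := main j.
Qed.

(** By Harnack, the leaf stays near the origin if all the logarithms are large. *)
Lemma small_leaf (x : rV) (f : C -> rV) (S t r : R) :
  polydisc x -> x != 0 -> universal_covering lam x f -> f 0 = x ->
  0 <= r -> r < t -> t < 1 ->
  (forall j, x 0 j != 0 -> S <= - ln (normc (x 0 j))) ->
  forall z : C, normc z <= r -> forall j,
  normc (f z 0 j) <= expR (- (S * (1 - r / t) / 2)).
Proof.
move=> xD x0 cov f0 r0 rt t1 xS z zr j; have t0 := le_lt_trans r0 rt.
have [tau [lt t00 td]] := covering_lift lam0 x0 cov xD f0 t0 t1.
have q01 : 0 <= r / t < 1.
  by rewrite divr_ge0 ?(ltW t0) //= ltr_pdivrMr // mul1r.
have zq : normc z <= r / t * t by rewrite divfK ?gt_eqF.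
have -> : f z = flow lam x (tau z).
  by case: lt => _ tf _; rewrite tf //=; exact: le_lt_trans rt.
have [xj|xj] := eqVneq (x 0 j) 0.
  by rewrite flowE xj mul0r normcC0 expR_ge0.
have [b1 _] := lift_bounds t0 lt t00 td xj (xD j) q01 zq.
rewrite flow_coord_bound // ler_expR lerN2; apply: le_trans b1.
rewrite ler_pM2r // ler_pM2r ?xS // subr_gt0; by case/andP: q01.
Qed.

Lemma close_leaves (x y : rV) (f1 f2 : C -> rV) (t r S L B w s0 : R) (i0 : 'I_k) :
  polydisc x -> polydisc y -> x != 0 -> y != 0 ->
  universal_covering lam x f1 -> universal_covering lam y f2 ->
  f1 0 = x -> f2 0 = y -> 3 / 4 <= t -> t < 1 -> 0 <= r -> r < 1 ->
  x 0 i0 != 0 -> - ln (normc (x 0 i0)) <= S ->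
  0 < L -> (forall i j, normc (lam j) <= L * normc (lam i)) ->
  S < B -> 4 * L * (S + 1) / (1 - t) <= B ->
  (forall j, near_coord B w (x 0 j) (y 0 j)) ->
  (forall j, x 0 j != 0 -> s0 <= - ln (normc (x 0 j))) ->
  (forall j, y 0 j != 0 -> s0 <= - ln (normc (y 0 j))) ->
  0 <= w -> w <= 1 / 2 -> 2 * w < s0 * (1 - t) ->
  exists theta : R, forall z : C, normc z <= r -> forall j,
    normc (f1 z 0 j - f2 (cexp (Complex 0 theta) * z) 0 j) <=
      78 * (1 - t) / (1 - r) ^+ 2 + (2 * expR (- (B / 2)) + 4 * w).
Proof.
move=> xD yD x0 y0 cov1 cov2 f10 f20 t34 t1 r0 r1 xi0 xS L0 Llam SB1 SB xy xs ys
  w0 w12 ws.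
have t0 : 0 < t by lra.
have B0 : 0 < B.
  apply: le_lt_trans SB1; apply: le_trans xS.
  by rewrite oppr_ge0 ln_le0 //; exact: ltW (xD i0).
have [tau1 [l1 t10 d1]] := covering_lift lam0 x0 cov1 xD f10 t0 t1.
have [tau2 [l2 t20 d2]] := covering_lift lam0 y0 cov2 yD f20 t0 t1.
have xi0n : 0 < normc (x 0 i0) by rewrite normc_gt0.
have [yi0 yS] : y 0 i0 != 0 /\ - ln (normc (y 0 i0)) <= S + 1.
  have [[xB _]|[_ yi0 + _]] := xy i0.
    exfalso; move: xB; rewrite -[leLHS]lnK ?posrE // ler_expR; lra.
  by rewrite ler_norml => /andP[h1 h2]; split => //; lra.
have xS' : - ln (normc (x 0 i0)) <= S + 1 by lra.
have yx j : near_coord B w (y 0 j) (x 0 j) by apply: near_coord_sym.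
have i1 := close_inclusion xD t0 t1 l1 t10 d1 xi0 xS' L0 Llam B0 SB xy xs w0 w12 ws.
have i2 := close_inclusion yD t0 t1 l2 t20 d2 yi0 yS L0 Llam B0 SB yx ys w0 w12 ws.
have i1' (v : C) : normc v < t ^+ 2 -> flow_domain lam y (tau1 v) by case/i1.
have i2' (v : C) : normc v < t ^+ 2 -> flow_domain lam x (tau2 v) by case/i2.
have [theta th] := compare_leaves lam0 x0 y0 xD yD cov1 cov2 f10 f20 t34 t1 r0 r1
  l1 l2 t10 t20 d1 d2 i1' i2'.
exists theta => z zr j; have [v vt vP] := th z zr.
rewrite (le_trans (vP j)) // lerD2l; by have [_] := i1 v vt.
Qed.

End Closeness.

(** * The Poincare distance to the centre *)

Section Poincare.
Variable R : realType.
Local Notation C := (cplx R).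

Lemma log_density_le (a b p q : R) : a ^+ 2 + b ^+ 2 < 1 ->
  2 * (a * p + b * q) / (1 - (a ^+ 2 + b ^+ 2)) <=
  2 * Num.sqrt (p ^+ 2 + q ^+ 2) / (1 - (a ^+ 2 + b ^+ 2)).
Proof.
move=> ab; rewrite ler_pM2r ?invr_gt0 ?subr_gt0 // ler_pM2l //.
have pq : 0 <= p ^+ 2 + q ^+ 2 by rewrite addr_ge0 ?sqr_ge0.
have [neg|pos] := leP (a * p + b * q) 0; first exact: le_trans (sqrtr_ge0 _).
rewrite -(ler_pXn2r (n := 2)) ?nnegrE ?sqrtr_ge0 ?(ltW pos) // sqr_sqrtr //.
have := sqr_ge0 (a * q - b * p) => cs.
have : (a ^+ 2 + b ^+ 2) * (p ^+ 2 + q ^+ 2) <= p ^+ 2 + q ^+ 2.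
  by rewrite ler_piMl // ltW.
nra.
Qed.

(** The function [- ln (1 - normc g ^+ 2)] is smooth along a path, unlike the
distance to the centre, and grows slower than the length; near the boundary of
the disc it is the distance up to a bounded term. *)
Lemma poincare_length_ge (g : R -> C) (z : C) : poincare_path 0 z g ->
  ((- ln (1 - normc z ^+ 2))%:E <= poincare_length g)%E.
Proof.
move=> [[ud uc] [vd vc] gD g0 g1].
pose u (t : R) : R := complex.Re (g t); pose v (t : R) : R := complex.Im (g t).
pose u' : R -> R := derive1 u; pose v' : R -> R := derive1 v.
pose N (t : R) : R := u t ^+ 2 + v t ^+ 2.
have gN (t : R) : normc (g t) ^+ 2 = N t by exact: normc_sqr.
have N1 (t : R) : 0 <= t <= 1 -> 0 < 1 - N t.
  by move=> /gD g_1; rewrite subr_gt0 -gN expr_lt1 // normc_ge0.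
have du (t : R) : is_derive t 1 u (u' t) by apply: DeriveDef; [exact: ud|rewrite /u' derive1E].
have dv (t : R) : is_derive t 1 v (v' t) by apply: DeriveDef; [exact: vd|rewrite /v' derive1E].
pose Phi (t : R) : R := - ln (1 - N t).
pose phi (t : R) : R := 2 * (u t * u' t + v t * v' t) / (1 - N t).
have uct (t : R) : {for t, continuous u} by apply/differentiable_continuous/derivable1_diffP.
have vct (t : R) : {for t, continuous v} by apply/differentiable_continuous/derivable1_diffP.
have Nc (t : R) : {for t, continuous (fun t => 1 - N t)}.
  apply: (@continuousB R R R (fun=> 1) N); first exact: cst_continuous.
  apply: (@continuousD R R R (fun t => u t ^+ 2) (fun t => v t ^+ 2)).
    exact: (@continuousM R R u u t (uct t) (uct t)).
  exact: (@continuousM R R v v t (vct t) (vct t)).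
have dPhi (t : R) : 0 <= t <= 1 -> is_derive t 1 Phi (phi t).
  move=> /N1 Nt.
  have dN : is_derive t 1 (fun t => 1 - N t) (- (2 * (u t * u' t + v t * v' t))).
    apply: is_derive_eq; rewrite /GRing.scale /=; ring.
  have dl := @is_derive1_comp R (@ln R) (fun t => 1 - N t) t _ _ (is_derive1_ln Nt) dN.
  have := is_deriveN dl.
  by rewrite mulrN opprK mulrC.
have ctsI (F : R -> R) : (forall t : R, 0 <= t <= 1 -> {for t, continuous F}) ->
    {within `[0, 1], continuous F}.
  by move=> Fc; apply: continuous_in_subspaceT => t; rewrite inE /= in_itv /= => /Fc.
have Nic (t : R) : 0 <= t <= 1 -> {for t, continuous (fun t => (1 - N t)^-1)}.
  by move=> /N1 Nt; apply: (@continuousV R R (fun t => 1 - N t) t) (Nc t); rewrite gt_eqF.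
have phic (t : R) : 0 <= t <= 1 -> {for t, continuous phi}.
  move=> t01; apply: (@continuousM R R (fun t => 2 * (u t * u' t + v t * v' t))
    (fun t => (1 - N t)^-1)); last exact: Nic.
  apply: (@continuousM R R (fun=> 2)); first exact: cst_continuous.
  apply: (@continuousD R R R (fun t => u t * u' t) (fun t => v t * v' t)).
    exact: (@continuousM R R u u' t (uct t) (uc t)).
  exact: (@continuousM R R v v' t (vct t) (vc t)).
pose psi (t : R) : R := 2 * Num.sqrt (u' t ^+ 2 + v' t ^+ 2) / (1 - N t).
have psic (t : R) : 0 <= t <= 1 -> {for t, continuous psi}.
  move=> t01; apply: (@continuousM R R (fun t => 2 * Num.sqrt (u' t ^+ 2 + v' t ^+ 2))
    (fun t => (1 - N t)^-1)); last exact: Nic.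
  apply: (@continuousM R R (fun=> 2)); first exact: cst_continuous.
  apply: (@continuous_comp R R R (fun t => u' t ^+ 2 + v' t ^+ 2) Num.sqrt).
    apply: (@continuousD R R R (fun t => u' t ^+ 2) (fun t => v' t ^+ 2)).
      exact: (@continuousM R R u' u' t (uc t) (uc t)).
    exact: (@continuousM R R v' v' t (vc t) (vc t)).
  exact: sqrt_continuous.
have ctsPhi (t : R) : 0 <= t <= 1 -> {for t, continuous Phi}.
  move=> /dPhi[dp _]; exact/differentiable_continuous/derivable1_diffP.
have FTC : (\int[lebesgue_measure]_(t in `[0%R, 1%R]) (phi t)%:E = (Phi 1)%:E - (Phi 0)%:E)%E.
  apply: continuous_FTC2 => //; first exact: ctsI.
    split.
    - move=> t; rewrite in_itv /= => /andP[t0 t1].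
      by have [] := dPhi t; first by rewrite !ltW.
    - by apply: cvg_at_right_filter; apply: ctsPhi; rewrite lexx ler01.
    - by apply: cvg_at_left_filter; apply: ctsPhi; rewrite lexx ler01.
  move=> t; rewrite in_itv /= => /andP[t0 t1]; rewrite derive1E.
  by have [] := dPhi t; first by rewrite !ltW.
have P0 : Phi 0 = 0.
  by rewrite /Phi -gN g0 normcC0 expr0n subr0 ln1 oppr0.
have P1 : Phi 1 = - ln (1 - normc z ^+ 2) by rewrite /Phi -gN g1.
rewrite P0 sube0 P1 in FTC; rewrite -FTC /poincare_length.
have -> : (\int[lebesgue_measure]_(t in `[0%R, 1%R])
    (2 * Num.sqrt (derive1 (fun t => complex.Re (g t)) t ^+ 2 +
      derive1 (fun t => complex.Im (g t)) t ^+ 2) / (1 - normc (g t) ^+ 2))%:E =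
  \int[lebesgue_measure]_(t in `[0%R, 1%R]) (psi t)%:E)%E.
  by apply: eq_integral => t _; rewrite gN.
apply: le_integral => //.
- by apply: continuous_compact_integrable; [exact: segment_compact|exact: ctsI].
- by apply: continuous_compact_integrable; [exact: segment_compact|exact: ctsI].
move=> t; rewrite inE /= in_itv /= => /N1 Nt; rewrite lee_fin.
by apply: log_density_le; rewrite -subr_gt0.
Qed.

Lemma poincare_disc_norm (r : R) (z : C) : poincare_disc r z ->
  normc z <= 1 - expR (- r) / 2.
Proof.
move=> [z1 /ereal_inf_lt[_ [g gP <-] lt]].
have := le_lt_trans (poincare_length_ge gP) lt; rewrite lte_fin => h.
have z0 := normc_ge0 z; have zz : 0 < 1 - normc z ^+ 2.
  by rewrite subr_gt0 expr_lt1.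
have : expR (- r) < 1 - normc z ^+ 2.
  by rewrite -[ltRHS]lnK ?posrE // ltr_expR ltrNl.
have := expR_gt0 (- r); move: z1; rewrite /disc /=; nra.
Qed.
End Poincare.

(** * Labels of points of the polydisc *)

Section Counting.
Variables (R : realType) (k : nat) (lam : 'I_k -> cplx R).
Local Notation C := (cplx R).
Local Notation rV := 'rV[C]_k.

(** The moduli of the coordinates have maxima less than [1] on [K]. *)
Lemma compact_polydisc_bound (K : set rV) : compact K -> K `<=` @polydisc R k ->
  exists2 s0 : R, 0 < s0 & forall x, K x -> forall j, x 0 j != 0 ->
    s0 <= - ln (normc (x 0 j)).
Proof.
move=> Kc KD.
have bnd j : exists2 q : R, q < 1 & forall x, K x -> normc (x 0 j) <= q.
  have [K0|/set0P/negP/negPn/eqP K0] := pselect (K !=set0); last first.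
    by exists 0 => //; rewrite K0.
  have uc : {within K, continuous (fun x : rV => normc (x 0 j))}.
    apply: continuous_subspaceT => x A /nbhs_ballP[e /= e0 eA].
    have : nbhs (x 0 j) [set z : C | normc (z - x 0 j) < e] by exact: nbhsC_gt0.
    move=> nb; have cc : nbhs x [set y : rV | normc (y 0 j - x 0 j) < e].
      exact: (@coord_continuous R[i] 1 k 0 j x _ nb).
    suff sub : [set y : rV | normc (y 0 j - x 0 j) < e] `<=`
        (fun y : rV => normc (y 0 j)) @^-1` A by exact: filterS sub cc.
    move=> y /= ye; apply: eA; rewrite /ball /= ltr_norml.
    have h1 := lerB_normc (x 0 j) (y 0 j); have h2 := lerB_normc (y 0 j) (x 0 j).
    rewrite normc_sub in h1; apply/andP; split; lra.
  have [x Kx xmax] := compact_EVT_max K0 Kc uc.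
  exists (normc (x 0 j)); first by apply: KD; move: Kx; rewrite inE.
  by move=> y Ky; apply: xmax; rewrite inE.
have [q qP] : exists q : 'I_k -> R, forall j, q j < 1 /\
    forall x, K x -> normc (x 0 j) <= q j.
  have : forall j, exists q : R, q < 1 /\ forall x, K x -> normc (x 0 j) <= q.
    by move=> j; have [q q1 qK] := bnd j; exists q.
  by move=> /choice[q qP]; exists q.
pose Q := \big[Order.max/(1 / 2 : R)]_(j < k) q j.
have Q1 : Q < 1.
  by apply: bigmax_lt => [|j _]; [lra|case: (qP j)].
have Q0 : 1 / 2 <= Q by exact: bigmax_ge_id.
exists (- ln Q); first by rewrite oppr_gt0 ln_lt0 // Q1 andbT; lra.
move=> x Kx j xj; rewrite lerN2 ler_ln ?posrE ?normc_gt0 //; last by lra.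
apply: le_trans (le_bigmax _ _ j); by case: (qP j) => _; exact.
Qed.

Lemma lambda_star_ratio : (1 <= k)%N -> (forall j, lam j != 0) ->
  0 < lambda_star lam /\
  forall i j, normc (lam j) <= lambda_star lam * normc (lam i).
Proof.
move=> k1 lam0; rewrite /lambda_star.
set M := \big[_/0]_(j < k) _; set m := \big[_/M]_(j < k) _.
have lamM j : normc (lam j) <= M by exact: le_bigmax.
have M0 : 0 < M.
  by apply: lt_le_trans (lamM (Ordinal k1)); rewrite normc_gt0.
have m0 : 0 < m by apply: lt_bigmin => // j _; rewrite normc_gt0.
have ml j : m <= normc (lam j) by exact: bigmin_le.
split; first exact: divr_gt0.
move=> i j; rewrite mulrAC ler_pdivlMr //.
by rewrite ler_pM ?normc_ge0 // ltW.
Qed.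

(** The cap [2 * B] is twice the threshold of [near_coord]: a label shared with a
capped coordinate still forces a logarithm above [B]. *)
Definition capped_log (B : R) (a : C) : R :=
  if a == 0 then 2 * B else Num.min (2 * B) (- ln (normc a)).

Definition direction (a : C) : C := a / (normc a)%:C%C.

(** The direction replaces the argument, to avoid the jump of the latter. *)
Definition coord_label (n : nat) (B w : R) (a : C) : 'I_n.+1 * 'I_n.+1 * 'I_n.+1 :=
  (inord (Num.truncn (capped_log B a / w)),
   inord (Num.truncn ((complex.Re (direction a) + 1) / (w / 2))),
   inord (Num.truncn ((complex.Im (direction a) + 1) / (w / 2)))).

Lemma same_cell (X c a b : R) (n : nat) : 0 < c -> 0 <= a <= X -> 0 <= b <= X ->
  X / c < n.+1%:R ->
  inord (Num.truncn (a / c)) = inord (Num.truncn (b / c)) :> 'I_n.+1 ->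
  `|a - b| < c.
Proof.
move=> c0 /andP[a0 aX] /andP[b0 bX] nX.
have h (y : R) : 0 <= y -> y <= X -> (Num.truncn (y / c) < n.+1)%N.
  move=> y0 yX; have yc0 : 0 <= y / c by rewrite divr_ge0 // ltW.
  have /andP[h1 _] := truncn_itv yc0.
  rewrite -(ltr_nat R); apply: le_lt_trans h1 _; apply: le_lt_trans nX.
  by rewrite ler_pM2r ?invr_gt0.
move=> /(congr1 (@nat_of_ord _)); rewrite !inordK ?h // => eq.
have ac0 : 0 <= a / c by rewrite divr_ge0 // ltW.
have bc0 : 0 <= b / c by rewrite divr_ge0 // ltW.
have /andP[a1 a2] := truncn_itv ac0; have /andP[b1 b2] := truncn_itv bc0.
rewrite eq in a1 a2; rewrite -natr1 in a2 b2.
have : `|a / c - b / c| < 1 by rewrite ltr_norml; apply/andP; split; lra.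
by rewrite -mulrBl normrM normfV (gtr0_norm c0) ltr_pdivrMr // mul1r.
Qed.

Lemma direction_le1 a : normc (direction a) <= 1.
Proof.
rewrite normcCM normcCV normc_real ger0_norm ?normc_ge0 //.
have [->|a0] := eqVneq a 0; first by rewrite normcC0 mul0r.
by rewrite mulfV // normc_eq0.
Qed.

Lemma same_label_near (n : nat) (B w : R) (a b : C) : 0 < w -> w <= B -> 2 <= B ->
  2 * B / w < n.+1%:R -> normc a < 1 -> normc b < 1 ->
  coord_label n B w a = coord_label n B w b -> near_coord B w a b.
Proof.
move=> w0 wB B2 nB a1 b1 [e1 e2 e3].
have B0 : 0 < B by lra.
have capP (c : C) : normc c < 1 -> 0 <= capped_log B c <= 2 * B.
  move=> c1; rewrite /capped_log; case: eqVneq => [_|c0].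
    by rewrite lexx andbT mulr_ge0 // ltW.
  rewrite le_min ge_min lexx /= andbT mulr_ge0 ?(ltW B0) //=.
  by rewrite oppr_ge0 ln_le0 // ltW.
have capw := same_cell w0 (capP a a1) (capP b b1) nB e1.
have n4 : 2 / (w / 2) < n.+1%:R.
  apply: le_lt_trans nB; have -> : 2 / (w / 2) = 4 / w by field; rewrite gt_eqF.
  by rewrite ler_pM2r ?invr_gt0 //; lra.
have w20 : 0 < w / 2 by exact: divr_gt0.
have dirR (c : C) : 0 <= complex.Re (direction c) + 1 <= 2.
  have := le_trans (normc_Re _) (direction_le1 c); rewrite ler_norml.
  by move=> /andP[? ?]; apply/andP; split; lra.
have dirI (c : C) : 0 <= complex.Im (direction c) + 1 <= 2.
  have := le_trans (normc_Im _) (direction_le1 c); rewrite ler_norml.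
  by move=> /andP[? ?]; apply/andP; split; lra.
have reR := same_cell w20 (dirR a) (dirR b) n4 e2.
have imI := same_cell w20 (dirI a) (dirI b) n4 e3.
have dirw : normc (direction a - direction b) <= w.
  rewrite (le_trans (normc_ReIm _)) // ReD ImD ReN ImN.
  have E (p q : R) : p + 1 - (q + 1) = p - q by ring.
  rewrite E in reR; rewrite E in imI.
  by rewrite [leRHS]splitr lerD // ltW.
have deep (c : C) : B <= capped_log B c -> normc c <= expR (- B).
  rewrite /capped_log; case: eqVneq => [-> _|c0].
    by rewrite normcC0 expR_ge0.
  rewrite le_min => /andP[_ h].
  by rewrite -[leLHS]lnK ?posrE ?normc_gt0 // ler_expR lerNr.
have shallow (c : C) : capped_log B c < 2 * B -> c != 0 /\
    capped_log B c = - ln (normc c).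
  rewrite /capped_log; case: eqVneq => [_|c0]; first by rewrite ltxx.
  by rewrite gt_min ltxx /= => h; rewrite min_r // ltW.
move: capw; rewrite ltr_norml => /andP[cw1 cw2].
have [aB|aB] := leP (2 * B) (capped_log B a).
  by left; split; apply: deep; lra.
have [bB|bB] := leP (2 * B) (capped_log B b).
  by left; split; apply: deep; lra.
right; have [a0 aE] := shallow a aB; have [b0 bE] := shallow b bB.
by split => //; rewrite ler_norml; apply/andP; split; rewrite aE bE in cw1 cw2; lra.
Qed.

Lemma euclid_dist_le (z w : rV) (d : R) : 0 <= d ->
  (forall j, normc (z 0 j - w 0 j) <= d) -> euclid_dist z w <= k%:R * d.
Proof.
move=> d0 zw; rewrite /euclid_dist.
have kd0 : 0 <= k%:R * d by rewrite mulr_ge0.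
rewrite -(ger0_norm kd0) -sqrtr_sqr ler_wsqrtr //.
apply: (@le_trans _ _ (\sum_(j < k) d ^+ 2)).
  by apply: ler_sum => j _; rewrite ler_pXn2r ?nnegrE ?normc_ge0.
have -> : \sum_(j < k) d ^+ 2 = k%:R * d ^+ 2.
  by rewrite sumr_const card_ord mulr_natl.
rewrite exprMn; apply: ler_wpM2r; first exact: sqr_ge0.
rewrite -natrX ler_nat; case: (k) => [//|m]; exact: leq_pmulr.
Qed.

Lemma bowen_dist_lt (phi : rV -> C -> rV) (h e d theta : R) (x y : rV) :
  0 <= d -> k%:R * d < e ->
  (forall z : C, normc z <= 1 - expR (- h) / 2 -> forall j,
    normc (phi x z 0 j - phi y (cexp (Complex 0 theta) * z) 0 j) <= d) ->
  (bowen_dist phi h x y < e%:E)%E.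
Proof.
move=> d0 kde close.
apply: (@le_lt_trans _ _ ((k%:R * d)%:E)%E); last by rewrite lte_fin.
apply: (@le_trans _ _ (ereal_sup [set (euclid_dist (phi x xi)
   (phi y (cexp (Complex 0 theta) * xi)))%:E | xi in poincare_disc h])).
  by apply: ereal_inf_lbound; exists theta.
apply: ge_ereal_sup => _ [xi xiP <-]; rewrite lee_fin.
by apply: euclid_dist_le => // j; apply: close; exact: poincare_disc_norm.
Qed.

End Counting.

(** * Counting Bowen balls *)

Section Entropy.
Variables (R : realType) (k : nat) (lam : 'I_k -> cplx R).
Local Notation C := (cplx R).
Local Notation rV := 'rV[C]_k.

Lemma expRN_le_inv (y : R) : 0 < y -> expR (- y) <= y^-1.
Proof.
move=> y0; rewrite expRN lef_pV2 ?posrE ?expR_gt0 //.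
by have := expR_ge1Dx y; lra.
Qed.

(** Each of the [3 * k] integers takes at most [E ^+ 11] values; one more factor
[E ^+ k] absorbs the label [None]. *)
Lemma label_count (n : nat) (E : R) : (1 <= k)%N -> 4 <= E -> n%:R <= 2 * E ^+ 10 ->
  (#|{: option {ffun 'I_k -> 'I_n.+1 * 'I_n.+1 * 'I_n.+1}}|%:R : R) <=
  E ^+ (34 * k).
Proof.
move=> k1 E4 nE; have E0 : 0 < E by lra.
have n11 : n.+1%:R <= E ^+ 11 :> R.
  rewrite -natr1 exprS.
  have : 1 <= E ^+ 10 by rewrite exprn_ege1 //; lra.
  have : 4 * E ^+ 10 <= E * E ^+ 10 by rewrite ler_pM2r ?exprn_gt0.
  lra.
have n0 : 0 <= n.+1%:R :> R by rewrite ler0n.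
have E11 : 0 <= E ^+ 11 by rewrite exprn_ge0 // ltW.
rewrite card_option card_ffun !card_prod !card_ord -natr1 natrX !natrM.
have step : (n.+1%:R * n.+1%:R * n.+1%:R : R) ^+ k <= E ^+ (33 * k).
  rewrite exprM; apply: lerXn2r; rewrite ?nnegrE ?mulr_ge0 ?exprn_ge0 ?(ltW E0) //.
  have -> : E ^+ 33 = E ^+ 11 * E ^+ 11 * E ^+ 11 by rewrite -!exprD.
  by rewrite ler_pM ?mulr_ge0 // ler_pM.
have E33 : 1 <= E ^+ (33 * k) by rewrite exprn_ege1 //; lra.
have Ek : 4 <= E ^+ k.
  by rewrite (le_trans E4) // -{1}(expr1 E) ler_weXn2l //; lra.
have -> : E ^+ (34 * k) = E ^+ k * E ^+ (33 * k) by rewrite -exprD -mulSn.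
have : 4 * E ^+ (33 * k) <= E ^+ k * E ^+ (33 * k).
  by rewrite ler_pM2r // (lt_le_trans ltr01).
lra.
Qed.

(** At hyperbolic radius [h], all the scales are powers of [E = expR h]: the disc has
Euclidean radius at most [r = 1 - 1 / (2 * E)], the comparison is made at
[1 - t = E ^- 3], the mesh of the labels is [E ^- 4], coordinates with logarithm
above [E ^+ 6] are negligible, and a point is [deep] if all its logarithms exceed
[E ^+ 2]. *)
Section Cover.
Variables (phi : rV -> C -> rV) (K : set rV) (e s0 h : R).
Hypothesis (k1 : (1 <= k)%N) (lam0 : forall j, lam j != 0).
Hypothesis (phiP : leaf_coverings lam phi) (KD : K `<=` @polydisc R k).
Hypothesis (e0 : 0 < e) (s00 : 0 < s0).
Hypothesis s0P : forall x, K x -> forall j, x 0 j != 0 -> s0 <= - ln (normc (x 0 j)).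
Variables (E v r t : R).
Hypotheses (EE : E = expR h) (vE : v = E^-1) (rD : r = 1 - v / 2)
  (tD : t = 1 - v ^+ 3).
Hypotheses (E4 : 4 <= E) (EL : 8 * lambda_star lam <= E) (Es : 2 / s0 < E)
  (Ek : 640 * k%:R / e <= E).

Let E0 : 0 < E. Proof. exact: lt_le_trans E4. Qed.
Let v0 : 0 < v. Proof. by rewrite vE invr_gt0. Qed.
Let v4 : v <= 1 / 4.
Proof. by rewrite mul1r vE lef_pV2 ?posrE. Qed.
Let Ev : E * v = 1. Proof. by rewrite vE mulfV // gt_eqF. Qed.
Let vV : v^-1 = E. Proof. by rewrite vE invrK. Qed.
Let rE : 1 - expR (- h) / 2 = r. Proof. by rewrite rD vE EE expRN. Qed.
Let v3 : 0 < v ^+ 3. Proof. exact: exprn_gt0. Qed.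
Let v34 : v ^+ 3 <= v / 4.
Proof.
rewrite exprS mulrC (mulrC v) ler_wpM2r ?(ltW v0) //.
apply: (@le_trans _ _ (1 / 4 * (1 / 4))); last by lra.
by rewrite expr2 ler_pM // ltW.
Qed.

Let kv (d : R) : d <= 320 * v -> k%:R * d < e.
Proof.
move=> dv; have ke : 640 * k%:R * v <= e.
  move: Ek; rewrite ler_pdivrMr // => /(ler_wpM2r (ltW v0)).
  by rewrite [E * e * v]mulrAC Ev mul1r.
have : k%:R * d <= k%:R * (320 * v) by rewrite ler_wpM2l // ler0n.
have -> : k%:R * (320 * v) = 640 * k%:R * v / 2 by field.
move: (640 * k%:R * v) ke => c ce kd; apply: (le_lt_trans kd).
rewrite ltr_pdivrMr //; move: e0; lra.
Qed.

Let deep (x : rV) := forall j, x 0 j != 0 -> E ^+ 2 <= - ln (normc (x 0 j)).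

Let n : nat := Num.truncn (2 * E ^+ 6 / v ^+ 4).

(** The whole hyperbolic disc of a deep point maps into the [8 / E] neighbourhood of
the singular point. *)
Lemma deep_near_zero (x : rV) : polydisc x -> deep x ->
  (bowen_dist phi h 0 x < e%:E)%E.
Proof.
have v0' := v0; have v1' := v4; have v3' := v3; have v34' := v34; have E4' := E4.
move=> xD xdeep; have [phi0 phi1] := phiP.
have d0 : 0 <= 8 * v by rewrite mulr_ge0 // ltW.
have d8 : k%:R * (8 * v) < e by apply: kv; rewrite ler_pM2r //; lra.
apply: (bowen_dist_lt d0 d8 (theta := 0)) => z; rewrite rE => zr j.
have r1 : r < 1 by rewrite rD; lra.
have z1 : normc z < 1 := le_lt_trans zr r1.
have uz : normc (cexp (Complex 0 0) * z) <= r.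
  by rewrite normcCM normc_cexp /= expR0 mul1r.
rewrite phi0 // mxE sub0r normc_opp.
have [x0|x0] := eqVneq x 0.
  rewrite x0 phi0; last exact: le_lt_trans uz r1.
  by rewrite mxE normcC0.
have [cov f0] := phi1 x xD x0.
have r0 : 0 <= r by rewrite rD; lra.
have rt : r < t by rewrite rD tD; lra.
have t1 : t < 1 by rewrite tD; lra.
rewrite (le_trans (small_leaf lam0 xD x0 cov f0 r0 rt t1 xdeep uz j)) //.
have t0 : 0 < t := le_lt_trans r0 rt.
have q1 : v / 4 <= 1 - r / t.
  have -> : 1 - r / t = (t - r) / t by field; rewrite gt_eqF.
  rewrite ler_pdivlMr //.
  have : v / 4 * t <= v / 4 by rewrite ler_piMr ?(ltW t1) // divr_ge0 // ltW.
  rewrite rD tD; lra.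
have y0 : E / 8 <= E ^+ 2 * (1 - r / t) / 2.
  have : E ^+ 2 * (v / 4) <= E ^+ 2 * (1 - r / t) by rewrite ler_pM2l // exprn_gt0.
  have -> : E ^+ 2 * (v / 4) = E / 4 by rewrite expr2 -mulrA (mulrA E v) Ev mul1r.
  lra.
apply: (@le_trans _ _ (expR (- (E / 8)))); first by rewrite ler_expR lerN2.
rewrite (le_trans (expRN_le_inv _)) ?divr_gt0 //.
by rewrite invfM invrK mulrC vE.
Qed.

Lemma same_label_close (x y : rV) : K x -> K y -> ~ deep x -> ~ deep y ->
  (forall j, coord_label n (E ^+ 6) (v ^+ 4) (x 0 j) =
             coord_label n (E ^+ 6) (v ^+ 4) (y 0 j)) ->
  (bowen_dist phi h x y < e%:E)%E.
Proof.
have v0' := v0; have v1' := v4; have v3' := v3; have v34' := v34; have E4' := E4.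
have EL' := EL; move=> Kx Ky xs ys lab; have xD := KD Kx; have yD := KD Ky.
have [_ phi1] := phiP.
have ndeep0 (z : rV) : ~ deep z -> z != 0.
  by move=> zd; apply/eqP => z0; apply: zd => j; rewrite z0 mxE eqxx.
have x0 := ndeep0 x xs; have y0 := ndeep0 y ys.
have [cov1 f10] := phi1 x xD x0; have [cov2 f20] := phi1 y yD y0.
have [i0 xi0 xS] : exists2 i0, x 0 i0 != 0 & - ln (normc (x 0 i0)) <= E ^+ 2.
  apply: contrapT => nex; apply: xs => j xj.
  rewrite leNgt; apply/negP => lt; apply: nex; exists j => //; exact: ltW.
have v4' : 0 < v ^+ 4 by exact: exprn_gt0.
have v4s : v ^+ 4 <= v / 4.
  apply: le_trans v34; rewrite [leLHS]exprS ler_piMl ?(ltW v3) //; lra.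
have E6 : 4 * E ^+ 5 <= E ^+ 6 by rewrite [leRHS]exprS ler_pM2r // exprn_gt0.
have E5 : 1 <= E ^+ 5 by rewrite exprn_ege1 //; lra.
have E2 : 1 <= E ^+ 2 by rewrite exprn_ege1 //; lra.
have near j : near_coord (E ^+ 6) (v ^+ 4) (x 0 j) (y 0 j).
  apply: (@same_label_near R n) => //; try lra.
  exact: truncnS_gt.
have [L0 Lle] := lambda_star_ratio k1 lam0.
have t34 : 3 / 4 <= t by rewrite tD; lra.
have t1 : t < 1 by rewrite tD; lra.
have r0 : 0 <= r by rewrite rD; lra.
have r1 : r < 1 by rewrite rD; lra.
have SB : E ^+ 2 < E ^+ 6 by apply: ltr_eXn2l => //; lra.
have te : 1 - t = v ^+ 3 by rewrite tD; ring.
have re : 1 - r = v / 2 by rewrite rD; ring.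
have LB : 4 * lambda_star lam * (E ^+ 2 + 1) / (1 - t) <= E ^+ 6.
  rewrite te -exprVn vV.
  apply: (@le_trans _ _ (8 * lambda_star lam * E ^+ 2 * E ^+ 3)).
    rewrite ler_pM2r ?exprn_gt0 //.
    have : lambda_star lam * (E ^+ 2 + 1) <= lambda_star lam * (2 * E ^+ 2).
      by rewrite ler_pM2l //; lra.
    lra.
  by rewrite -mulrA -exprD [leRHS]exprS ler_pM2r // exprn_gt0.
have w12 : v ^+ 4 <= 1 / 2 by lra.
have ws : 2 * v ^+ 4 < s0 * (1 - t).
  rewrite te exprS mulrA ltr_pM2r //.
  by move: Es; rewrite ltr_pdivrMr // => h1; rewrite vE ltr_pdivrMr // mulrC.
have [theta th] := close_leaves lam0 xD yD x0 y0 cov1 cov2 f10 f20 t34 t1 r0 r1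
  xi0 xS L0 Lle SB LB near (s0P Kx) (s0P Ky) (ltW v4') w12 ws.
pose d := 78 * (1 - t) / (1 - r) ^+ 2 + (2 * expR (- (E ^+ 6 / 2)) + 4 * v ^+ 4).
have d320 : d <= 320 * v.
  have e1 : 78 * (1 - t) / (1 - r) ^+ 2 = 312 * v.
    by rewrite te re; field; rewrite gt_eqF.
  have e2 : expR (- (E ^+ 6 / 2)) <= 2 * v.
    rewrite (le_trans (expRN_le_inv _)) ?divr_gt0 ?exprn_gt0 //.
    rewrite invfM invrK mulrC ler_pM2l // vE lef_pV2 ?posrE ?exprn_gt0 //.
    by rewrite -{1}(expr1 E) ler_weXn2l //; lra.
  rewrite /d e1; lra.
have d0 : 0 <= d.
  rewrite /d te !addr_ge0 ?mulr_ge0 ?expR_ge0 ?invr_ge0 ?sqr_ge0 ?ltW //.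
apply: (bowen_dist_lt d0 (kv d320) (theta := theta)) => z; rewrite rE => zr j.
exact: th.
Qed.

(** Centres: the origin for deep points, and one point of [K] for each label which
occurs at another point. *)
Lemma bowen_cover_exists : exists2 N : nat, bowen_cover phi K h e N &
  (N%:R : R) <= E ^+ (34 * k).
Proof.
pose T : finType := option {ffun 'I_k -> 'I_n.+1 * 'I_n.+1 * 'I_n.+1}.
pose lab (x : rV) : T := if `[< deep x >] then None else
  Some [ffun j => coord_label n (E ^+ 6) (v ^+ 4) (x 0 j)].
have zD : polydisc (0 : rV) by move=> j; rewrite mxE normcC0.
have zdeep : deep 0 by move=> j; rewrite mxE eqxx.
have [c cP] : exists c : T -> rV, forall l, polydisc (c l) /\
    forall x, K x -> lab x = l -> (bowen_dist phi h (c l) x < e%:E)%E.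
  have : forall l : T, exists c : rV, polydisc c /\
      forall x, K x -> lab x = l -> (bowen_dist phi h c x < e%:E)%E.
    case=> [l|]; last first.
      exists 0; split => // x Kx; rewrite /lab; case: asboolP => // xdeep _.
      by apply: deep_near_zero => //; exact: KD.
    have [[y Ky yl]|nex] := pselect (exists2 y, K y & lab y = Some l); last first.
      exists 0; split => // x Kx xl; exfalso; apply: nex; by exists x.
    exists y; split; first exact: KD.
    move=> x Kx; rewrite -yl /lab; move: yl; rewrite /lab.
    case: asboolP => // ydeep _; case: asboolP => // xdeep [/ffunP eq].
    apply: same_label_close => // j; have := eq j; by rewrite !ffunE.
  by move=> /choice[c cP]; exists c.
exists #|T|.
  exists (fun i => c (enum_val i)); split; first by move=> i; case: (cP (enum_val i)).
  move=> x Kx; exists (enum_rank (lab x)) => //; rewrite enum_rankK.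
  by split; [exact: KD|case: (cP (lab x)) => _; apply].
apply: label_count => //.
have X0 : 0 <= 2 * E ^+ 6 / v ^+ 4.
  by rewrite divr_ge0 ?mulr_ge0 ?exprn_ge0 // ltW.
have /andP[h1 _] := truncn_itv X0; apply: le_trans h1 _.
by rewrite -exprVn vV -mulrA -exprD.
Qed.

End Cover.

Lemma limf_esup_le (F : R -> \bar R) (a A : R) :
  (forall h : R, A < h -> (F h <= a%:E)%E) ->
  (limf_esup F (pinfty_nbhs R) <= a%:E)%E.
Proof.
move=> FA; apply: (@le_trans _ _ (ereal_sup [set F h | h in [set h | A < h]])).
  apply: ereal_inf_lbound; exists [set h | A < h] => //.
  by exists A; split; [exact: num_real|].
by apply: ge_ereal_sup => _ [h Ah <-]; exact: FA.
Qed.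

End Entropy.

Theorem theorem2p1 (R : realType) (k : nat) (lam : 'I_k -> cplx R)
    (phi : 'rV[cplx R]_k -> cplx R -> 'rV[cplx R]_k)
    (K : set 'rV[cplx R]_k) :
  (1 <= k)%N ->
  (forall j, lam j != 0) ->
  leaf_coverings lam phi ->
  compact K ->
  K `<=` @polydisc R k ->
  (hyperbolic_entropy phi K <= (70 * k%:R * lambda_star lam)%:E)%E.
Proof.
move=> k1 lam0 phiP Kc KD.
have [s0 s00 s0P] := compact_polydisc_bound Kc KD.
have [L0 Lle] := lambda_star_ratio k1 lam0.
have L1 : 1 <= lambda_star lam.
  have := Lle (Ordinal k1) (Ordinal k1).
  by rewrite -{1}(mul1r (normc _)) ler_pM2r // normc_gt0.
apply: ge_ereal_sup => _ [e /= e0 <-].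
pose A0 := 4 + 8 * lambda_star lam + 2 / s0 + 640 * k%:R / e.
have p1 : 0 < 2 / s0 by exact: divr_gt0.
have p2 : 0 <= 640 * k%:R / e by rewrite divr_ge0 ?mulr_ge0 ?ler0n // ltW.
have A00 : 0 < A0 by rewrite /A0; lra.
apply: (@limf_esup_le R _ _ (Num.max 0 (ln A0))) => h.
rewrite gt_max => /andP[h0 hA].
have EA : A0 < expR h by rewrite -[ltLHS]lnK ?posrE // ltr_expR.
have [||||N cov NE] := @bowen_cover_exists R k lam phi K e s0 h k1 lam0 phiP KD e0
  s00 s0P (expR h) (expR h)^-1 _ _ erefl erefl erefl erefl.
- by move: EA; rewrite /A0; lra.
- by move: EA; rewrite /A0; lra.
- by move: EA; rewrite /A0; lra.
- by move: EA; rewrite /A0; lra.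
have B0 : (0 <= bowen_number phi K h e)%E.
  by apply: le_ereal_inf_tmp => _ [m _ <-]; rewrite lee_fin ler0n.
have BN : (bowen_number phi K h e <= (expR h ^+ (34 * k))%:E)%E.
  apply: (@le_trans _ _ (N%:R%:E)%E); last by rewrite lee_fin.
  by apply: ereal_inf_lbound; exists N.
have E0 : 0 < expR h ^+ (34 * k) by rewrite exprn_gt0 // expR_gt0.
have lB : (lne (bowen_number phi K h e) <= ((34 * k)%:R * h)%:E)%E.
  have -> : (34 * k)%:R * h = ln (expR h ^+ (34 * k)).
    by rewrite lnXn ?expR_gt0 // expRK mulr_natl.
  rewrite -lne_EFin // lee_lne // in_itv /= ?lee_fin ?leey ?andbT // ltW //.
apply: (@le_trans _ _ ((h^-1)%:E * ((34 * k)%:R * h)%:E)%E).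
  by rewrite lee_pmul2l // ?lte_fin ?invr_gt0.
rewrite -EFinM lee_fin mulrCA mulVf ?gt_eqF // mulr1 natrM.
have k0 : 0 <= k%:R :> R by rewrite ler0n.
have : 70 * k%:R * 1 <= 70 * k%:R * lambda_star lam :> R.
  by rewrite ler_wpM2l // mulr_ge0.
lra.
Qed.
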